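(* Let $W$ be a random variable with values in $(0,1)$ and let the random probabilities $P=(P_r)_{r\in\mathbb{N}}$ be given by stick-breaking, $P_r=W_1W_2\cdots W_{r-1}(1-W_r)$, $r\in\mathbb{N}$, where $W_1,W_2,\ldots$ are independent copies of $W$. Assume that $\mathbb{E}(\log W)^2<\infty$ and $\mathbb{E}|\log(1-W)|<\infty$. For the nested occupancy scheme generated by $P$, let $K_n(j)$ be the number of occupied boxes in the $j$th generation when $n$ balls have been thrown. Then, for every sequence $(j_n)_{n\in\mathbb{N}}$ of positive integers with $j_n=o((\log n)^{1/2})$ as $n\to\infty$, $$\frac{j_n!\,(\mathbb{E}|\log W|)^{j_n}\,K_n(j_n)}{(\log n)^{j_n}}\ \longrightarrow\ 1\quad\text{in probability as } n\to\infty.$$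
   Context: Nested occupancy scheme. Let $\mathbb{V}=\bigcup_{k\ge 0}\mathbb{N}^k$ be the set of finite words over $\mathbb{N}=\{1,2,\ldots\}$; a word $v=v_1\ldots v_j$ has length (generation) $|v|=j$, and $\varnothing$ is the empty word. Let $((P_r(v))_{r\in\mathbb{N}})_{v\in\mathbb{V}}$ be a family of independent copies of $P=(P_r)_{r\in\mathbb{N}}$ (here $P_r>0$ and $\sum_{r\ge1}P_r=1$ a.s.). Put $P(\varnothing)=1$ and $P(vr)=P(v)P_r(v)$ for $v\in\mathbb{V}$, $r\in\mathbb{N}$. Words are identified with boxes. All $n$ balls start in the box $\varnothing$; given the weights, each ball located in a box $v$ with $|v|=k$ is placed, independently of the other balls, into the box $vr$ with probability $P_r(v)$, and this is repeated for $k=0,1,2,\ldots$. Thus in generation $j$ the $n$ balls are, given the weights, allocated independently with probability $P(v)$ of hitting the box $v$, $|v|=j$. $K_n(j)$ is the number of boxes $v$ with $|v|=j$ that contain at least one of the $n$ balls. *)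

(* Defs.v *)
From mathcomp Require Import all_boot all_order all_algebra finmap.
From mathcomp Require Import all_classical all_reals all_analysis.

Set Implicit Arguments.
Unset Strict Implicit.
Unset Printing Implicit Defensive.

Import Order.TTheory GRing.Theory Num.Theory.
Import numFieldTopology.Exports numFieldNormedType.Exports.

Local Open Scope classical_set_scope.
Local Open Scope ring_scope.

(* Words over {0, 1, 2, ...}: the r-th letter of the usual alphabet
   {1, 2, ...} is encoded by r.-1, and P_(r+1) is the term of index r. *)
Definition word := seq nat.

Section Probability.
Context {d : measure_display} {T : measurableType d} {R : realType}.
Variable P : probability T R.

(* The sigma-algebra generated by the family X *)
Definition sigma_family (I U : Type) (X : I -> U -> R) : set (set U) :=
  <<s \bigcup_i preimage_set_system setT (X i) measurable >>.

Definition independent_classes (I : eqType) (F : I -> set (set T)) : Prop :=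
  forall (s : seq I) (E : I -> set T), uniq s ->
    (forall i, i \in s -> F i (E i)) ->
    P (\bigcap_(i in [set` s]) E i) = (\prod_(i <- s) P (E i))%E.

Definition iid_copies (W : {RV P >-> R}) (X : nat -> {RV P >-> R}) : Prop :=
  (forall r (B : set R), measurable B ->
     distribution P (X r) B = distribution P W B) /\
  independent_classes (fun r => preimage_set_system setT (X r) measurable).

(* Equality in law of X and Y as random elements of R^nat, which carries the
   product sigma-algebra, i.e. the one generated by the coordinate maps *)
Definition same_law (X Y : nat -> T -> R) : Prop :=
  forall B : set (nat -> R), sigma_family (fun r (x : nat -> R) => x r) B ->
    P [set w | B (X ^~ w)] = P [set w | B (Y ^~ w)].

Definition stick_breaking (X : nat -> T -> R) (r : nat) (w : T) : R :=
  (\prod_(l < r) X l w) * (1 - X r w).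

(* C i k is the letter chosen by ball i when it moves from generation k to
   generation k.+1, so that the box of ball i in generation k is the word
   formed by its first k choices. *)
Definition box (C : nat -> nat -> T -> nat) (i k : nat) (w : T) : word :=
  mkseq (fun l => C i l w) k.

Definition at_boxes (C : nat -> nat -> T -> nat) n k (v : 'I_n -> word) :
    set T :=
  [set w | forall i : 'I_n, box C i k w = v i].

Record nested_occupancy (p : nat -> T -> R) (Pw : word -> nat -> {RV P >-> R})
    (C : nat -> nat -> {RV P >-> nat}) : Prop := NestedOccupancy {
  weights_copies : forall v, same_law (fun r => Pw v r) p;
  weights_independent :
    independent_classes (fun v => sigma_family (fun r => Pw v r));
  (* Given all the weights and the boxes v i of the first n balls in
     generation k (these boxes determine their previous history), the balls
     choose their next letters independently, ball i choosing the letter r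
     with probability P_r(v i). *)
  balls_transition : forall (n k : nat) (A : set T) (v : 'I_n -> word)
      (r : 'I_n -> nat),
    sigma_family (fun u : word * nat => Pw u.1 u.2 : T -> R) A ->
    P (A `&` at_boxes C k v `&` [set w | forall i : 'I_n, C i k w = r i]) =
    (\int[P]_(w in A `&` at_boxes C k v)
        (\prod_(i < n) Pw (v i) (r i) w)%:E)%E
}.

(* K_n(j), the number of boxes of generation j containing one of the first n
   balls *)
Definition occupied (C : nat -> nat -> T -> nat) (n j : nat) (w : T) : nat :=
  #|` fset_set [set v : word | size v = j /\
                  exists2 i, (i < n)%N & box C i j w = v] |.

Definition cvg_in_probability (Z : nat -> T -> R) (c : R) : Prop :=
  forall e : R, 0 < e -> P [set w | e < `|Z n w - c|] @[n --> \oo] --> 0%E.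

End Probability.

(* Main.v *)
(* Write xi = |log W|, m = E xi, G_k(t) = t^k / (k! m^k), and let N_j be the
   number of boxes of generation j of weight at least 1/n.  By the many-to-one
   formula, E N_j = A^j 1_{t >= 0} at t = log n, where A f(t) is the mean of the
   sum over r of f(t + log P_r); since P_r = W_1 ... W_(r-1) (1 - W_r), A is a
   renewal potential followed by one extra step |log(1 - W)|.  Explicit super-
   and subsolutions of the renewal equation give
   G_j(log n - j c) <= E N_j <= G_j(log n + j a), and the same supersolutions
   bound the sum over pairs of boxes, hence E N_j^2 <= (1 + O(eps)) G_j(log n)^2
   when j^2 <= eps log n.  Finally K_n(j) differs from N_j by at most the number
   of light boxes that are hit plus the number of heavy boxes that are missed,
   whose mean is O(sum over i < j of G_i) = O(eps G_j(log n)); Chebyshev's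
   inequality concludes. *)
Require Import Defs.
From HB Require Import structures.
From mathcomp Require Import all_boot all_order all_algebra finmap.
From mathcomp Require Import all_classical all_reals all_analysis.
From mathcomp Require Import measurable_realfun ring lra.
Set Implicit Arguments.
Unset Strict Implicit.
Unset Printing Implicit Defensive.
Import Order.TTheory GRing.Theory Num.Theory.
Import numFieldTopology.Exports numFieldNormedType.Exports.
Local Open Scope classical_set_scope.
Local Open Scope ring_scope.

(** * Truncated powers *)

(** Since the generation j grows with n, a constant factor lost per generation would be fatal. Every
    renewal error is therefore turned into a shift of the argument: by convexity a lower-order term
    [c x^k] is absorbed into [(x + a)^(k+1)]. After j generations the total shift is of order j and
    changes [G_j(log n)] by a factor [(1 + O(j / log n))^j = 1 + O(j^2 / log n)], which is what the
    growth condition on [j_n] controls. For this to work, the renewal estimate for [t^k] must have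
    an error constant independent of k. No renewal theorem is invoked, and [|log W|] may be lattice.
    A nonnegative supersolution dominates the potential because the remainder of the iteration is
    nonnegative; for a subsolution the remainder is killed by [E exp (- xi) = E W < 1]. In the
    supersolutions for powers, the error of one step is paid for by the bounded quantity
    [1 - W <= xi], whose mean [1 - rho] is positive; this is the origin of [kap = 1 / (1 - rho)]. *)

Section Elementary.
Variable R : realFieldType.
Implicit Types (b t u x y z s : R) (k n : nat).

Lemma bernoulli_ineq n x : -1 <= x -> 1 + n%:R * x <= (1 + x) ^+ n.
Proof.
move=> x1; elim: n => [|n IH]; first by rewrite mul0r addr0 expr0.
have x0 : 0 <= 1 + x by lra.
have := ler_wpM2l x0 IH; rewrite -exprS; apply: le_trans.
rewrite -natr1; have : 0 <= n%:R * x ^+ 2 by rewrite mulr_ge0 ?sqr_ge0 ?ler0n.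
by rewrite expr2; nra.
Qed.

(** Convexity: the power lies above its tangent at [z]. Applied at [x + a] and [x], it absorbs an
    error [n.+1 a x^n] into a shift by [a]. *)
Lemma tangent_pow n x z : 0 <= x -> 0 <= z ->
  z ^+ n.+1 + n.+1%:R * z ^+ n * (x - z) <= x ^+ n.+1.
Proof.
move=> x0 z0; elim: n => [|n IH]; first by rewrite !expr1 expr0; lra.
have zn : 0 <= z ^+ n by rewrite exprn_ge0.
have nn : 0 <= n.+1%:R :> R by rewrite ler0n.
have := ler_wpM2l x0 IH; rewrite -exprS; apply: le_trans.
rewrite -(natr1 n.+1) !(exprS z n.+1) !(exprS z n).
have : 0 <= n.+1%:R * z ^+ n * (x - z) ^+ 2.
  by rewrite mulr_ge0 ?sqr_ge0 // mulr_ge0.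
rewrite expr2; set N := n.+1%:R; set Z := z ^+ n; move=> H.
rewrite -subr_ge0; apply: le_trans H _; rewrite le_eqVlt; apply/orP; left; apply/eqP.
ring.
Qed.

(** The cut stays at 0 and not at [- b]: a larger [b] increases the function without enlarging its
    support. For [b = k = 0] it is the indicator that marks the heavy boxes at level
    [t = ln (n p)]. *)
Definition tpow b k t : R := if 0 <= t then (t + b) ^+ k else 0.

Lemma tpow_ge0 b k t : 0 <= b -> 0 <= tpow b k t.
Proof. by move=> b0; rewrite /tpow; case: ifP => // t0; rewrite exprn_ge0 ?addr_ge0. Qed.

Lemma le_tpow b k : 0 <= b -> {homo tpow b k : s t / s <= t}.
Proof.
move=> b0 s t st; rewrite {1}/tpow; case: ifPn => s0; last exact: tpow_ge0.
by rewrite /tpow (le_trans s0 st) lerXn2r ?nnegrE ?addr_ge0 ?lerD2r // (le_trans s0).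
Qed.

Lemma tpow_lt0 b k t : t < 0 -> tpow b k t = 0.
Proof. by rewrite /tpow ltNge => /negbTE ->. Qed.

Lemma tpowE0 k t : 0 <= t -> tpow 0 k t = t ^+ k.
Proof. by rewrite /tpow => ->; rewrite addr0. Qed.

(** Bernoulli for [1 + u] together with [(1 - u) (1 + u) <= 1]; a division-free form of
    [(1 - u)^n <= 1 / (1 + n u)]. *)
Lemma pow1B_le n u : 0 <= u <= 1 -> (1 - u) ^+ n * (1 + n%:R * u) <= 1.
Proof.
move=> /andP[u0 u1].
apply: (@le_trans _ _ ((1 - u) ^+ n * (1 + u) ^+ n)).
  by rewrite ler_wpM2l ?exprn_ge0 ?subr_ge0// bernoulli_ineq //; lra.
rewrite -exprMn exprn_ile1 //; nra.
Qed.

Lemma tpow_scale k t u : 0 < t -> 0 <= u ->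
  tpow 0 k (t - t * u) = t ^+ k * tpow 0 k (1 - u).
Proof.
move=> t0 u0; rewrite /tpow.
have -> : t - t * u = t * (1 - u) by ring.
rewrite pmulr_rge0 //; case: ifP => _; last by rewrite mulr0.
by rewrite !addr0 exprMn.
Qed.

(* s stands for min (1, k / t). *)
Lemma tpow_drop_main k t y s : (0 < k)%N -> 0 < t -> 0 <= y -> 0 <= s ->
  s = 1 \/ (s * t = k%:R) ->
  tpow 0 k.+1 (t - y) / k.+1%:R
   <= t ^+ k.+1 / k.+1%:R - t ^+ k * y + t ^+ k * (s * (y + 2 * y ^+ 2)).
Proof.
move=> k0 t0 y0 s0 hs.
pose u := y / t; have yE : y = t * u by rewrite /u mulrCA divff ?mulr1 // gt_eqF.
have u0 : 0 <= u by rewrite /u divr_ge0 // ltW.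
rewrite yE tpow_scale // (exprS t k).
set n : R := k.+1%:R; have n0 : 0 < n by rewrite ltr0n.
have nE : n = k%:R + 1 by rewrite natr1.
have k1 : 1 <= k%:R :> R by rewrite ler1n.
have tk : 0 < t ^+ k by rewrite exprn_gt0.
have -> : t * t ^+ k * tpow 0 k.+1 (1 - u) / n = t ^+ k * (t * (tpow 0 k.+1 (1 - u) / n)) by ring.
have -> : t * t ^+ k / n - t ^+ k * (t * u) + t ^+ k * (s * (t * u + 2 * (t * u) ^+ 2)) =
   t ^+ k * (t * (n^-1 - u + (s * (u + 2 * t * u ^+ 2)))) by ring.
rewrite ler_pM2l // ler_pM2l //.
have [u1|u1] := leP u 1.
  have H : (1 - u) ^+ k.+1 * (1 + n * u) <= 1 by apply: pow1B_le; rewrite u0.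
  rewrite tpowE0 ?subr_ge0 //.
  have q0 : 0 <= (1 - u) ^+ k.+1 by rewrite exprn_ge0 ?subr_ge0.
  rewrite ler_pdivrMr // mulrDl mulrBl mulVf ?gt_eqF //.
  case: hs => [->|hs].
    have : 0 <= t * u ^+ 2 * n by apply: mulr_ge0 (mulr_ge0 (ltW t0) (sqr_ge0 u)) (ltW n0).
    have : (1 - u) ^+ k.+1 <= 1 by apply: exprn_ile1; lra.
    nra.
  have -> : s * (u + 2 * t * u ^+ 2) = s * u + 2 * k%:R * u ^+ 2 by rewrite -hs; ring.
  have su : 0 <= s * u * n by apply: mulr_ge0 (mulr_ge0 s0 u0) (ltW n0).
  (* With [v = n u] this is [1 / (1 + v) <= 1 - v + v^2], which holds because
     [(1 - v + v^2) (1 + v) = 1 + v^3]. *)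
  have H2 : (1 - u) ^+ k.+1 <= 1 - n * u + n ^+ 2 * u ^+ 2.
    set Q := (1 - u) ^+ k.+1 in H q0 *.
    have nu : 0 <= n * u by rewrite mulr_ge0 // ltW.
    have D : 0 < 1 + n * u by lra.
    rewrite -(ler_pM2r D) (le_trans H) //.
    have -> : (1 - n * u + n ^+ 2 * u ^+ 2) * (1 + n * u) = 1 + (n * u) ^+ 3 by ring.
    by rewrite lerDl exprn_ge0.
  apply: (le_trans H2).
  (* Here [n = k + 1 <= 2 k], as [k] is positive: this is the origin of the 2 in front of
     [y ^+ 2]. *)
  have : n ^+ 2 * u ^+ 2 <= 2 * k%:R * u ^+ 2 * n.
    have -> : n ^+ 2 * u ^+ 2 = (n * u ^+ 2) * n by ring.
    rewrite (ler_pM2r n0) ler_wpM2r ?sqr_ge0 //; lra.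
  by rewrite mulrDl; lra.
rewrite tpow_lt0 ?subr_lt0 // mul0r.
have: 0 <= n^-1 by rewrite invr_ge0 ltW.
move: (n^-1) => ni ni0.
case: hs => [->|hs].
  have : 0 <= t * u ^+ 2 by apply: mulr_ge0 (ltW t0) (sqr_ge0 u).
  nra.
have -> : s * (u + 2 * t * u ^+ 2) = s * u + 2 * k%:R * u ^+ 2 by rewrite -hs; ring.
have : 0 <= s * u by rewrite mulr_ge0.
have : u <= u ^+ 2 by rewrite expr2 ler_peMl // ltW.
have : u ^+ 2 <= k%:R * u ^+ 2 by rewrite ler_peMl ?sqr_ge0.
nra.
Qed.

(** Put [p = s z]; then [p <= 1] and [p <= k y / t], so [pow1B_le] bounds the ratio by
    [1 / (1 + p) <= 1 - p / 2]. In use [y] is [xi] and [z] is [1 - W]. The decrease carries the same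
    factor [s] as the error in [tpow_drop_main], so a constant multiple of it can pay for that
    error. *)
Lemma tpow_drop_low k t y s z : (0 < k)%N -> 0 < t -> 0 <= y -> 0 <= s <= 1 ->
  s * t <= k%:R -> 0 <= z -> z <= 1 -> z <= y ->
  tpow 0 k (t - y) <= t ^+ k - t ^+ k * (s * z / 2).
Proof.
move=> k0 t0 y0 /andP[s0 s1] st z0 z1 zy.
pose u := y / t; have yE : y = t * u by rewrite /u mulrCA divff ?mulr1 // gt_eqF.
have u0 : 0 <= u by rewrite /u divr_ge0 // ltW.
have tk : 0 < t ^+ k by rewrite exprn_gt0.
rewrite yE tpow_scale //.
have -> : t ^+ k - t ^+ k * (s * z / 2) = t ^+ k * (1 - s * z / 2) by ring.
rewrite ler_pM2l //.
have sz1 : s * z <= 1 by nra.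
have sz0 : 0 <= s * z by rewrite mulr_ge0.
have k1 : 1 <= k%:R :> R by rewrite ler1n.
have szk : s * z <= k%:R * u.
  apply: (@le_trans _ _ (s * y)); first by rewrite ler_wpM2l.
  by rewrite yE mulrA ler_wpM2r.
have [u1|u1] := leP u 1; last by rewrite tpow_lt0 ?subr_lt0 //; lra.
have H : (1 - u) ^+ k * (1 + k%:R * u) <= 1 by apply: pow1B_le; rewrite u0.
rewrite tpowE0 ?subr_ge0 //.
have ku : 0 <= k%:R * u by rewrite mulr_ge0.
have D : 0 < 1 + k%:R * u by lra.
rewrite -(ler_pM2r D) (le_trans H) //.
set p := s * z in sz1 sz0 szk *; set v := k%:R * u in szk ku D *.
nra.
Qed.

(** On [0 <= t] the slope in [t] is [2 max 0 (x - t)], twice the overshoot of a step [x] over the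
    level [t]. The added 1 gives a jump at 0 large enough for [gap_drop] to hold when the step ends
    below 0. *)
Definition gap x t : R := if 0 <= t then (x + 1) ^+ 2 - Num.max 0 (x - t) ^+ 2 else 0.

Lemma gap_ge0 x t : 0 <= x -> 0 <= gap x t.
Proof.
move=> x0; rewrite /gap; case: ifP => // t0; rewrite subr_ge0 lerXn2r ?nnegrE //.
- by rewrite le_max lexx.
- lra.
- by rewrite ge_max; apply/andP; split; lra.
Qed.

Lemma gap_le x t : gap x t <= (x + 1) ^+ 2.
Proof.
rewrite /gap; case: ifP => _; last exact: sqr_ge0.
by rewrite gerBl sqr_ge0.
Qed.

(** The slope of [gap x] is nonincreasing on the positive axis, so over a step [y] the function
    falls by at least [y] times its slope at [t]. If the step ends below 0, the whole value is lost,
    and with [v = x - t] the bound [v^2 + 2 z v <= (v + 1)^2] suffices; this is where [z <= 1]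
    enters. *)
Lemma gap_drop x t y z : 0 <= x -> 0 <= t -> 0 <= y -> 0 <= z -> z <= 1 ->
  z <= y -> gap x (t - y) + 2 * z * Num.max 0 (x - t) <= gap x t.
Proof.
move=> x0 t0 y0 z0 z1 zy; rewrite /gap t0.
have [xt|xt] := leP x t.
  have -> : Num.max 0 (x - t) = 0 by apply/max_idPl; lra.
  rewrite mulr0 addr0 expr0n subr0; case: ifP => _; last exact: sqr_ge0.
  by rewrite gerBl sqr_ge0.
have -> : Num.max 0 (x - t) = x - t by rewrite max_r; lra.
case: ifPn => ty.
  have -> : Num.max 0 (x - (t - y)) = x - t + y by rewrite max_r; lra.
  nra.
nra.
Qed.

Lemma gap_mono x : 0 <= x -> {homo gap x : s t / s <= t}.
Proof.
move=> x0 s t st; rewrite {1}/gap; case: ifPn => s0; last exact: gap_ge0.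
rewrite /gap (le_trans s0 st) lerB //; apply: lerXn2r.
- by rewrite nnegrE le_max lexx.
- by rewrite nnegrE le_max lexx.
- by rewrite ge_max !le_max lexx /= lerB ?orbT.
Qed.

Lemma tpow_step k t y : 0 <= y ->
  tpow 0 k.+1 t <= tpow 0 k.+1 (t - y) + k.+1%:R * y * tpow 0 k t.
Proof.
move=> y0; have [t0|t0] := ltP t 0; first by rewrite !tpow_lt0 //; lra.
rewrite !(tpowE0 _ t0).
have [ty|ty] := leP y t.
  rewrite tpowE0 ?subr_ge0 //.
  have := @tangent_pow k (t - y) t; rewrite subr_ge0 => /(_ ty t0); lra.
rewrite tpow_lt0 ?subr_lt0 // add0r exprS ler_wpM2r ?exprn_ge0 //.
have : 1 <= k.+1%:R :> R by rewrite ler1n.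
nra.
Qed.

(** Truncation costs nothing: for negative [x] the tangent at [z] is already nonpositive, since
    [k.+1 (x - z) <= - z]. *)
Lemma tpow_tangent k x z : 0 <= z ->
  z ^+ k.+1 + k.+1%:R * z ^+ k * (x - z) <= tpow 0 k.+1 x.
Proof.
move=> z0; have [x0|x0] := leP 0 x; first by rewrite tpowE0 // tangent_pow.
rewrite tpow_lt0 // exprS -subr_le0.
have zk : 0 <= z ^+ k by rewrite exprn_ge0.
have k1 : 1 <= k.+1%:R :> R by rewrite ler1n.
have -> : z * z ^+ k + k.+1%:R * z ^+ k * (x - z) - 0 = z ^+ k * (z + k.+1%:R * (x - z)) by ring.
rewrite mulr_ge0_le0 //; nra.
Qed.

End Elementary.

(** * Factorial asymptotics *)

Section Asymptotics.
Variable R : realFieldType.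
Implicit Types (x z m L a c s eps : R) (i j k n : nat).

Lemma geometric_sum_le n z : 0 <= z -> z < 1 -> (\sum_(i < n) z ^+ i) * (1 - z) <= 1.
Proof.
move=> z0 z1; have -> : (\sum_(i < n) z ^+ i) * (1 - z) = 1 - z ^+ n.
  elim: n => [|n IH]; first by rewrite big_ord0 expr0; ring.
  by rewrite big_ord_recr /= mulrDl IH exprS; ring.
by rewrite gerBl exprn_ge0.
Qed.

Lemma pow1D_le n x : 0 <= x -> n%:R * x <= 1 -> (1 + x) ^+ n * (1 - n%:R * x) <= 1.
Proof.
move=> x0 nx; case: n nx => [|n] nx; first by rewrite mul0r subr0 mulr1.
have n1 : 1 <= n.+1%:R :> R by rewrite ler1n.
have x1 : x <= 1 by apply: le_trans nx; rewrite ler_peMl.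
apply: (@le_trans _ _ ((1 + x) ^+ n.+1 * (1 - x) ^+ n.+1)).
  rewrite ler_wpM2l ?exprn_ge0 ?addr_ge0 //.
  by have := @bernoulli_ineq R n.+1 (- x); rewrite mulrN; apply; lra.
rewrite -exprMn exprn_ile1 //; nra.
Qed.

Definition gterm m k x : R := x ^+ k / (k`!%:R * m ^+ k).

Lemma fact_ne0 k : (k`!%:R : R) != 0.
Proof. by rewrite pnatr_eq0 -lt0n fact_gt0. Qed.

Lemma gterm_ge0 m k x : 0 < m -> 0 <= x -> 0 <= gterm m k x.
Proof.
by move=> m0 x0; rewrite divr_ge0 ?exprn_ge0 // mulr_ge0 ?exprn_ge0 // ltW.
Qed.

Lemma gterm_gt0 m k x : 0 < m -> 0 < x -> 0 < gterm m k x.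
Proof.
by move=> m0 x0; rewrite divr_gt0 ?exprn_gt0 // mulr_gt0 ?exprn_gt0 // ltr0n fact_gt0.
Qed.

Lemma le_gterm m k x y : 0 < m -> 0 <= x -> x <= y -> gterm m k x <= gterm m k y.
Proof.
move=> m0 x0 xy; rewrite ler_wpM2r ?invr_ge0 ?mulr_ge0 ?exprn_ge0 ?(ltW m0) //.
by rewrite lerXn2r ?nnegrE // (le_trans x0).
Qed.

(** Consecutive terms have ratio [i.+1 m / x], and this is at most [j m / x] for every index below
    [j]. *)
Lemma gterm_drop m j k x : 0 < m -> 0 < x -> (k <= j)%N ->
  gterm m (j - k) x <= gterm m j x * (j%:R * m / x) ^+ k.
Proof.
move=> m0 x0; elim: k => [|k IH] kj; first by rewrite subn0 expr0 mulr1.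
have := IH (ltnW kj); rewrite -(subnSK kj); set i := (j - k.+1)%N => H.
have ij : (i.+1%:R : R) <= j%:R by rewrite ler_nat /i subnSK // leq_subr.
have -> : gterm m i x = (i.+1%:R * m / x) * gterm m i.+1 x.
  rewrite /gterm factS natrM !exprS; have f0 := fact_ne0 i.
  have i0 : (i.+1%:R : R) != 0 by rewrite pnatr_eq0.
  have mi : m ^+ i != 0 by rewrite expf_neq0 // gt_eqF.
  by field; rewrite !nat1r mi f0 i0 !gt_eqF.
have z0 : 0 <= i.+1%:R * m / x by rewrite divr_ge0 ?mulr_ge0 // ltW.
apply: le_trans (ler_wpM2l z0 H) _.
rewrite [leLHS]mulrC exprSr [leRHS]mulrA; apply: ler_wpM2l.
  by rewrite mulr_ge0 ?gterm_ge0 ?exprn_ge0 ?divr_ge0 ?mulr_ge0 ?(ltW m0) ?(ltW x0).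
by rewrite ler_wpM2r ?invr_ge0 ?(ltW x0) // ler_wpM2r // ltW.
Qed.

Lemma gterm_le_pow m k x : 0 < m -> 0 <= x -> gterm m k x <= (x / m) ^+ k.
Proof.
move=> m0 x0; rewrite /gterm expr_div_n invfM mulrCA ler_piMl //.
  by rewrite mulr_ge0 ?exprn_ge0 // invr_ge0 exprn_ge0 // ltW.
by rewrite invf_le1 ?ltr0n ?fact_gt0 // ler1n fact_gt0.
Qed.

Lemma gterm_sum m j x z : 0 < m -> 0 < x -> j%:R * m / x <= z -> z < 1 ->
  (\sum_(i < j) gterm m i x) * (1 - z) <= gterm m j x * z.
Proof.
move=> m0 x0 jz z1.
have jm0 : 0 <= j%:R * m / x by rewrite divr_ge0 ?mulr_ge0 // ltW.
have z0 : 0 <= z by apply: le_trans jz.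
have gj := gterm_ge0 j m0 (ltW x0).
apply: (@le_trans _ _ ((\sum_(i < j) gterm m j x * z * z ^+ i) * (1 - z))).
  rewrite ler_wpM2r ?subr_ge0 ?(ltW z1) // (reindex_inj rev_ord_inj) /=.
  apply: ler_sum => i _; apply: le_trans (gterm_drop m0 x0 (ltn_ord i)) _.
  by rewrite -[leRHS]mulrA -exprS; apply: ler_wpM2l => //; rewrite lerXn2r ?nnegrE.
rewrite -mulr_sumr -mulrA; apply: ler_piMr; first exact: mulr_ge0.
exact: geometric_sum_le.
Qed.

(** The index [i] will be the generation of the last common ancestor of two boxes. Bounding
    [gterm m i x] crudely by [(x / m)^i] and the square by [gterm_drop] leaves
    [((x / m) (j m / x)^2)^i = (j^2 m / x)^i], a geometric series whose ratio is small when [j^2] is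
    small against [x]. *)
Lemma gterm_convolution m j x s : 0 < m -> 0 < x -> j%:R ^+ 2 * m / x <= s -> s < 1 ->
  (\sum_(i < j.+1) gterm m i x * gterm m (j - i) x ^+ 2) * (1 - s) <= gterm m j x ^+ 2.
Proof.
move=> m0 x0 js s1.
have q0 : 0 <= j%:R ^+ 2 * m / x by rewrite divr_ge0 ?mulr_ge0 ?exprn_ge0 // ltW.
have s0 : 0 <= s by apply: le_trans js.
have gj := gterm_ge0 j m0 (ltW x0).
apply: (@le_trans _ _ ((\sum_(i < j.+1) gterm m j x ^+ 2 * s ^+ i) * (1 - s))).
  rewrite ler_wpM2r ?subr_ge0 ?(ltW s1) //; apply: ler_sum => i _.
  have ij : (i <= j)%N by rewrite -ltnS.
  have z0 : 0 <= j%:R * m / x by rewrite divr_ge0 ?mulr_ge0 // ltW.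
  have H1 := gterm_le_pow i m0 (ltW x0).
  have H2 : gterm m (j - i) x ^+ 2 <= (gterm m j x * (j%:R * m / x) ^+ i) ^+ 2.
    apply: lerXn2r; last exact: gterm_drop.
      by rewrite nnegrE; apply: gterm_ge0 => //; exact: ltW.
    by rewrite nnegrE; apply: mulr_ge0 => //; exact: exprn_ge0.
  have gi := gterm_ge0 i m0 (ltW x0).
  apply: le_trans (ler_pM gi (sqr_ge0 _) H1 H2) _.
  have -> : (x / m) ^+ i * (gterm m j x * (j%:R * m / x) ^+ i) ^+ 2 =
     gterm m j x ^+ 2 * (j%:R ^+ 2 * m / x) ^+ i.
    have -> : j%:R ^+ 2 * m / x = (x / m) * (j%:R * m / x) ^+ 2.
      by field; rewrite !gt_eqF.
    move: (gterm m j x) (j%:R * m / x) (x / m) => g z y.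
    by rewrite [(y * z ^+ 2) ^+ i]exprMn [(z ^+ 2) ^+ i]exprAC; ring.
  by rewrite ler_wpM2l ?exprn_ge0 // lerXn2r ?nnegrE.
rewrite -mulr_sumr -mulrA ler_piMr ?exprn_ge0 //.
exact: geometric_sum_le.
Qed.

(** The shift multiplies the term by [(1 + j.+1 a / L)^j], and [j (j + 1) a / L <= 2 a j^2 / L <= 2
    a eps]. *)
Lemma gterm_shift_le m j L a eps : 0 < m -> 0 < L -> 0 <= a -> (0 < j)%N ->
  j%:R ^+ 2 <= eps * L -> 2 * a * eps <= 1 ->
  gterm m j (L + j.+1%:R * a) * (1 - 2 * a * eps) <= gterm m j L.
Proof.
move=> m0 L0 a0 j0 jL ae.
pose x := j.+1%:R * a / L.
have x0 : 0 <= x by rewrite divr_ge0 ?mulr_ge0 // ltW.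
have j1 : 1 <= j%:R :> R by rewrite ler1n.
have jx : j%:R * x <= 2 * a * eps.
  rewrite /x mulrA ler_pdivrMr // -natr1.
  have : a * (j%:R ^+ 2) <= a * (eps * L) by rewrite ler_wpM2l.
  have : a * j%:R <= a * j%:R ^+ 2 by rewrite ler_wpM2l // expr2 ler_peMl ?ler0n.
  rewrite !expr2; nra.
have -> : gterm m j (L + j.+1%:R * a) = gterm m j L * (1 + x) ^+ j.
  rewrite /gterm mulrAC -exprMn; congr (_ ^+ _ / _); rewrite /x; field.
  by rewrite gt_eqF.
have g0 := gterm_ge0 j m0 (ltW L0).
rewrite -mulrA ler_piMr //.
apply: le_trans (pow1D_le x0 _); last exact: le_trans jx ae.
by rewrite ler_wpM2l ?exprn_ge0 ?addr_ge0 // lerB.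
Qed.

(** Bernoulli for [1 - j c / L]. The first conclusion keeps the shifted argument in the support of
    [tpow]. *)
Lemma gterm_low m j L c eps : 0 < m -> 0 < L -> 0 <= c -> (0 < j)%N ->
  j%:R ^+ 2 <= eps * L -> c * eps <= 1 ->
  j%:R * c <= L /\ gterm m j L * (1 - c * eps) <= gterm m j (L - j%:R * c).
Proof.
move=> m0 L0 c0 j0 jL ce.
have j1 : 1 <= j%:R :> R by rewrite ler1n.
have jc : j%:R * c <= L.
  have : c * (j%:R ^+ 2) <= c * (eps * L) by rewrite ler_wpM2l.
  have : c * j%:R <= c * j%:R ^+ 2 by rewrite ler_wpM2l // expr2 ler_peMl ?ler0n.
  have : c * eps * L <= 1 * L by rewrite ler_wpM2r // ltW.
  rewrite !expr2; nra.
split=> //; pose x := j%:R * c / L.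
have -> : gterm m j (L - j%:R * c) = gterm m j L * (1 - x) ^+ j.
  rewrite /gterm mulrAC -exprMn; congr (_ ^+ _ / _); rewrite /x; field.
  by rewrite gt_eqF.
have x1 : x <= 1 by rewrite ler_pdivrMr // mul1r.
rewrite ler_wpM2l ?gterm_ge0 ?(ltW L0) //.
have H := @bernoulli_ineq R j (- x); rewrite mulrN in H.
apply: le_trans (H _); last by lra.
rewrite lerB // /x mulrA ler_pdivrMr //.
have : c * (j%:R ^+ 2) <= c * (eps * L) by rewrite ler_wpM2l.
by rewrite expr2; nra.
Qed.

Lemma gterm_sum_small m j L a eps : 0 < m -> 0 < L -> 0 <= a -> (0 < j)%N -> 0 <= eps ->
  j%:R ^+ 2 <= eps * L -> (4 * a + m) * eps <= 1 / 2 ->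
  \sum_(i < j) gterm m i (L + j.+1%:R * a) <= 2 * m * eps * gterm m j L.
Proof.
move=> m0 L0 a0 j0 e0 jL H.
set x := L + j.+1%:R * a.
have xL : L <= x by rewrite lerDl mulr_ge0.
have x0 : 0 < x by apply: lt_le_trans xL.
have j1 : 1 <= j%:R :> R by rewrite ler1n.
have ae : 0 <= a * eps by rewrite mulr_ge0.
have me : 0 <= m * eps by rewrite mulr_ge0 // ltW.
have jz : j%:R * m / x <= m * eps.
  rewrite ler_pdivrMr // mulrC -mulrA ler_wpM2l ?(ltW m0) //.
  apply: (@le_trans _ _ (eps * L)); last by rewrite ler_wpM2l.
  by apply: le_trans jL; rewrite expr2 ler_peMl ?ler0n.
have z1 : m * eps < 1 by lra.
have H1 := gterm_sum m0 x0 jz z1.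
have ae1 : 2 * a * eps <= 1 by lra.
have H2 := gterm_shift_le m0 L0 a0 j0 jL ae1; rewrite -/x in H2.
have G0 := gterm_ge0 j m0 (ltW L0).
set S := \sum_(i < j) _ in H1 *; set g := gterm m j x in H1 H2.
set Gj := gterm m j L in H2 G0 *.
have S0 : 0 <= S by apply: sumr_ge0 => i _; rewrite gterm_ge0 // ltW.
have H3 : S * ((1 - m * eps) * (1 - 2 * a * eps)) <= m * eps * Gj.
  rewrite mulrA; apply: (@le_trans _ _ (g * (m * eps) * (1 - 2 * a * eps))).
    by rewrite ler_wpM2r // subr_ge0.
  by rewrite mulrAC mulrC ler_wpM2l.
have H4 : 1 / 2 <= (1 - m * eps) * (1 - 2 * a * eps) by nra.
have : S * (1 / 2) <= S * ((1 - m * eps) * (1 - 2 * a * eps)) by rewrite ler_wpM2l.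
lra.
Qed.

Lemma gterm_convolution_le m j L a eps : 0 < m -> 0 < L -> 0 <= a -> (0 < j)%N -> 0 <= eps ->
  j%:R ^+ 2 <= eps * L -> (4 * a + m) * eps <= 1 / 2 ->
  \sum_(i < j.+1) gterm m i (L + j.+1%:R * a) * gterm m (j - i) (L + j.+1%:R * a) ^+ 2
   <= (1 + 2 * (4 * a + m) * eps) * gterm m j L ^+ 2.
Proof.
move=> m0 L0 a0 j0 e0 jL H.
set x := L + j.+1%:R * a.
have xL : L <= x by rewrite lerDl mulr_ge0.
have x0 : 0 < x by apply: lt_le_trans xL.
have ae : 0 <= a * eps by rewrite mulr_ge0.
have me : 0 <= m * eps by rewrite mulr_ge0 // ltW.
have js : j%:R ^+ 2 * m / x <= m * eps.
  rewrite ler_pdivrMr // mulrC -mulrA ler_wpM2l ?(ltW m0) //.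
  by apply: le_trans jL _; rewrite ler_wpM2l.
have s1 : m * eps < 1 by lra.
have H1 := gterm_convolution m0 x0 js s1.
have ae1 : 2 * a * eps <= 1 by lra.
have H2 := gterm_shift_le m0 L0 a0 j0 jL ae1; rewrite -/x in H2.
have G0 := gterm_ge0 j m0 (ltW L0).
have g0 := gterm_ge0 j m0 (ltW x0).
set S := \sum_(i < j.+1) _ in H1 *; set g := gterm m j x in H1 H2 g0.
set Gj := gterm m j L in H2 G0 *.
have S0 : 0 <= S.
  by apply: sumr_ge0 => i _; apply: mulr_ge0 (gterm_ge0 _ m0 (ltW x0)) (sqr_ge0 _).
have q0 : 0 <= 1 - 2 * a * eps by rewrite subr_ge0.
have H3 : S * ((1 - m * eps) * (1 - 2 * a * eps) ^+ 2) <= Gj ^+ 2.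
  rewrite mulrA; apply: (@le_trans _ _ (g ^+ 2 * (1 - 2 * a * eps) ^+ 2)).
    by rewrite ler_wpM2r // exprn_ge0.
  by rewrite -exprMn; apply: lerXn2r; rewrite ?nnegrE //; exact: mulr_ge0.
(* The loss [2 a eps] of the shift counts twice because the term is squared, and [m eps] comes from
   the geometric series. Then [1 / (1 - t) <= 1 + 2 t] on [[0, 1/2]]. *)
set t := (4 * a + m) * eps in H.
have t0 : 0 <= t by rewrite /t mulrDl; lra.
have H4 : 1 - t <= (1 - m * eps) * (1 - 2 * a * eps) ^+ 2.
  have E : 1 - 4 * (a * eps) <= (1 - 2 * a * eps) ^+ 2 by rewrite expr2; nra.
  apply: (@le_trans _ _ ((1 - m * eps) * (1 - 4 * (a * eps)))); last first.
    by rewrite ler_wpM2l // subr_ge0 ltW.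
  by rewrite /t; nra.
have H5 : S * (1 - t) <= Gj ^+ 2 by apply: le_trans H3; rewrite ler_wpM2l.
have -> : 1 + 2 * (4 * a + m) * eps = 1 + 2 * t by rewrite /t; ring.
have G20 : 0 <= Gj ^+ 2 by rewrite exprn_ge0.
have H6 : 1 <= (1 + 2 * t) * (1 - t) by nra.
have H7 : S * 1 <= S * ((1 + 2 * t) * (1 - t)) by rewrite ler_wpM2l.
have H8 : (1 + 2 * t) * (S * (1 - t)) <= (1 + 2 * t) * Gj ^+ 2.
  by rewrite ler_wpM2l //; lra.
lra.
Qed.

End Asymptotics.

(** * Renewal operators *)

Definition borel_ge0 {R : realType} (f : R -> \bar R) :=
  measurable_fun setT f /\ forall t, (0 <= f t)%E.

Section BorelGe0.
Context {R : realType}.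
Implicit Types f g : R -> \bar R.

Lemma borel_ge0D f g : borel_ge0 f -> borel_ge0 g -> borel_ge0 (f \+ g)%E.
Proof.
move=> [mf f0] [mg g0]; split; first exact: emeasurable_funD.
by move=> t; apply: adde_ge0.
Qed.

Lemma borel_ge0M f g : borel_ge0 f -> borel_ge0 g -> borel_ge0 (f \* g)%E.
Proof.
move=> [mf f0] [mg g0]; split; first exact: emeasurable_funM.
by move=> t; apply: mule_ge0.
Qed.

Lemma borel_ge0_series (f : nat -> R -> \bar R) : (forall r, borel_ge0 (f r)) ->
  borel_ge0 (fun t => \sum_(r <oo) f r t)%E.
Proof.
move=> h; split; last by move=> t; apply: nneseries_ge0 => r _ _; exact: (h r).2.
apply: ge0_emeasurable_sum => [k x _ _|k _]; [exact: (h k).2|exact: (h k).1].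
Qed.

Lemma borel_ge0_nondecreasing (f : R -> R) :
  {homo f : s t / s <= t} -> (forall t, 0 <= f t) -> borel_ge0 (EFin \o f).
Proof.
move=> hf f0; split; last by move=> t; rewrite lee_fin.
apply/measurable_EFinP; exact: nondecreasing_measurable.
Qed.

End BorelGe0.

Section Shift.
Context {d : measure_display} {T : measurableType d} {R : realType}.
Variable P : probability T R.
Local Open Scope ereal_scope.

Definition stepE (X : T -> R) (f : R -> \bar R) (t : R) : \bar R :=
  \int[P]_w f (t - X w)%R.

Variable X : T -> R.
Hypothesis mX : measurable_fun setT X.
Implicit Types f g : R -> \bar R.

Lemma measurable_sub t : measurable_fun setT (fun w => t - X w)%R.
Proof. by apply: measurable_funB. Qed.

Lemma measurable_stepE_fun f t : borel_ge0 f ->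
  measurable_fun setT (fun w => f (t - X w)%R).
Proof. by move=> [mf _]; apply: measurableT_comp => //; exact: measurable_sub. Qed.

Lemma borel_ge0_stepE f : borel_ge0 f -> borel_ge0 (stepE X f).
Proof.
move=> [mf f0]; split; last by move=> t; exact: integral_ge0.
pose F (z : R * T) := f (z.1 - X z.2)%R.
have mF : measurable_fun setT F.
  apply: measurableT_comp => //; apply: measurable_funB => //.
  exact: measurableT_comp.
have := @measurable_fun_fubini_tonelli_F _ _ _ _ _ P F mF.
by apply => z; exact: f0.
Qed.

Lemma le_stepE f g t : borel_ge0 f -> borel_ge0 g ->
  (forall w, f (t - X w)%R <= g (t - X w)%R) -> stepE X f t <= stepE X g t.
Proof.
move=> hf hg fg; apply: ge0_le_integral => //.
- by move=> w _; exact: hf.2.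
- exact: measurable_stepE_fun.
- exact: measurable_stepE_fun.
Qed.

Lemma stepED f g t : borel_ge0 f -> borel_ge0 g ->
  stepE X (f \+ g) t = stepE X f t + stepE X g t.
Proof.
move=> hf hg; apply: ge0_integralD => //.
- by move=> w _; exact: hf.2.
- exact: measurable_stepE_fun.
- by move=> w _; exact: hg.2.
- exact: measurable_stepE_fun.
Qed.

Lemma stepEZ f k t : borel_ge0 f -> (0 <= k)%R ->
  stepE X (fun s => k%:E * f s) t = k%:E * stepE X f t.
Proof.
move=> hf k0; apply: ge0_integralZl_EFin => //.
- by move=> w _; exact: hf.2.
- exact: measurable_stepE_fun.
Qed.

Lemma stepE_series (f : nat -> R -> \bar R) t : (forall r, borel_ge0 (f r)) ->
  stepE X (fun s => \sum_(r <oo) f r s) t = \sum_(r <oo) stepE X (f r) t.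
Proof.
move=> hf; apply: integral_nneseries => //.
- by move=> r; exact: measurable_stepE_fun.
- by move=> r w _; exact: (hf r).2.
Qed.

Lemma borel_ge0_iter f r : borel_ge0 f -> borel_ge0 (iter r (stepE X) f).
Proof. by move=> hf; elim: r => //= r; exact: borel_ge0_stepE. Qed.

Lemma le_iter f g r : borel_ge0 f -> borel_ge0 g ->
  (forall t, f t <= g t) -> forall t, iter r (stepE X) f t <= iter r (stepE X) g t.
Proof.
move=> hf hg fg; elim: r => //= r IH t.
by apply: le_stepE => [||w]; [exact: borel_ge0_iter|exact: borel_ge0_iter|exact: IH].
Qed.

Lemma stepE_iterZ f k r t : borel_ge0 f -> (0 <= k)%R ->
  iter r (stepE X) (fun s => k%:E * f s) t = k%:E * iter r (stepE X) f t.
Proof.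
move=> hf k0; elim: r t => //= r IH t.
rewrite -(stepEZ t (borel_ge0_iter r hf) k0); congr (stepE X _ t).
by apply/funext => s; exact: IH.
Qed.

Lemma stepE_iterD f g r t : borel_ge0 f -> borel_ge0 g ->
  iter r (stepE X) (f \+ g) t = iter r (stepE X) f t + iter r (stepE X) g t.
Proof.
move=> hf hg; elim: r t => //= r IH t.
rewrite -(stepED t (borel_ge0_iter r hf) (borel_ge0_iter r hg)).
by congr (stepE X _ t); apply/funext => s; exact: IH.
Qed.

Definition potential f t := \sum_(r <oo) iter r (stepE X) f t.

Lemma borel_ge0_potential f : borel_ge0 f -> borel_ge0 (potential f).
Proof. by move=> hf; apply: borel_ge0_series => r; exact: borel_ge0_iter. Qed.

Lemma le_potential f g t : borel_ge0 f -> borel_ge0 g ->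
  (forall t, f t <= g t) -> potential f t <= potential g t.
Proof.
move=> hf hg fg; apply: lee_nneseries => [r _ _|r _].
  exact: (borel_ge0_iter r hf).2.
exact: le_iter.
Qed.

Lemma potentialD f g t : borel_ge0 f -> borel_ge0 g ->
  potential (f \+ g) t = potential f t + potential g t.
Proof.
move=> hf hg; rewrite /potential -nneseriesD.
- by apply: eq_eseriesr => r _; exact: stepE_iterD.
- by move=> r _ _; exact: (borel_ge0_iter r hf).2.
- by move=> r _ _; exact: (borel_ge0_iter r hg).2.
Qed.

Lemma potentialZ f k t : borel_ge0 f -> (0 <= k)%R ->
  potential (fun s => k%:E * f s) t = k%:E * potential f t.
Proof.
move=> hf k0; rewrite /potential -nneseriesZl; last first.
  by move=> r _; exact: (borel_ge0_iter r hf).2.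
by apply: eq_eseriesr => r _; exact: stepE_iterZ.
Qed.

(** The potential is the least nonnegative supersolution: iterating the hypothesis, the first [n]
    terms plus the [n]-th image of [h] stay below [h], and that image is nonnegative. Upper renewal
    estimates thus reduce to one inequality for one step. *)
Lemma le_potential_super f h : borel_ge0 f -> borel_ge0 h ->
  (forall t, f t + stepE X h t <= h t) -> forall t, potential f t <= h t.
Proof.
move=> hf hh H.
have part n t : \sum_(0 <= r < n) iter r (stepE X) f t + iter n (stepE X) h t <= h t.
  elim: n => [|n]; first by rewrite big_nil add0e.
  apply: le_trans; rewrite big_nat_recr //= -addeA leeD2l //.
  rewrite -iterS iterSr -(stepE_iterD n t hf (borel_ge0_stepE hh)).
  exact: le_iter (borel_ge0D hf (borel_ge0_stepE hh)) hh _ _.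
move=> t; apply: lime_le.
  by apply: is_cvg_nneseries => r _ _; exact: (borel_ge0_iter r hf).2.
apply: nearW => n; apply: le_trans (part n t).
by rewrite leeDl // (borel_ge0_iter n hh).2.
Qed.

Hypothesis X0 : forall w, (0 <= X w)%R.

Lemma stepE_le_homo f t : borel_ge0 f -> {homo f : s t / (s <= t)%R >-> s <= t} ->
  stepE X f t <= f t.
Proof.
move=> hf fm; have <- : \int[P]_w f t = f t.
  by rewrite integral_cst //= probability_setT mule1.
apply: ge0_le_integral => //.
- by move=> w _; exact: hf.2.
- exact: measurable_stepE_fun.
- by move=> w _; apply: fm; rewrite gerBl.
Qed.

(* A nondecreasing factor can be pulled out because the steps are downwards. *)
Lemma stepE_weight (p : R -> R) f t : borel_ge0 f ->
  (forall t, 0 <= p t)%R -> {homo p : s t / (s <= t)%R} ->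
  stepE X (fun s => (p s)%:E * f s) t <= (p t)%:E * stepE X f t.
Proof.
move=> hf p0 pm; rewrite -(stepEZ t hf (p0 t)).
have hp := borel_ge0_nondecreasing pm p0.
apply: le_stepE => [||w]; first exact: borel_ge0M.
- apply: borel_ge0M => //; split => [|s]; first exact: measurable_cst.
  by rewrite lee_fin.
- by rewrite lee_wpmul2r ?hf.2 // lee_fin pm // gerBl.
Qed.

Lemma iter_weight (p : R -> R) f r t : borel_ge0 f ->
  (forall t, 0 <= p t)%R -> {homo p : s t / (s <= t)%R} ->
  iter r (stepE X) (fun s => (p s)%:E * f s) t <= (p t)%:E * iter r (stepE X) f t.
Proof.
move=> hf p0 pm; have hp := borel_ge0_nondecreasing pm p0.
elim: r t => //= r IH t.
apply: le_trans (stepE_weight _ (borel_ge0_iter r hf) p0 pm).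
apply: le_stepE => [||w]; last exact: IH.
- apply: borel_ge0_iter; exact: borel_ge0M.
- apply: borel_ge0M => //; exact: borel_ge0_iter.
Qed.

End Shift.

(** * Finite means *)

Section Mean.
Context {d : measure_display} {T : measurableType d} {R : realType}.
Variable P : probability T R.
Implicit Types f g : T -> R.

(** Integrability and the value of the mean are kept together, so that linear combinations of means
    are computed in [R] and not in the extended reals. *)
Definition has_mean f (a : R) :=
  P.-integrable setT (EFin \o f) /\ (\int[P]_w (f w)%:E = a%:E)%E.

Lemma has_mean_measurable f a : has_mean f a -> measurable_fun setT f.
Proof. by move=> [/measurable_int/measurable_EFinP]. Qed.

Lemma has_mean_cst a : has_mean (cst a) a.
Proof.
split; last by rewrite (integral_cst P measurableT a%:E) /= probability_setT mule1.
exact: (finite_measure_integrable_cst P a measurableT).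
Qed.

Lemma has_meanD f g a b : has_mean f a -> has_mean g b ->
  has_mean (fun w => f w + g w) (a + b).
Proof.
move=> [fi fa] [gi gb]; split.
  have -> : EFin \o (fun w => f w + g w) = ((EFin \o f) \+ (EFin \o g))%E by [].
  exact: integrableD.
by rewrite (integralD_EFin measurableT fi gi) fa gb.
Qed.

Lemma has_meanZ f a k : has_mean f a -> has_mean (fun w => k * f w) (k * a).
Proof.
move=> [fi fa]; split.
  have -> : EFin \o (fun w => k * f w) = (fun w => k%:E * (EFin \o f) w)%E by [].
  exact: integrableZl.
by rewrite EFinM -fa -(integralZl measurableT fi k).
Qed.

Lemma has_meanB f g a b : has_mean f a -> has_mean g b ->
  has_mean (fun w => f w - g w) (a - b).
Proof.
move=> fa gb; have := has_meanD fa (has_meanZ (-1) gb).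
rewrite mulN1r; congr has_mean; apply/funext => w; by rewrite mulN1r.
Qed.

Lemma has_mean_le f g a b : has_mean f a -> has_mean g b ->
  (forall w, f w <= g w) -> a <= b.
Proof.
move=> [fi fa] [gi gb] fg; rewrite -lee_fin -fa -gb.
by apply: le_integral => // w _; rewrite lee_fin.
Qed.

Lemma has_mean_ex f g b : measurable_fun setT f -> (forall w, 0 <= f w <= g w) ->
  has_mean g b -> exists a, has_mean f a.
Proof.
move=> mf fg [gi gb]; have fi : P.-integrable setT (EFin \o f).
  apply: le_integrable gi => //; first exact/measurable_EFinP.
  move=> w _ /=; have /andP[f0 fgw] := fg w.
  by rewrite lee_fin !ger0_norm // (le_trans f0).
exists (fine (\int[P]_w (f w)%:E)%E); split => //.
rewrite fineK //; exact: integrable_fin_num fi.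
Qed.

Lemma has_mean_gt0 f a : has_mean f a -> (forall w, 0 < f w) -> 0 < a.
Proof.
move=> fa f0; have a0 : 0 <= a.
  by apply: has_mean_le (has_mean_cst 0) fa _ => w; exact: ltW.
rewrite lt_neqAle a0 andbT; apply/negP => /eqP az; subst a.
case: fa => fi fa; have mf := measurable_int _ fi.
have /(ae_eq_integral_abs P measurableT mf) : (\int[P]_(x in setT) `|(EFin \o f) x| = 0)%E.
  rewrite -[RHS]fa; apply: eq_integral => w _ /=.
  by rewrite ger0_norm // ltW.
case=> N [mN N0 sub].
have : P setT = 0%E.
  apply/eqP; rewrite eq_le measure_ge0 andbT -N0 le_measure ?inE //.
  move=> w _; apply: sub => /= h; have := h I => -[fw].
  by have := f0 w; rewrite fw ltxx.
by rewrite probability_setT => /eqP; rewrite onee_eq0.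
Qed.

Lemma has_mean_E f a : has_mean f a -> ('E_P[f] = a%:E)%E.
Proof. by move=> [_ <-]; rewrite unlock. Qed.

Lemma has_mean_fine f : measurable_fun setT f -> (forall w, 0 <= f w) ->
  ('E_P[f] < +oo)%E -> has_mean f (fine 'E_P[f]).
Proof.
move=> mf f0; rewrite unlock => foo.
have fi : P.-integrable setT (EFin \o f).
  apply/integrableP; split; first exact/measurable_EFinP.
  apply: le_lt_trans foo; rewrite le_eqVlt; apply/orP; left; apply/eqP.
  by apply: eq_integral => w _ /=; rewrite ger0_norm.
by split => //; rewrite fineK //; exact: integrable_fin_num fi.
Qed.

End Mean.

Section ShiftMean.
Context {d : measure_display} {T : measurableType d} {R : realType}.
Variable P : probability T R.
Variable X : T -> R.
Hypothesis mX : measurable_fun setT X.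
Hypothesis X0 : forall w, 0 <= X w.
Implicit Types (h : R -> R) (B : T -> R) (a b t : R).

Lemma stepE_has_mean h t : {homo h : s t / s <= t} -> (forall t, 0 <= h t) ->
  exists a, has_mean P (fun w => h (t - X w)) a.
Proof.
move=> hm h0; apply: (@has_mean_ex _ _ _ _ _ (cst (h t)) (h t)).
- apply: measurableT_comp; last exact: measurable_sub.
  exact: nondecreasing_measurable.
- by move=> w; rewrite h0 /= hm // gerBl.
- exact: has_mean_cst.
Qed.

(** The form in which supersolutions are checked: [h (t - X)] is dominated pointwise by a
    combination [B] of variables with known means. Monotonicity of [h] supplies measurability and
    the integrable bound [h t]. *)
Lemma stepE_le_mean h B b t : {homo h : s t / s <= t} -> (forall t, 0 <= h t) ->
  has_mean P B b -> (forall w, h (t - X w) <= B w) ->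
  (stepE P X (EFin \o h) t <= b%:E)%E.
Proof.
move=> hm h0 Bb hB; have [a ha] := stepE_has_mean t hm h0.
have -> : stepE P X (EFin \o h) t = a%:E by case: ha.
by rewrite lee_fin; exact: has_mean_le ha Bb hB.
Qed.

Lemma stepE_ge_mean h B b t : {homo h : s t / s <= t} -> (forall t, 0 <= h t) ->
  has_mean P B b -> (forall w, B w <= h (t - X w)) ->
  (b%:E <= stepE P X (EFin \o h) t)%E.
Proof.
move=> hm h0 Bb hB; have [a ha] := stepE_has_mean t hm h0.
have -> : stepE P X (EFin \o h) t = a%:E by case: ha.
by rewrite lee_fin; exact: has_mean_le Bb ha hB.
Qed.

End ShiftMean.

(** * Renewal supersolutions for stick-breaking *)

Section Renewal.
Context {d : measure_display} {T : measurableType d} {R : realType}.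
Variable P : probability T R.
Variable W : T -> R.
Hypothesis mW : measurable_fun setT W.
Hypothesis W01 : forall w, 0 < W w < 1.

Definition xi w : R := `|ln (W w)|.
Definition eta w : R := `|ln (1 - W w)|.

Variables m M2 rho e1 : R.
Hypothesis xi_m : has_mean P xi m.
Hypothesis xi_M2 : has_mean P (fun w => xi w ^+ 2) M2.
Hypothesis W_rho : has_mean P W rho.
Hypothesis eta_e1 : has_mean P eta e1.

Lemma xi_ge0 w : 0 <= xi w. Proof. exact: normr_ge0. Qed.
Lemma eta_ge0 w : 0 <= eta w. Proof. exact: normr_ge0. Qed.

Let mxi : measurable_fun setT xi := has_mean_measurable xi_m.
Let meta : measurable_fun setT eta := has_mean_measurable eta_e1.

Lemma xiE w : xi w = - ln (W w).
Proof. by rewrite /xi ler0_norm // ln_le0 // ltW //; case/andP: (W01 w). Qed.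

Lemma etaE w : eta w = - ln (1 - W w).
Proof. by rewrite /eta ler0_norm // ln_le0 //; case/andP: (W01 w); lra. Qed.

Lemma expRNxi w : expR (- xi w) = W w.
Proof. by rewrite xiE opprK lnK // posrE; case/andP: (W01 w). Qed.

Lemma expRNeta w : expR (- eta w) = 1 - W w.
Proof. by rewrite etaE opprK lnK // posrE; case/andP: (W01 w); lra. Qed.

Lemma xi_gt0 w : 0 < xi w.
Proof. by rewrite xiE oppr_gt0 ln_lt0. Qed.

Lemma subW_le_xi w : 1 - W w <= xi w.
Proof. have := expR_ge1Dx (- xi w); rewrite expRNxi; lra. Qed.

Lemma m_gt0 : 0 < m. Proof. exact: has_mean_gt0 xi_m xi_gt0. Qed.

Lemma subW_mean : has_mean P (fun w => 1 - W w) (1 - rho).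
Proof. exact: has_meanB (has_mean_cst P 1) W_rho. Qed.

Lemma rho_lt1 : rho < 1.
Proof.
rewrite -subr_gt0; apply: has_mean_gt0 subW_mean _ => w.
by case/andP: (W01 w); lra.
Qed.

Lemma rho_ge0 : 0 <= rho.
Proof. by apply: has_mean_le (has_mean_cst P 0) W_rho _ => w /=; case/andP: (W01 w); lra. Qed.

Lemma M2_ge0 : 0 <= M2.
Proof. by apply: has_mean_le (has_mean_cst P 0) xi_M2 _ => w /=; rewrite sqr_ge0. Qed.

Lemma e1_ge0 : 0 <= e1.
Proof. by apply: has_mean_le (has_mean_cst P 0) eta_e1 _; exact: eta_ge0. Qed.

(** [1 - W] is a bounded lower bound of the step [xi], and [kap] normalises its mean to 1. It is
    also the sum of the geometric series of [rho = E exp (- xi)]. *)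
Definition kap : R := (1 - rho)^-1.

Lemma kap_gt0 : 0 < kap. Proof. by rewrite invr_gt0 subr_gt0 rho_lt1. Qed.

Lemma kapM : kap * (1 - rho) = 1.
Proof. by rewrite mulVf // gt_eqF // subr_gt0 rho_lt1. Qed.

Local Notation U := (potential P xi).

Definition splitE f t := stepE P eta (U f) t.
Local Notation A := splitE.

Lemma borel_ge0_U f : borel_ge0 f -> borel_ge0 (U f).
Proof. exact: borel_ge0_potential. Qed.

Lemma borel_ge0_A f : borel_ge0 f -> borel_ge0 (A f).
Proof. by move=> hf; apply: borel_ge0_stepE => //; exact: borel_ge0_U. Qed.

(** * Upper bounds for potentials of powers *)

Lemma borel_ge0_tpow b k : 0 <= b -> borel_ge0 (EFin \o tpow b k : R -> \bar R).
Proof.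
by move=> b0; apply: borel_ge0_nondecreasing;
  [exact: le_tpow|move=> t; exact: tpow_ge0].
Qed.

(** Its slope on [0 <= t] is formally twice the mean overshoot [E max 0 (xi - t)], while it stays
    below [E (xi + 1)^2]; so the second moment of [log W] bounds the total overshoot. *)
Definition ren_gap t : R := fine (\int[P]_w (gap (xi w) t)%:E)%E.

Lemma measurable_gap t : measurable_fun setT (fun x : R => gap x t).
Proof.
rewrite /gap; case: (0 <= t) => //; apply: measurable_funB.
  have : measurable_fun setT (fun x : R => x + 1) by exact: measurable_funD.
  by move/(measurable_funX 2).
have : measurable_fun setT (fun x : R => Num.max 0 (x - t)).
  by apply: measurable_maxr => //; exact: measurable_funB.
by move/(measurable_funX 2).
Qed.

Lemma sqr1xi_mean : has_mean P (fun w => (xi w + 1) ^+ 2) (M2 + 2 * m + 1).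
Proof.
have := has_meanD (has_meanD xi_M2 (has_meanZ 2 xi_m)) (has_mean_cst P 1).
by congr has_mean; apply/funext => w /=; ring.
Qed.

Lemma ren_gap_mean t : has_mean P (fun w => gap (xi w) t) (ren_gap t).
Proof.
have [a ha] : exists a, has_mean P (fun w => gap (xi w) t) a.
  apply: has_mean_ex sqr1xi_mean.
    by apply: (measurableT_comp (measurable_gap t)).
  by move=> w; rewrite gap_ge0 ?xi_ge0 //= gap_le.
by rewrite /ren_gap (_ : (\int[P]_w (gap (xi w) t)%:E)%E = a%:E) //; case: ha.
Qed.

Lemma ren_gap_ge0 t : 0 <= ren_gap t.
Proof.
by apply: has_mean_le (has_mean_cst P 0) (ren_gap_mean t) _ => w /=; rewrite gap_ge0 ?xi_ge0.
Qed.

Lemma ren_gap_le t : ren_gap t <= M2 + 2 * m + 1.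
Proof. by apply: has_mean_le (ren_gap_mean t) sqr1xi_mean _ => w; exact: gap_le. Qed.

Lemma ren_gap_mono : {homo ren_gap : s t / s <= t}.
Proof.
move=> s t st; apply: has_mean_le (ren_gap_mean s) (ren_gap_mean t) _ => w.
by apply: gap_mono => //; exact: xi_ge0.
Qed.

Lemma ren_gap_lt0 t : t < 0 -> ren_gap t = 0.
Proof.
move=> t0; rewrite /ren_gap (_ : (\int[P]_w (gap (xi w) t)%:E)%E = 0%E) //.
by apply: integral0_eq => w _; rewrite /gap leNgt t0.
Qed.

(** [cst0] is [kap / (2 m)] times the bound on [ren_gap]. [cst1] solves
    [cst1 (1 - rho) / 2 = (m + 2 M2) / m], the balance of error and decrease in [potential_tpowS].
    Neither depends on the exponent. *)
Definition cst0 : R := kap * (M2 + 2 * m + 1) / (2 * m).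
Definition cst1 : R := 2 * kap * (m + 2 * M2) / m.
Definition cstU : R := cst0 + cst1.

Lemma cst0_ge0 : 0 <= cst0.
Proof.
have := m_gt0; have := kap_gt0; have := M2_ge0 => *.
by rewrite /cst0 divr_ge0 ?mulr_ge0 //; lra.
Qed.

Lemma cst1_ge0 : 0 <= cst1.
Proof.
have := m_gt0; have := kap_gt0; have := M2_ge0 => *.
by rewrite /cst1 divr_ge0 ?mulr_ge0 //; lra.
Qed.

Lemma cstU_ge0 : 0 <= cstU. Proof. exact: addr_ge0 cst0_ge0 cst1_ge0. Qed.

(* Lorden's bound on the renewal function, by exhibiting an explicit
   superharmonic majorant. *)
Lemma potential_tpow0 t :
  (U (EFin \o tpow 0 0) t <= (tpow 0 1 t / m + cst0 * tpow 0 0 t)%:E)%E.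
Proof.
(* Truncating [t / m] at 0 costs [Q / m] in mean, where [Q] is the mean overshoot, and [ren_gap]
   falls by at least [2 (1 - rho) Q] in mean; this value of [c] balances the two exactly. *)
pose c := kap / (2 * m).
have c0 : 0 <= c by rewrite /c divr_ge0 ?mulr_ge0 ?(ltW kap_gt0) ?(ltW m_gt0).
have mi0 : 0 <= m^-1 by rewrite invr_ge0 (ltW m_gt0).
pose h t := tpow 0 1 t / m + c * ren_gap t.
have h0 s : 0 <= h s.
  by apply: addr_ge0; apply: mulr_ge0 => //; [exact: tpow_ge0|exact: ren_gap_ge0].
have hm : {homo h : s t / s <= t}.
  by move=> s s' ss; apply: lerD; [apply: ler_wpM2r => //; exact: le_tpow|apply: ler_wpM2l => //; exact: ren_gap_mono].
have bh := borel_ge0_nondecreasing hm h0.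
apply: (@le_trans _ _ (h t)%:E); last first.
  rewrite lee_fin lerD2l; have [t0|t0] := ltP t 0.
    by rewrite ren_gap_lt0 // tpow_lt0 // !mulr0.
  rewrite tpowE0 // expr0 mulr1 /cst0 /c mulrAC ler_wpM2r //.
    by rewrite invr_ge0 mulr_ge0 // ltW // m_gt0.
  by rewrite ler_wpM2l ?(ltW kap_gt0) // ren_gap_le.
apply: (le_potential_super mxi (borel_ge0_tpow 0 (lexx 0)) bh) => {}t.
have [t0|t0] := ltP t 0.
  rewrite /= tpow_lt0 // add0e; apply: stepE_le_homo => //; exact: xi_ge0.
have [Q hQ] : exists Q, has_mean P (fun w => Num.max 0 (xi w - t)) Q.
  apply: has_mean_ex xi_m; last first.
    move=> w; rewrite le_max lexx /= ge_max xi_ge0 /=; have := xi_ge0 w; lra.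
  by apply: measurable_maxr => //; exact: measurable_funB.
have Q0 : 0 <= Q.
  by apply: has_mean_le (has_mean_cst P 0) hQ _ => w /=; rewrite le_max lexx.
pose B w := t / m + (- m^-1) * xi w + m^-1 * Num.max 0 (xi w - t)
   + c * ren_gap t - (2 * c * Q) * (1 - W w).
have hB : has_mean P B (t / m + (- m^-1) * m + m^-1 * Q + c * ren_gap t - (2 * c * Q) * (1 - rho)).
  apply: has_meanB; last exact: has_meanZ subW_mean.
  apply: has_meanD; last exact: has_mean_cst.
  apply: has_meanD; last exact: has_meanZ hQ.
  by apply: has_meanD; [exact: has_mean_cst|exact: has_meanZ xi_m].
have stepB : (stepE P xi (EFin \o h) t <=
   (t / m + (- m^-1) * m + m^-1 * Q + c * ren_gap t - (2 * c * Q) * (1 - rho))%:E)%E.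
  apply: stepE_le_mean hB _ => //; first exact: xi_ge0.
  move=> w; rewrite /h /B.
  have e : tpow 0 1 (t - xi w) = t - xi w + Num.max 0 (xi w - t).
    have [tx|tx] := leP (xi w) t.
      rewrite tpowE0 ?subr_ge0 // expr1.
      by have -> : Num.max 0 (xi w - t) = 0; [apply/max_idPl; lra|rewrite addr0].
    rewrite tpow_lt0 ?subr_lt0 //.
    by have -> : Num.max 0 (xi w - t) = xi w - t; [apply/max_idPr; lra|lra].
  rewrite e !mulrDl.
  have H : ren_gap (t - xi w) + 2 * (1 - W w) * Q <= ren_gap t.
    apply: has_mean_le (has_meanD (ren_gap_mean _) (has_meanZ _ hQ)) (ren_gap_mean t) _.
    have := W01 w => /andP[? ?].
    move=> w'; apply: gap_drop => //; rewrite ?xi_ge0 //; try lra.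
    exact: subW_le_xi.
  have := ler_wpM2l c0 H; lra.
apply: le_trans (leeD2l _ stepB) _.
rewrite -EFinD lee_fin /h /= !tpowE0 // expr0 expr1.
have -> : 2 * c * Q * (1 - rho) = m^-1 * Q.
  transitivity (kap * (1 - rho) * (m^-1 * Q)); last by rewrite kapM mul1r.
  by rewrite /c; have m0 := m_gt0; field; rewrite gt_eqF.
have : m^-1 * m = 1 by rewrite mulVf // gt_eqF // m_gt0.
lra.
Qed.

(** The right-hand side is a supersolution. By [tpow_drop_main] its first term falls by [t^k] in
    mean, up to an error [t^k s (m + 2 M2) / m]; by [tpow_drop_low] the second falls by at least
    [cst1 t^k s (1 - rho) / 2]. Both carry [s = min (1, k / t)], hence a constant uniform in [k] and
    [t]. *)
Lemma potential_tpowS k t : (0 < k)%N ->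
  (U (EFin \o tpow 0 k) t <= (tpow 0 k.+1 t / (k.+1%:R * m) + cst1 * tpow 0 k t)%:E)%E.
Proof.
move=> k0; have mm := m_gt0.
have mi0 : 0 <= (k.+1%:R * m)^-1 by rewrite invr_ge0 mulr_ge0 // ltW.
pose h t := tpow 0 k.+1 t / (k.+1%:R * m) + cst1 * tpow 0 k t.
have h0 s : 0 <= h s.
  by apply: addr_ge0; apply: mulr_ge0; rewrite ?tpow_ge0 ?cst1_ge0.
have hm : {homo h : s t / s <= t}.
  move=> s s' ss; apply: lerD; first by apply: ler_wpM2r => //; exact: le_tpow.
  by apply: ler_wpM2l; [exact: cst1_ge0|exact: le_tpow].
have bh := borel_ge0_nondecreasing hm h0.
apply: (le_potential_super mxi (borel_ge0_tpow k (lexx 0)) bh) => {}t.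
have [t0|t0] := leP t 0.
  have -> : (EFin \o tpow 0 k) t = 0%E.
    rewrite /=; move: t0; rewrite le_eqVlt => /orP[/eqP ->|t0]; last by rewrite tpow_lt0.
    by rewrite tpowE0 // expr0n; case: (k) k0.
  by rewrite add0e; apply: stepE_le_homo => //; exact: xi_ge0.
pose s := if (k%:R : R) < t then k%:R / t else 1.
have s0 : 0 <= s by rewrite /s; case: ifP => // _; rewrite divr_ge0 // ltW.
have s1 : s <= 1 by rewrite /s; case: ifP => // kt; rewrite ler_pdivrMr // mul1r ltW.
have sor : s = 1 \/ s * t = k%:R.
  by rewrite /s; case: ifP => kt; [right; rewrite divfK // gt_eqF|left].
have stk : s * t <= k%:R.
  rewrite /s; case: ifPn => kt; first by rewrite divfK // gt_eqF.
  by rewrite mul1r leNgt.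
pose B w := t ^+ k.+1 / (k.+1%:R * m) + cst1 * t ^+ k + (- (t ^+ k / m)) * xi w
  + (t ^+ k * s / m) * (xi w + 2 * xi w ^+ 2) - (cst1 * t ^+ k * s / 2) * (1 - W w).
have hB : has_mean P B (t ^+ k.+1 / (k.+1%:R * m) + cst1 * t ^+ k + (- (t ^+ k / m)) * m
  + (t ^+ k * s / m) * (m + 2 * M2) - (cst1 * t ^+ k * s / 2) * (1 - rho)).
  apply: has_meanB; last exact: has_meanZ subW_mean.
  apply: has_meanD; last by apply: has_meanZ; apply: has_meanD => //; exact: has_meanZ.
  by apply: has_meanD; [exact: has_mean_cst|exact: has_meanZ].
have stepB : (stepE P xi (EFin \o h) t <=
   (t ^+ k.+1 / (k.+1%:R * m) + cst1 * t ^+ k + (- (t ^+ k / m)) * m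
  + (t ^+ k * s / m) * (m + 2 * M2) - (cst1 * t ^+ k * s / 2) * (1 - rho))%:E)%E.
  apply: stepE_le_mean hB _ => //; first exact: xi_ge0.
  move=> w; rewrite /h /B; have /andP[W0 W1] := W01 w.
  have H1 := tpow_drop_main k0 t0 (xi_ge0 w) s0 sor.
  have s01 : 0 <= s <= 1 by rewrite s0.
  have z0 : 0 <= 1 - W w by lra.
  have z1 : 1 - W w <= 1 by lra.
  have H2 := tpow_drop_low k0 t0 (xi_ge0 w) s01 stk z0 z1 (subW_le_xi w).
  have := ler_wpM2l cst1_ge0 H2.
  have mi : 0 <= m^-1 by rewrite invr_ge0 ltW.
  have := ler_wpM2r mi H1; rewrite !invfM.
  move: (m^-1) (k.+1%:R^-1) (tpow 0 k.+1 (t - xi w)) (tpow 0 k (t - xi w)).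
  by move: (t ^+ k.+1) (t ^+ k) (xi w) => ? ? ? ? ? ? ?; lra.
apply: le_trans (leeD2l _ stepB) _.
rewrite -EFinD lee_fin /h /= !(tpowE0 _ (ltW t0)).
have -> : cst1 * t ^+ k * s / 2 * (1 - rho) = (kap * (1 - rho)) * (t ^+ k * s / m * (m + 2 * M2)).
  by rewrite /cst1; field; rewrite gt_eqF.
rewrite kapM mul1r.
rewrite mulNr divfK ?gt_eqF //.
by move: (t ^+ k) (cst1 * _) (t ^+ k * s / m * _) (t ^+ k.+1 / _) => ? ? ? ?; lra.
Qed.

Lemma potential_tpow k t :
  (U (EFin \o tpow 0 k) t <= (tpow 0 k.+1 t / (k.+1%:R * m) + cstU * tpow 0 k t)%:E)%E.
Proof.
case: k => [|k].
  apply: le_trans (potential_tpow0 t) _; rewrite lee_fin mul1r lerD2l.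
  by rewrite ler_wpM2r ?tpow_ge0 // lerDl cst1_ge0.
apply: le_trans (potential_tpowS t (ltn0Sn k)) _; rewrite lee_fin lerD2l.
by rewrite ler_wpM2r ?tpow_ge0 // lerDr cst0_ge0.
Qed.

Lemma le_potential_sum n (a : nat -> R) (f : nat -> R -> R) (g : nat -> R -> R) t :
  (forall l, 0 <= a l) -> (forall l, borel_ge0 (EFin \o f l)) ->
  (forall l, (U (EFin \o f l) t <= (g l t)%:E)%E) ->
  (U (fun s => (\sum_(l < n) a l * f l s)%:E) t <= (\sum_(l < n) a l * g l t)%:E)%E.
Proof.
move=> a0 hf H.
have hS k : borel_ge0 (fun s => (\sum_(l < k) a l * f l s)%:E).
  elim: k => [|k IH].
    by under eq_fun do rewrite big_ord0; split=> //; exact: measurable_cst.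
  under eq_fun do rewrite big_ord_recr EFinD EFinM.
  apply: borel_ge0D; first exact: IH.
  apply: borel_ge0M; last exact: hf.
  by split; [exact: measurable_cst|move=> ?; rewrite lee_fin].
elim: n => [|n IHn].
  rewrite big_ord0; under eq_fun do rewrite big_ord0.
  have bc : borel_ge0 (cst 0%E : R -> \bar R) by split=> //; exact: measurable_cst.
  by apply: (le_potential_super mxi bc bc) => s; rewrite add0e /stepE integral0.
rewrite big_ord_recr /= EFinD; under eq_fun do rewrite big_ord_recr EFinD EFinM.
rewrite (potentialD P mxi t (hS n)); last first.
  apply: borel_ge0M; last exact: hf.
  by split; [exact: measurable_cst|move=> ?; rewrite lee_fin].
rewrite leeD // (potentialZ P mxi t (hf n) (a0 n)) EFinM.
by rewrite lee_wpmul2l // lee_fin.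
Qed.

(** Binomial expansion of [(t + b)^k], with [potential_tpow] applied to each power of [t]. Since
    [C(k, l) / (l + 1) = C(k + 1, l + 1) / (k + 1)], the leading parts reassemble into
    [(t + b)^(k+1)]. *)
Lemma potential_tpow_shift b k t : 0 <= b ->
  (U (EFin \o tpow b k) t <= (tpow b k.+1 t / (k.+1%:R * m) + cstU * tpow b k t)%:E)%E.
Proof.
move=> b0; have mm := m_gt0.
pose a l : R := b ^+ (k - l) *+ 'C(k, l).
have a0 l : 0 <= a l by rewrite mulrn_wge0 // exprn_ge0.
have E s : tpow b k s = \sum_(l < k.+1) a l * tpow 0 l s.
  rewrite /tpow; case: ifP => _; last by rewrite big1 // => l _; rewrite mulr0.
  rewrite addrC exprDn; apply: eq_bigr => l _.
  by rewrite addr0 /a mulrnAl.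
have -> : EFin \o tpow b k = fun s => (\sum_(l < k.+1) a l * tpow 0 l s)%:E.
  by apply/funext => s /=; rewrite E.
apply: le_trans (le_potential_sum (g := fun l s => tpow 0 l.+1 s / (l.+1%:R * m)
  + cstU * tpow 0 l s) _ a0 _ (fun l => potential_tpow l t)) _.
  by move=> l; exact: borel_ge0_tpow.
rewrite lee_fin; under eq_bigr do rewrite /= mulrDr.
rewrite big_split /= E; apply: lerD; last first.
  by rewrite mulr_sumr; apply: ler_sum => l _; rewrite mulrCA.
rewrite /tpow; case: ifP => [t0|_]; last first.
  by rewrite mul0r big1 // => l _; rewrite mul0r mulr0.
(* The term [b^(k+1)] on the right has no counterpart on the left and is dropped as nonnegative. *)
rewrite [t + b]addrC exprDn [in leRHS]big_ord_recl [in leRHS]mulrDl.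
apply: ler_wpDl.
  apply: mulr_ge0; last by rewrite invr_ge0 mulr_ge0 // ltW.
  by rewrite mulrn_wge0 // mulr_ge0 // exprn_ge0.
rewrite mulr_suml; apply: ler_sum => l _; rewrite le_eqVlt; apply/orP; left; apply/eqP.
rewrite addr0 /a lift0 subSS -mulr_natr -[in RHS]mulr_natr.
have : (k.+1 * 'C(k, l) = l.+1 * 'C(k.+1, l.+1))%N by rewrite mul_bin_diag.
move/(congr1 (fun n => n%:R : R)); rewrite !natrM => e.
have l0 : (l.+1%:R : R) != 0 by rewrite pnatr_eq0.
have k0 : (k.+1%:R : R) != 0 by rewrite pnatr_eq0.
have m0 : m != 0 by rewrite gt_eqF.
have e' : 'C(k, l)%:R = l.+1%:R * 'C(k.+1, l.+1)%:R / k.+1%:R :> R.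
  by apply: (mulfI k0); rewrite e; field.
by rewrite e'; field; rewrite m0 !nat1r k0 l0.
Qed.

(** * The operator of one generation and its iterates *)

Lemma le_A f g t : borel_ge0 f -> borel_ge0 g -> (forall t, (f t <= g t)%E) ->
  (A f t <= A g t)%E.
Proof.
move=> hf hg fg; apply: le_stepE => [//|||w]; try exact: borel_ge0_U.
exact: le_potential.
Qed.

(** The extra step [eta] goes downwards, so for a nondecreasing majorant it is simply discarded. *)
Lemma A_le_super f h t : borel_ge0 f -> borel_ge0 h ->
  (forall t, (U f t <= h t)%E) -> {homo h : s t / s <= t >-> (s <= t)%E} ->
  (A f t <= h t)%E.
Proof.
move=> hf hh H hm; apply: (@le_trans _ _ (stepE P eta h t)).
  by apply: le_stepE => //; exact: borel_ge0_U.
by apply: stepE_le_homo => //; exact: eta_ge0.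
Qed.

Lemma borel_ge0_iterA f i : borel_ge0 f -> borel_ge0 (iter i A f).
Proof. by move=> hf; elim: i => //= i; exact: borel_ge0_A. Qed.

Lemma le_iterA f g i t : borel_ge0 f -> borel_ge0 g ->
  (forall t, (f t <= g t)%E) -> (iter i A f t <= iter i A g t)%E.
Proof.
move=> hf hg fg; elim: i t => //= i IH t.
by apply: le_A => //; exact: borel_ge0_iterA.
Qed.

Lemma A_weight (p : R -> R) f t : borel_ge0 f ->
  (forall t, 0 <= p t) -> {homo p : s t / s <= t} ->
  (A (fun s => (p s)%:E * f s) t <= (p t)%:E * A f t)%E.
Proof.
move=> hf p0 pm; have hp := borel_ge0_nondecreasing pm p0.
have hpf : borel_ge0 (fun s => (p s)%:E * f s)%E by exact: borel_ge0M.
apply: le_trans (stepE_weight P meta eta_ge0 t (borel_ge0_U hf) p0 pm).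
apply: le_stepE => [//|||w]; first exact: borel_ge0_U.
  by apply: borel_ge0M => //; exact: borel_ge0_U.
rewrite /potential -nneseriesZl; last by move=> r _; exact: (borel_ge0_iter P mxi r hf).2.
apply: lee_nneseries => [r _ _|r _]; first exact: (borel_ge0_iter P mxi r hpf).2.
by apply: iter_weight => //; exact: xi_ge0.
Qed.

Lemma iterA_weight (p : R -> R) f i t : borel_ge0 f ->
  (forall t, 0 <= p t) -> {homo p : s t / s <= t} ->
  (iter i A (fun s => (p s)%:E * f s) t <= (p t)%:E * iter i A f t)%E.
Proof.
move=> hf p0 pm; have hp := borel_ge0_nondecreasing pm p0.
have hpf : borel_ge0 (fun s => (p s)%:E * f s)%E by exact: borel_ge0M.
elim: i t => //= i IH t.
apply: le_trans (A_weight _ (borel_ge0_iterA i hf) p0 pm).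
apply: le_A => //; first exact: borel_ge0_iterA.
by apply: borel_ge0M => //; exact: borel_ge0_iterA.
Qed.

(** The shift per generation: [(x + a)^(k+1) - x^(k+1) >= k.+1 a x^k], which after division by
    [k.+1 m] must cover the error [cstU x^k]; so [a = cstU m]. *)
Definition cstA : R := cstU * m.

Lemma cstA_ge0 : 0 <= cstA. Proof. by rewrite mulr_ge0 ?cstU_ge0 // ltW // m_gt0. Qed.

Lemma den_gt0 k : 0 < k`!%:R * m ^+ k.
Proof. by rewrite mulr_gt0 ?ltr0n ?fact_gt0 // exprn_gt0 // m_gt0. Qed.

Lemma tpow_shift_mono b k : 0 <= b ->
  (forall t, 0 <= tpow b k t / (k`!%:R * m ^+ k)) /\
  {homo (fun t => tpow b k t / (k`!%:R * m ^+ k)) : s t / s <= t}.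
Proof.
move=> b0; have d0 : 0 <= (k`!%:R * m ^+ k)^-1 by rewrite invr_ge0 ltW // den_gt0.
split=> [t|s t st]; first by rewrite mulr_ge0 // tpow_ge0.
by rewrite ler_wpM2r // le_tpow.
Qed.

(** [G_k(t + k a)] on [0 <= t], with one shift by [a = cstA] for each generation. *)
Definition phi k t : R := tpow (k%:R * cstA) k t / (k`!%:R * m ^+ k).

Lemma phi_ge0 k t : 0 <= phi k t.
Proof. have [h _] := @tpow_shift_mono (k%:R * cstA) k (mulr_ge0 (ler0n _ _) cstA_ge0); exact: h. Qed.

Lemma phi_mono k : {homo phi k : s t / s <= t}.
Proof. have [_ h] := @tpow_shift_mono (k%:R * cstA) k (mulr_ge0 (ler0n _ _) cstA_ge0); exact: h. Qed.

Lemma borel_ge0_phi k : borel_ge0 (EFin \o phi k : R -> \bar R).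
Proof. exact: borel_ge0_nondecreasing (@phi_mono k) (phi_ge0 k). Qed.

(** The error term of [potential_tpow_shift] is absorbed by moving the argument from [t + k a] to
    [t + k.+1 a]. Iteration then accumulates shifts and no multiplicative constants. *)
Lemma potential_phi k t : (U (EFin \o phi k) t <= (phi k.+1 t)%:E)%E.
Proof.
have b0 : 0 <= k%:R * cstA by rewrite mulr_ge0 ?cstA_ge0.
have D0 := den_gt0 k; have mm := m_gt0.
have -> : EFin \o phi k = (fun s => ((k`!%:R * m ^+ k)^-1)%:E * (EFin \o tpow (k%:R * cstA) k) s)%E.
  by apply/funext => s; rewrite /= -EFinM mulrC.
rewrite (potentialZ P mxi _ (borel_ge0_tpow k b0)) ?invr_ge0 ?(ltW D0) //.
apply: le_trans (lee_wpmul2l _ (potential_tpow_shift k t b0)) _.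
  by rewrite lee_fin invr_ge0 ltW.
rewrite -EFinM lee_fin /phi.
have [t0|t0] := ltP t 0; first by rewrite !tpow_lt0 // !mul0r mulr0 addr0 mulr0.
rewrite /tpow t0 ler_pdivlMr ?den_gt0 //.
set x := t + k%:R * cstA; have x0 : 0 <= x by rewrite addr_ge0.
have -> : t + k.+1%:R * cstA = x + cstA by rewrite /x -natr1; ring.
have k0 : (k.+1%:R : R) != 0 by rewrite pnatr_eq0.
have f0 : (k`!%:R : R) != 0 by rewrite pnatr_eq0 -lt0n fact_gt0.
have mk0 : m ^+ k != 0 by rewrite expf_neq0 // gt_eqF.
rewrite factS natrM exprS.
apply: le_trans (@tangent_pow _ k (x + cstA) x _ x0); last by rewrite addr_ge0 ?cstA_ge0.
rewrite (exprS m k) le_eqVlt; apply/orP; left; apply/eqP; rewrite /cstA.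
by rewrite -(exprS x k); field; rewrite !nat1r k0 f0 mk0 gt_eqF.
Qed.

Lemma A_phi k t : (A (EFin \o phi k) t <= (phi k.+1 t)%:E)%E.
Proof.
apply: (A_le_super (h := EFin \o phi k.+1)); [exact: borel_ge0_phi|exact: borel_ge0_phi| |].
  by move=> s; exact: potential_phi.
by move=> s s' ss; rewrite lee_fin phi_mono.
Qed.

Lemma phi0 : phi 0 = tpow 0 0.
Proof. by apply/funext => t; rewrite /phi /tpow !expr0 mulr1 divr1; case: ifP. Qed.

Lemma iterA_phi i t : (iter i A (EFin \o tpow 0 0) t <= (phi i t)%:E)%E.
Proof.
rewrite -phi0; elim: i t => //= i IH t.
apply: le_trans (A_phi i t); apply: le_A => //; last exact: borel_ge0_phi.
by apply: borel_ge0_iterA; exact: borel_ge0_phi.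
Qed.

(** Bounds the mean sum of [f (t + ln P_r) f (t + ln P_r')] over all pairs of siblings: the 2 stands
    for the order of [r] and [r'], the outer potential for the smaller index, the inner one for the
    further sticks up to the larger. *)
Definition A2 f t : \bar R := (2%:E * U (f \* U f) t)%E.
Definition psi k t : R := (tpow (k.+1%:R * cstA) k t / (k`!%:R * m ^+ k)) ^+ 2.

Lemma psi_ge0 k t : 0 <= psi k t. Proof. exact: sqr_ge0. Qed.

Lemma psi_mono k : {homo psi k : s t / s <= t}.
Proof.
have [h0 hm] := @tpow_shift_mono (k.+1%:R * cstA) k (mulr_ge0 (ler0n _ _) cstA_ge0).
by move=> s t st; apply: lerXn2r; rewrite ?nnegrE; [exact: h0|exact: h0|exact: hm].
Qed.

(** Writing [phi k] and [phi k.+1] over the denominators [D] and [D' = k.+1 m D], the product is at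
    most [(t + b)^(2k+1) / (D D')]. Its potential has leading coefficient [1 / ((2k + 2) m D D')],
    and twice this is exactly [1 / D'^2], so the leading term is a perfect square. The error is
    absorbed by one more shift, whence [k.+1] shifts in [psi k]. *)
Lemma A2_phi k t : (A2 (EFin \o phi k) t <= (psi k.+1 t)%:E)%E.
Proof.
set b := k.+1%:R * cstA; have mm := m_gt0; have a0 := cstA_ge0.
have b0 : 0 <= b by rewrite mulr_ge0.
set D := k`!%:R * m ^+ k; have D0 : 0 < D := den_gt0 k.
set D' := k.+1`!%:R * m ^+ k.+1; have D0' : 0 < D' := den_gt0 k.+1.
have DD : 0 <= (D * D')^-1 by rewrite invr_ge0 mulr_ge0 // ltW.
have bk s : phi k s <= tpow b k s / D.
  rewrite /phi -/D ler_wpM2r ?invr_ge0 ?(ltW D0) // /tpow; case: ifP => // s0.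
  have kb : k%:R * cstA <= b by rewrite /b -natr1 ler_wpM2r // lerDl.
  have k0 : 0 <= k%:R * cstA by rewrite mulr_ge0.
  by apply: lerXn2r; rewrite ?nnegrE ?addr_ge0 // lerD2l.
have H s : (((EFin \o phi k) \* U (EFin \o phi k)) s <=
    ((D * D')^-1)%:E * (EFin \o tpow b (k + k.+1)%N) s)%E.
  apply: (@le_trans _ _ ((tpow b k s / D)%:E * (phi k.+1 s)%:E)%E).
    apply: lee_pmul => //; first by rewrite lee_fin phi_ge0.
    - exact: (borel_ge0_U (borel_ge0_phi k)).2.
    - by rewrite lee_fin.
    - exact: potential_phi.
  rewrite -!EFinM lee_fin le_eqVlt; apply/orP; left; apply/eqP.
  rewrite /phi -/D' -/b (invfM D D') /tpow; case: ifP => _; last by rewrite !mul0r mulr0.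
  by rewrite exprD; move: (D^-1) (D'^-1) => p q; ring.
rewrite /A2.
apply: le_trans (lee_wpmul2l _ (le_potential P mxi _ _ _ H)) _.
- by rewrite lee_fin.
- by apply: borel_ge0M; [exact: borel_ge0_phi|apply: borel_ge0_U; exact: borel_ge0_phi].
- apply: borel_ge0M; last exact: borel_ge0_tpow.
  by split; [exact: measurable_cst|move=> ?; rewrite lee_fin].
rewrite (potentialZ P mxi _ (borel_ge0_tpow _ b0) DD).
apply: le_trans (lee_wpmul2l _ (lee_wpmul2l _ (potential_tpow_shift _ t b0))) _.
- by rewrite lee_fin.
- by rewrite lee_fin.
rewrite -!EFinM lee_fin /psi -/D'.
have [t0|t0] := ltP t 0; first by rewrite !tpow_lt0 // !mul0r !mulr0 addr0 !mulr0 expr0n.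
rewrite /tpow t0.
set x := t + b; have x0 : 0 <= x by rewrite addr_ge0.
have -> : t + k.+2%:R * cstA = x + cstA by rewrite /x /b -natr1; ring.
rewrite expr_div_n ler_pdivlMr ?exprn_gt0 // -exprM.
have -> : (k.+1 * 2 = (k + k.+1).+1)%N by rewrite muln2 -addnn addSn.
apply: le_trans (@tangent_pow _ (k + k.+1) (x + cstA) x _ x0); last by rewrite addr_ge0.
rewrite le_eqVlt; apply/orP; left; apply/eqP.
have k0 : (k.+1%:R : R) != 0 by rewrite pnatr_eq0.
have kk0 : ((k + k.+1).+1%:R : R) = 2 * k.+1%:R by rewrite -addSn addnn -muln2 natrM mulrC.
have f0 : (k`!%:R : R) != 0 by rewrite pnatr_eq0 -lt0n fact_gt0.
have mk0 : m ^+ k != 0 by rewrite expf_neq0 // gt_eqF.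
have Dne : D != 0 by rewrite gt_eqF.
have DE : D' = k.+1%:R * m * D by rewrite /D' /D factS natrM exprS; ring.
rewrite kk0 DE /cstA (exprS x (k + k.+1)); move: (x ^+ (k + k.+1)) => y.
by field; rewrite nat1r k0 Dne gt_eqF.
Qed.

(** * Lower bounds by subsolutions *)

Lemma borel_ge0_expR : borel_ge0 (EFin \o expR : R -> \bar R).
Proof.
split; last by move=> t; rewrite lee_fin expR_ge0.
by apply/measurable_EFinP; exact: measurable_expR.
Qed.

(** The exponential is an eigenfunction with eigenvalue [E W = rho < 1]; it provides the geometric
    decay of remainders. *)
Lemma stepE_expR t : stepE P xi (EFin \o expR) t = (rho * expR t)%:E.
Proof.
rewrite [rho * _]mulrC; have [_ <-] := has_meanZ (expR t) W_rho.
by apply: eq_integral => w _; rewrite /= expRD expRNxi.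
Qed.

Lemma iter_expR n t : iter n (stepE P xi) (EFin \o expR) t = (rho ^+ n * expR t)%:E.
Proof.
elim: n t => [|n IH] t; first by rewrite expr0 mul1r.
rewrite iterS (_ : iter n _ _ = fun s => (rho ^+ n)%:E * (EFin \o expR) s)%E; last first.
  by apply/funext => s; rewrite IH EFinM.
rewrite (stepEZ P mxi t borel_ge0_expR) ?exprn_ge0 ?rho_ge0 //.
by rewrite stepE_expR -EFinM exprSr mulrA.
Qed.

Definition low k s t : R := tpow 0 k (t - s) / (k`!%:R * m ^+ k).

Lemma low_ge0 k s t : 0 <= low k s t.
Proof. by have [h _] := tpow_shift_mono k (lexx (0 : R)); exact: h. Qed.

Lemma low_mono k s : {homo low k s : t u / t <= u}.
Proof.
have [_ h] := tpow_shift_mono k (lexx (0 : R)).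
by move=> t u tu; apply: h; rewrite lerD2r.
Qed.

Lemma borel_ge0_low k s : borel_ge0 (EFin \o low k s : R -> \bar R).
Proof. exact: borel_ge0_nondecreasing (@low_mono k s) (@low_ge0 k s). Qed.

(** By [tpow_step] a step lowers [low k.+1 s] by at most [xi * low k s t / m], whose mean is
    [low k s t]. *)
Lemma low_sub k s t : ((low k.+1 s t)%:E <=
  (low k s t)%:E + stepE P xi (EFin \o low k.+1 s) t)%E.
Proof.
have mm := m_gt0; have D0 := den_gt0 k.+1.
have hB : has_mean P (fun w => low k.+1 s t + (- (low k s t / m)) * xi w)
    (low k.+1 s t + (- (low k s t / m)) * m).
  by apply: has_meanD; [exact: has_mean_cst|exact: has_meanZ].
have := stepE_ge_mean (h := low k.+1 s) (t := t) mxi xi_ge0 (@low_mono k.+1 s)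
  (@low_ge0 k.+1 s) hB.
rewrite mulNr divfK ?gt_eqF // => H.
rewrite -leeBlDl ?EFinB //; apply: le_trans (H _); last first.
  move=> w; have := tpow_step k (t - s) (xi_ge0 w).
  rewrite /low (addrAC t).
  have Di : 0 <= (k.+1`!%:R * m ^+ k.+1)^-1 by rewrite invr_ge0 ltW.
  move/(ler_wpM2r Di); rewrite mulrDl.
  have k0 : (k.+1%:R : R) != 0 by rewrite pnatr_eq0.
  have f0 : (k`!%:R : R) != 0 by rewrite pnatr_eq0 -lt0n fact_gt0.
  have mk0 : m ^+ k != 0 by rewrite expf_neq0 // gt_eqF.
  have -> : k.+1%:R * xi w * tpow 0 k (t - s) / (k.+1`!%:R * m ^+ k.+1) =
     tpow 0 k (t - s) / (k`!%:R * m ^+ k) / m * xi w.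
    by rewrite factS natrM exprS; field; rewrite nat1r k0 f0 mk0 gt_eqF.
  by rewrite mulNr lerBlDr.
by rewrite lee_fin.
Qed.

(** Iterating [low_sub] leaves the [n]-th image of [low k.+1 s], which must tend to 0. This function
    vanishes below [s], so multiplying it by [exp (v - s)] only increases it; then it is pulled out
    as a nondecreasing weight, and the iterates of the exponential give the bound [C rho^n]. *)
Lemma potential_low k s t : ((low k.+1 s t)%:E <= U (EFin \o low k s) t)%E.
Proof.
have hk := borel_ge0_low k s; have hk1 := borel_ge0_low k.+1 s.
pose C := low k.+1 s t * expR (t - s).
have part n : ((low k.+1 s t)%:E <= U (EFin \o low k s) t + (C * rho ^+ n)%:E)%E.
  have H0 u : ((low k.+1 s u)%:E <=
      \sum_(0 <= r < n) iter r (stepE P xi) (EFin \o low k s) u +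
      iter n (stepE P xi) (EFin \o low k.+1 s) u)%E.
    elim: n u => [|n IH] u; first by rewrite big_nil add0e.
    apply: le_trans (IH u) _; rewrite big_nat_recr //= -addeA leeD2l //.
    rewrite -iterS iterSr -(stepE_iterD P mxi n u hk (borel_ge0_stepE P mxi hk1)).
    apply: le_iter => //; first exact: (borel_ge0D hk (borel_ge0_stepE P mxi hk1)).
    by move=> v; exact: low_sub.
  apply: le_trans (H0 t) _; apply: leeD.
    apply: nneseries_lim_ge => r _ _; exact: (borel_ge0_iter P mxi r hk).2.
  have be : borel_ge0 (fun v => (expR (- s))%:E * (EFin \o expR) v)%E.
    apply: borel_ge0M; last exact: borel_ge0_expR.
    by split; [exact: measurable_cst|move=> ?; rewrite lee_fin expR_ge0].
  apply: (@le_trans _ _ (iter n (stepE P xi) (fun u => (low k.+1 s u)%:E *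
     ((expR (- s))%:E * (EFin \o expR) u))%E t)).
    apply: le_iter => //; first exact: (borel_ge0M hk1 be).
    move=> v; rewrite -!EFinM lee_fin -expRD.
    have [vs|vs] := ltP (v - s) 0; first by rewrite /low tpow_lt0 // !mul0r.
    by rewrite ler_peMr ?low_ge0 // -[leLHS]expR0 ler_expR addrC.
  apply: le_trans (iter_weight P mxi xi_ge0 n t be (@low_ge0 k.+1 s) (@low_mono k.+1 s)) _.
  rewrite (stepE_iterZ P mxi n t borel_ge0_expR) ?expR_ge0 // iter_expR -!EFinM lee_fin.
  by rewrite /C expRD le_eqVlt; apply/orP; left; apply/eqP; ring.
have rho01 := rho_lt1; have rho0 := rho_ge0.
have C0 : 0 <= C by rewrite mulr_ge0 ?low_ge0 ?expR_ge0.
apply/lee_addgt0Pr => e e0.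
have [n _ hn] : \forall n \near \oo, `|C * rho ^+ n| < e.
  have : (fun n => C * rho ^+ n) @ \oo --> 0.
    by apply: cvg_geometric; rewrite ger0_norm.
  by move/cvgr0Pnorm_lt/(_ e e0).
apply: le_trans (part n) _; apply: leeD2l; rewrite lee_fin ltW //.
by apply: le_lt_trans (hn n _) => //=; exact: ler_norm.
Qed.

(** Jensen's inequality: the truncated power lies above its tangent at [t - s - e1], so the extra
    step costs only a shift by its mean [e1 = E |log (1 - W)|]. *)
Lemma A_low k s t : ((low k.+1 (s + e1) t)%:E <= A (EFin \o low k s) t)%E.
Proof.
apply: (@le_trans _ _ (stepE P eta (EFin \o low k.+1 s) t)); last first.
  apply: le_stepE => [//|||w]; first exact: borel_ge0_low.
    by apply: borel_ge0_U; exact: borel_ge0_low.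
  exact: potential_low.
have D0 := den_gt0 k.+1; have Di : 0 <= (k.+1`!%:R * m ^+ k.+1)^-1 by rewrite invr_ge0 ltW.
have [ts|ts] := ltP (t - (s + e1)) 0.
  rewrite [X in (X%:E <= _)%E](_ : _ = 0); last by rewrite /low tpow_lt0 // mul0r.
  exact: (borel_ge0_stepE P meta (borel_ge0_low _ _)).2.
set z := t - (s + e1) in ts.
have hB : has_mean P (fun w => z ^+ k.+1 / (k.+1`!%:R * m ^+ k.+1) +
    (k.+1%:R * z ^+ k / (k.+1`!%:R * m ^+ k.+1)) * (e1 - eta w))
    (z ^+ k.+1 / (k.+1`!%:R * m ^+ k.+1) + (k.+1%:R * z ^+ k / (k.+1`!%:R * m ^+ k.+1)) * (e1 - e1)).
  apply: has_meanD; first exact: has_mean_cst.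
  by apply: has_meanZ; apply: has_meanB; first exact: has_mean_cst.
have := stepE_ge_mean (h := low k.+1 s) (t := t) meta eta_ge0 (@low_mono k.+1 s)
  (@low_ge0 k.+1 s) hB.
rewrite subrr mulr0 addr0 => H; apply: le_trans (H _).
  by rewrite lee_fin /low -/z tpowE0.
move=> w; rewrite /low mulrAC -mulrDl ler_wpM2r //.
have := @tpow_tangent _ k (t - eta w - s) z ts.
by apply: le_trans; rewrite /z lerD2l le_eqVlt; apply/orP; left; apply/eqP; ring.
Qed.

Lemma iterA_low i t : ((low i (i%:R * e1) t)%:E <= iter i A (EFin \o tpow 0 0) t)%E.
Proof.
elim: i t => [|i IH] t.
  by rewrite /low mul0r subr0 expr0 mulr1 divr1.
apply: (@le_trans _ _ (A (EFin \o low i (i%:R * e1)) t)).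
  by have := A_low i (i%:R * e1) t; rewrite -natr1 mulrDl mul1r.
apply: le_A => //; first exact: borel_ge0_low.
by apply: borel_ge0_iterA; exact: borel_ge0_tpow.
Qed.

(* A box with e^t < 1 expected balls is hit with probability at most small t,
   and a box with e^t >= 1 expected balls is missed with probability at most
   large t. *)
Definition small t : R := if t < 0 then expR t else 0.
Definition large t : R := if 0 <= t then expR (- t) else 0.

Lemma borel_ge0_small : borel_ge0 (EFin \o small : R -> \bar R).
Proof.
split; last by move=> t; rewrite lee_fin /small; case: ifP; rewrite ?expR_ge0.
apply/measurable_EFinP; apply: measurable_fun_ifT => //.
  exact: measurable_fun_ltr.
Qed.

Lemma borel_ge0_large : borel_ge0 (EFin \o large : R -> \bar R).
Proof.
split; last by move=> t; rewrite lee_fin /large; case: ifP; rewrite ?expR_ge0.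
apply/measurable_EFinP; apply: measurable_fun_ifT => //.
  exact: measurable_fun_ler.
by apply: (measurableT_comp (f := expR)).
Qed.

(** Below 0 the function [kap exp t] solves the renewal equation exactly, because
    [kap = 1 + kap rho]; above 0 the source vanishes and monotonicity is enough. *)
Lemma potential_small t : (U (EFin \o small) t <= (kap * Num.min 1 (expR t))%:E)%E.
Proof.
have k0 := kap_gt0.
pose h t := kap * Num.min 1 (expR t).
have h0 s : 0 <= h s by rewrite mulr_ge0 ?(ltW k0) // le_min ler01 expR_ge0.
have hm : {homo h : s t / s <= t}.
  move=> s s' ss; rewrite ler_wpM2l ?(ltW k0) // le_min !ge_min lexx /=.
  by rewrite ler_expR ss orbT.
have bh := borel_ge0_nondecreasing hm h0.
apply: (le_potential_super mxi borel_ge0_small bh) => {}t.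
rewrite /= /small; case: ifPn => t0; last first.
  by rewrite add0e; apply: stepE_le_homo => //; exact: xi_ge0.
have -> : h t = expR t + kap * (rho * expR t).
  rewrite /h min_r; last by rewrite -[leRHS]expR0 ler_expR ltW.
  transitivity (kap * (1 - rho) * expR t + kap * (rho * expR t)); first by ring.
  by rewrite kapM mul1r.
rewrite EFinD leeD2l // EFinM -stepE_expR -(stepEZ P mxi t borel_ge0_expR (ltW k0)).
apply: le_stepE => [//|//||w].
  apply: borel_ge0M; last exact: borel_ge0_expR.
  by split; [exact: measurable_cst|move=> ?; rewrite lee_fin ltW].
by rewrite -EFinM lee_fin ler_wpM2l ?(ltW k0) // ge_min lexx orbT.
Qed.

(** Below 0 the extra step contributes [E exp (- eta) = 1 - rho = 1 / kap], so [small t] returns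
    with factor 1: the expected number of balls is conserved. A heavy box adds at most [kap] through
    its light children. *)
Lemma A_small t : (A (EFin \o small) t <= (small t + kap * tpow 0 0 t)%:E)%E.
Proof.
have k0 := kap_gt0.
pose h t := kap * Num.min 1 (expR t).
have h0 s : 0 <= h s by rewrite mulr_ge0 ?(ltW k0) // le_min ler01 expR_ge0.
have hm : {homo h : s t / s <= t}.
  move=> s s' ss; rewrite ler_wpM2l ?(ltW k0) // le_min !ge_min lexx /=.
  by rewrite ler_expR ss orbT.
have bh := borel_ge0_nondecreasing hm h0.
have [t0|t0] := ltP t 0; last first.
  rewrite {2}/small ltNge t0 /= add0r tpowE0 // expr0 mulr1.
  apply: (@le_trans _ _ (h t)%:E); last by rewrite lee_fin /h ler_piMr ?(ltW k0) // ge_min lexx.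
  apply: (A_le_super (h := EFin \o h)) => //; first exact: borel_ge0_small.
  by move=> s; exact: potential_small.
rewrite {2}/small t0 tpow_lt0 // mulr0 addr0.
apply: (@le_trans _ _ (stepE P eta (EFin \o h) t)).
  apply: le_stepE => [//||//|w]; last exact: potential_small.
  exact: borel_ge0_U borel_ge0_small.
have hB := has_meanZ (kap * expR t) subW_mean.
have -> : expR t = kap * expR t * (1 - rho) by rewrite mulrAC kapM mul1r.
apply: (stepE_le_mean meta eta_ge0 hm h0 hB) => w.
rewrite /h -mulrA ler_wpM2l ?(ltW k0) // -expRNeta -expRD.
by rewrite ge_min lexx orbT.
Qed.

(** The supersolution [kap (2 - exp (- t))] on [0 <= t] falls by at least [kap exp (- t) (1 - W)] in
    one step, because [1 / W - 1 >= 1 - W], and the mean of this is [large t]. The 2 keeps the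
    comparison function nonnegative when the step ends below 0. *)
Lemma A_large t : (A (EFin \o large) t <= (2 * kap * tpow 0 0 t)%:E)%E.
Proof.
have k0 := kap_gt0.
pose h t := if 0 <= t then kap * (2 - expR (- t)) else 0.
have e1t (s : R) : 0 <= s -> expR (- s) <= 1 by move=> s0; rewrite -[leRHS]expR0 ler_expR oppr_le0.
have h0 s : 0 <= h s.
  by rewrite /h; case: ifP => // /e1t H; rewrite mulr_ge0 ?(ltW k0) //; lra.
have hm : {homo h : s t / s <= t}.
  move=> s s' ss; rewrite {1}/h; case: ifPn => // s0; rewrite /h (le_trans s0 ss).
  by rewrite ler_wpM2l ?(ltW k0) // lerB // ler_expR lerN2.
have bh := borel_ge0_nondecreasing hm h0.
apply: (@le_trans _ _ (h t)%:E); last first.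
  rewrite lee_fin /h; case: ifPn => t0; last by rewrite mulr_ge0 ?tpow_ge0 // mulr_ge0 // ltW.
  rewrite tpowE0 // expr0 mulr1 mulrC ler_wpM2r ?(ltW k0) //.
  by have := expR_ge0 (- t); lra.
apply: (A_le_super (h := EFin \o h)) => //; first exact: borel_ge0_large.
apply: (le_potential_super mxi borel_ge0_large bh) => {}t.
rewrite /= /large; case: ifPn => t0; last first.
  by rewrite add0e; apply: stepE_le_homo => //; exact: xi_ge0.
have hB : has_mean P (fun w => kap * (2 - expR (- t)) + (- (kap * expR (- t))) * (1 - W w))
    (kap * (2 - expR (- t)) + (- (kap * expR (- t))) * (1 - rho)).
  by apply: has_meanD; [exact: has_mean_cst|exact: has_meanZ subW_mean].
have := stepE_le_mean (h := h) (t := t) mxi xi_ge0 hm h0 hB.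
have -> : (- (kap * expR (- t))) * (1 - rho) = - expR (- t).
  by rewrite mulNr mulrAC kapM mul1r.
move=> H; apply: le_trans (leeD2l _ (H _)) _.
  move=> w; have /andP[W0 W1] := W01 w; have E := e1t _ t0; have E0 := expR_gt0 (- t).
  rewrite mulNr -mulrA -mulrBr /h; case: ifPn => tx.
    rewrite ler_wpM2l ?(ltW k0) // opprB expRD addrC.
    have -> : expR (xi w) = (W w)^-1 by rewrite -expRNxi -expRN opprK.
    have : 1 + (1 - W w) <= (W w)^-1.
      by rewrite -[(W w)^-1]mul1r ler_pdivlMr //; nra.
    move: (W w)^-1 => v Hv; nra.
  apply: mulr_ge0; first exact: ltW.
  nra.
rewrite -EFinD lee_fin ?/h ?t0; lra.
Qed.

Lemma A_D f g t : borel_ge0 f -> borel_ge0 g -> (A (f \+ g) t = A f t + A g t)%E.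
Proof.
move=> hf hg; rewrite /splitE -(stepED P meta t (borel_ge0_U hf) (borel_ge0_U hg)).
by congr (stepE P eta _ t); apply/funext => s; exact: potentialD.
Qed.

Lemma A_Z f k t : borel_ge0 f -> 0 <= k ->
  (A (fun s => k%:E * f s) t = k%:E * A f t)%E.
Proof.
move=> hf k0; rewrite /splitE -(stepEZ P meta t (borel_ge0_U hf) k0).
by congr (stepE P eta _ t); apply/funext => s; exact: potentialZ.
Qed.

Lemma iterA_D f g i t : borel_ge0 f -> borel_ge0 g ->
  (iter i A (f \+ g) t = iter i A f t + iter i A g t)%E.
Proof.
move=> hf hg; elim: i t => //= i IH t.
rewrite -(A_D t (borel_ge0_iterA i hf) (borel_ge0_iterA i hg)).
by congr (A _ t); apply/funext => s; exact: IH.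
Qed.

Lemma iterA_Z f k i t : borel_ge0 f -> 0 <= k ->
  (iter i A (fun s => k%:E * f s) t = k%:E * iter i A f t)%E.
Proof.
move=> hf k0; elim: i t => //= i IH t.
rewrite -(A_Z t (borel_ge0_iterA i hf) k0).
by congr (A _ t); apply/funext => s; exact: IH.
Qed.

Let h0 : borel_ge0 (EFin \o tpow 0 0 : R -> \bar R).
Proof. exact: borel_ge0_tpow. Qed.

Lemma borel_ge0Z k f : 0 <= k -> borel_ge0 f -> borel_ge0 (fun s : R => k%:E * f s)%E.
Proof.
move=> k0 hf; apply: borel_ge0M; last exact: hf.
by split; [exact: measurable_cst|move=> ?; rewrite lee_fin].
Qed.

(** Each light box is charged to the generation [i] of its last heavy ancestor. *)
Lemma iterA_small j t :
  (iter j A (EFin \o small) t <= (small t + kap * \sum_(i < j) phi i t)%:E)%E.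
Proof.
have k0 := ltW kap_gt0.
elim: j => [|j IH]; first by rewrite big_ord0 mulr0 addr0.
have hZ := borel_ge0Z k0 h0.
rewrite iterSr; apply: (@le_trans _ _ (iter j A
   ((EFin \o small) \+ (fun s => kap%:E * (EFin \o tpow 0 0) s))%E t)).
  apply: le_iterA.
  - exact: borel_ge0_A borel_ge0_small.
  - exact: borel_ge0D borel_ge0_small hZ.
  - by move=> s; apply: le_trans (A_small s) _; rewrite EFinD EFinM.
rewrite (iterA_D _ _ borel_ge0_small hZ) (iterA_Z _ _ h0 k0).
rewrite big_ord_recr /= mulrDr addrA EFinD leeD //.
rewrite [in leRHS]EFinM; apply: lee_wpmul2l; last exact: iterA_phi.
by rewrite lee_fin.
Qed.

Lemma iterA_large j t :
  (iter j.+1 A (EFin \o large) t <= (2 * kap * phi j t)%:E)%E.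
Proof.
have k0 : 0 <= 2 * kap by rewrite mulr_ge0 // ltW // kap_gt0.
have hZ := borel_ge0Z k0 h0.
rewrite iterSr; apply: (@le_trans _ _ (iter j A
   (fun s => (2 * kap)%:E * (EFin \o tpow 0 0) s)%E t)).
  apply: le_iterA => //; first exact: borel_ge0_A borel_ge0_large.
  by move=> s; apply: le_trans (A_large s) _; rewrite EFinM.
rewrite (iterA_Z _ _ h0 k0) [in leRHS]EFinM; apply: lee_wpmul2l; last exact: iterA_phi.
by rewrite lee_fin.
Qed.

Lemma borel_ge0_psi k : borel_ge0 (EFin \o psi k : R -> \bar R).
Proof. exact: borel_ge0_nondecreasing (@psi_mono k) (psi_ge0 k). Qed.

(** [psi k] equals itself times the indicator of [0 <= t]; being nondecreasing, it comes out of the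
    iterates with its value at the start. *)
Lemma iterA_psi k i t :
  (iter i A (EFin \o psi k) t <= (psi k t * phi i t)%:E)%E.
Proof.
have E : EFin \o psi k = (fun s => (psi k s)%:E * (EFin \o tpow 0 0) s)%E.
  apply/funext => s /=; rewrite -EFinM; congr EFin.
  rewrite /tpow; case: ifPn => s0; first by rewrite expr0 mulr1.
  by rewrite /psi /tpow (negbTE s0) mul0r expr0n /= mulr0.
rewrite E; apply: le_trans (iterA_weight i t h0 (psi_ge0 k) (@psi_mono k)) _.
rewrite [in leRHS]EFinM; apply: lee_wpmul2l; last exact: iterA_phi.
by rewrite lee_fin psi_ge0.
Qed.

End Renewal.

(** * Independent families of sigma-algebras *)

Section Grouping.
Context {d : measure_display} {T : measurableType d} {R : realType}.
Variable P : probability T R.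
Variables (I : choiceType) (F : I -> set (set T)).
Hypothesis Fm : forall i, F i `<=` measurable.
Hypothesis Fsigma : forall i, sigma_algebra setT (F i).
Hypothesis Find : independent_classes P F.

Lemma sigma_class_T i : F i setT.
Proof. by have [F0 FC _] := Fsigma i; rewrite -(setD0 setT); exact: FC. Qed.

Lemma sigma_class_I i : setI_closed (F i).
Proof.
move=> A B FA FB; rewrite -(sigma_algebra_id (Fsigma i)).
by apply: (@measurableI _ (g_sigma_algebraType (F i))); apply: sub_sigma_algebra.
Qed.

Definition other_classes (u : I) : set (set T) := \bigcup_(i in [set i | i != u]) F i.

Lemma other_classes_measurable u : <<s other_classes u >> `<=` measurable.
Proof.
apply: smallest_sub; first exact: sigma_algebra_measurable.
by move=> A [i _ FA]; exact: Fm FA.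
Qed.

(** Finite intersections of events from classes other than [u] form a pi-system on which [B]
    factorises. The measures [P (.]&[B)] and [P B * P] agree there, hence on the generated
    sigma-algebra. *)
Lemma independent_others u A B : <<s other_classes u >> A -> F u B ->
  P (A `&` B) = (P A * P B)%E.
Proof.
move=> sA FB; have mB := Fm FB.
pose G : set (set T) := [set A | exists s (E : I -> set T), [/\ uniq s, u \notin s,
  (forall i, i \in s -> F i (E i)) & A = \bigcap_(i in [set` s]) E i]].
have Gm : G `<=` measurable.
  move=> _ [s [E [us _ FE ->]]]; rewrite bigcap_seq big_seq; apply: bigsetI_measurable => i /FE.
  exact: Fm.
have GI : setI_closed G.
  move=> _ _ [s [E [us nus FE ->]]] [s' [E' [us' nus' FE' ->]]].
  pose E2 i := (if i \in s then E i else setT) `&` (if i \in s' then E' i else setT).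
  exists (undup (s ++ s')), E2; split.
  - exact: undup_uniq.
  - by rewrite mem_undup mem_cat negb_or nus.
  - move=> i _; apply: sigma_class_I.
      by case: ifP => [/FE//|_]; exact: sigma_class_T.
    by case: ifP => [/FE'//|_]; exact: sigma_class_T.
  - apply/seteqP; split => w.
      move=> [h1 h2] i /=; rewrite mem_undup mem_cat /E2 => _; split.
        by case: ifP => // /h1.
      by case: ifP => // /h2.
    move=> h; split => i /= si; have := h i; rewrite /= mem_undup mem_cat si ?orbT => /(_ isT).
      by move=> []; rewrite si.
    by move=> []; rewrite si.
have G1 : G setT.
  exists [::], (fun=> setT); split => //.
  by apply/seteqP; split.
have PB : P B \is a fin_num by rewrite fin_num_measure.
have PB0 : 0 <= fine (P B) by rewrite fine_ge0.
have H : mrestr P mB A = mscale (NngNum PB0) P A.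
  apply: (g_sigma_algebra_measure_unique G Gm (fun=> setT)) => //.
  - by rewrite bigcup_const //; exists 0%N.
  - move=> _ [s [E [us nus FE ->]]]; rewrite /mrestr /mscale /=.
    have := Find (s := u :: s) (E := fun i => if i == u then B else E i).
    rewrite /= nus us => /(_ isT) H.
    transitivity (P ((\bigcap_(i in [set` s]) E i) `&` B)) => //.
    transitivity ((fine (P B))%:E * P (\bigcap_(i in [set` s]) E i))%E => //.
    rewrite fineK //.
    have E2 : (\bigcap_(i in [set` s]) E i) `&` B =
       \bigcap_(i in [set` u :: s]) (if i == u then B else E i).
      apply/seteqP; split => w.
        move=> [h1 h2] i /=; rewrite in_cons; case: eqP => //= _; exact: h1.
      move=> h; split; last by have := h u; rewrite /= in_cons eqxx; apply.
      move=> i /= si; have := h i; rewrite /= in_cons si orbT.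
      by case: eqP => [iu|_]; [move: nus; rewrite -iu si|exact].
    rewrite E2 H; last first.
      move=> i; rewrite in_cons; case: eqP => [-> //|_ /=]; exact: FE.
    rewrite big_cons eqxx; congr (_ * _)%E; rewrite (Find us FE).
    rewrite big_seq [RHS]big_seq; apply: eq_bigr => i si; case: eqP => // iu.
    by move: nus; rewrite -iu si.
  - move=> k; change (P (setT `&` B) < +oo)%E.
    by rewrite setTI ltey_eq PB.
  - apply: sub_smallest2r sA; first exact: smallest_sigma_algebra.
    move=> C [i /= iu FC]; exists [:: i], (fun=> C); split => //.
    + by rewrite inE eq_sym.
    + by move=> k; rewrite inE => /eqP ->.
    + by apply/seteqP; split => [w Cw k //|w h]; apply: (h i); rewrite /= inE.
by move: H; rewrite /mrestr /mscale /= fineK // muleC.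
Qed.

End Grouping.

Section IndependentIntegral.
Context {d d1 d2 : measure_display} {T : measurableType d}
  {T1 : measurableType d1} {T2 : measurableType d2} {R : realType}.
Variable P : probability T R.
Variable G : set (set T).
Variables (X : T -> T1) (Y : T -> T2).
Hypothesis Gm : <<s G >> `<=` measurable.
Hypothesis mX : measurable_fun setT (X : g_sigma_algebraType G -> T1).
Hypothesis mY : measurable_fun setT Y.
Hypothesis GY : forall A B, <<s G >> A -> measurable B ->
  P (A `&` Y @^-1` B) = (P A * P (Y @^-1` B))%E.

Lemma measurable_fun_sub : measurable_fun setT X.
Proof. by move=> _ B mB; apply: Gm; apply: mX. Qed.

Local Open Scope ereal_scope.

(** The law of the pair is a product measure, since it factorises on rectangles; Tonelli then
    freezes [X] and integrates an independent copy of [Y]. *)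
Lemma independent_integral (F : T1 * T2 -> \bar R) :
  measurable_fun setT F -> (forall z, 0 <= F z) ->
  \int[P]_w F (X w, Y w) = \int[P]_w \int[P]_w' F (X w, Y w').
Proof.
move=> mF F0; have mX' := measurable_fun_sub.
pose X' : {RV P >-> T1} := HB.pack X (isMeasurableFun.Build _ _ _ _ X mX').
pose Y' : {RV P >-> T2} := HB.pack Y (isMeasurableFun.Build _ _ _ _ Y mY).
have mZ : measurable_fun setT (fun w => (X w, Y w)) by exact: measurable_fun_pair.
pose Z' : {RV P >-> (T1 * T2)%type} :=
  HB.pack (fun w => (X w, Y w)) (isMeasurableFun.Build _ _ _ _ (fun w => (X w, Y w)) mZ).
have E0 : \int[P]_w F (X w, Y w) = \int[distribution P Z']_z F z.
  by rewrite ge0_integral_pushforward //= preimage_setT.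
rewrite E0 (eq_measure_integral (distribution P X' \x distribution P Y')); last first.
  move=> C mC _; apply/esym; apply: product_measure_unique => // A B mA mB.
  rewrite -(GY _ mB); last by have := mX measurableT mA; rewrite setTI.
  by congr (P _); apply/seteqP; split.
rewrite fubini_tonelli1 //.
rewrite ge0_integral_pushforward //=; last 2 first.
- exact: measurable_fun_fubini_tonelli_F.
- by move=> x _; exact: integral_ge0.
rewrite preimage_setT; apply: eq_integral => w _ /=.
rewrite /fubini_F ge0_integral_pushforward //= ?preimage_setT //.
exact: measurableT_comp.
Qed.

End IndependentIntegral.

Lemma independent_sets_of_class {d d2 : measure_display} {T : measurableType d}
  {T2 : measurableType d2} {R : realType} (P : probability T R)
  (I : choiceType) (F : I -> set (set T)) (u : I) (Y : T -> T2) :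
  (forall i, F i `<=` measurable) -> (forall i, sigma_algebra setT (F i)) ->
  independent_classes P F ->
  (forall B, measurable B -> F u (Y @^-1` B)) ->
  forall A B, <<s other_classes F u >> A -> measurable B ->
  P (A `&` Y @^-1` B) = (P A * P (Y @^-1` B))%E.
Proof. by move=> Fm Fs Fi FY A B sA mB; apply: independent_others sA _ => //; exact: FY. Qed.

(** * Many-to-one formulas for one stick-breaking *)

(* A box of weight p enters the renewal estimates at level ln (n * p). *)
Definition lnlift {R : realType} (f : R -> \bar R) (y : R) : \bar R :=
  if 0 < y then f (ln y) else 0%E.

Section Lift.
Context {R : realType}.
Implicit Types f g : R -> \bar R.

Lemma borel_ge0_lift f : borel_ge0 f -> borel_ge0 (lnlift f).
Proof.
move=> [mf f0]; split; last by move=> y; rewrite /lnlift; case: ifP.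
apply: measurable_fun_ifT => //; first exact: measurable_fun_ltr.
exact: measurableT_comp.
Qed.

Lemma lift_homo f : (forall t, 0 <= f t)%E -> {homo f : s t / s <= t >-> (s <= t)%E} ->
  {homo lnlift f : s t / s <= t >-> (s <= t)%E}.
Proof.
move=> f0 hf s t st; rewrite {1}/lnlift; case: ifPn => s0; last first.
  by rewrite /lnlift; case: ifP.
by rewrite /lnlift (lt_le_trans s0 st) hf // ler_ln // posrE // (lt_le_trans s0).
Qed.

Lemma liftM f g y : (lnlift f y * lnlift g y)%E = lnlift (f \* g)%E y.
Proof. by rewrite /lnlift; case: ifP => //; rewrite mule0. Qed.

End Lift.

Section MultiplicativeStep.
Context {d : measure_display} {T : measurableType d} {R : realType}.
Variable P : probability T R.
Implicit Types (f : R -> \bar R) (Z : T -> R).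

(** Steps are first taken multiplicatively: the copies of [W] lie in [(0, 1)] only almost surely, so
    logarithms are taken after they have been replaced in the integrals by [W] itself, which lies
    there everywhere. *)
Definition mstep Z f y : \bar R := (\int[P]_w f (y * Z w)%R)%E.

Lemma mstep_lift Z X f : (forall w, 0 < Z w) -> (forall w, X w = - ln (Z w)) ->
  mstep Z (lnlift f) = lnlift (stepE P X f).
Proof.
move=> Z0 XZ; apply/funext => y; rewrite {2}/lnlift; case: ifPn => y0.
  apply: eq_integral => w _; rewrite /lnlift pmulr_lgt0 // y0 lnM ?posrE //.
  by rewrite XZ opprK.
by apply: integral0_eq => w _; rewrite /lnlift pmulr_lgt0 // (negbTE y0).
Qed.

Lemma iter_mstep_lift Z X f r : (forall w, 0 < Z w) -> (forall w, X w = - ln (Z w)) ->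
  iter r (mstep Z) (lnlift f) = lnlift (iter r (stepE P X) f).
Proof.
by move=> Z0 XZ; elim: r => //= r ->; rewrite (mstep_lift _ Z0 XZ).
Qed.

Lemma borel_ge0_mstep Z f : measurable_fun setT Z -> borel_ge0 f -> borel_ge0 (mstep Z f).
Proof.
move=> mZ [mf f0]; split; last by move=> t; exact: integral_ge0.
pose F (z : R * T) := f (z.1 * Z z.2).
have mF : measurable_fun setT F.
  apply: measurableT_comp => //; apply: measurable_funM => //.
  exact: measurableT_comp.
have := @measurable_fun_fubini_tonelli_F _ _ _ _ _ P F mF.
by apply => z; exact: f0.
Qed.

End MultiplicativeStep.

Section StickBreaking.
Context {d : measure_display} {T : measurableType d} {R : realType}.
Variable P : probability T R.
Variable W : {RV P >-> R}.
Variable X : nat -> {RV P >-> R}.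
Hypothesis W01 : forall w, 0 < W w < 1.
Hypothesis X_iid : iid_copies W X.

Let F r : set (set T) := preimage_set_system setT (X r) measurable.

Let F_measurable r : F r `<=` measurable.
Proof. by move=> _ [B mB <-]; exact: measurable_funP. Qed.

Let F_sigma r : sigma_algebra setT (F r).
Proof. exact: sigma_algebra_preimage (sigma_algebra_measurable _). Qed.

Let F_indep : independent_classes P F. Proof. by case: X_iid. Qed.

Lemma X_sub u l : l != u ->
  measurable_fun setT (X l : g_sigma_algebraType (other_classes F u) -> R).
Proof.
by move=> lu _ B mB; apply: sub_sigma_algebra; exists l => //; exists B.
Qed.

Definition sticks r w : R := \prod_(l < r) X l w.

Lemma sticks0 : sticks 0 = cst 1.
Proof. by apply/funext => w; rewrite /sticks big_ord0. Qed.

Lemma sticksS r : sticks r.+1 = (fun w => sticks r w * X r w).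
Proof. by apply/funext => w; rewrite /sticks big_ord_recr. Qed.

Lemma sticks_sub u r : (r <= u)%N ->
  measurable_fun setT (sticks r : g_sigma_algebraType (other_classes F u) -> R).
Proof.
elim: r => [|r IH] ru.
  by rewrite sticks0; exact: measurable_cst.
rewrite sticksS; apply: measurable_funM; first exact: IH (ltnW ru).
by apply: X_sub; rewrite neq_ltn ru.
Qed.

Lemma measurable_sticks r : measurable_fun setT (sticks r).
Proof.
exact: measurable_fun_sub (other_classes_measurable F_measurable (u := r)) (sticks_sub (leqnn r)).
Qed.

Local Open Scope ereal_scope.

Lemma law_integral r (g : R -> \bar R) : borel_ge0 g ->
  \int[P]_w g (X r w) = \int[P]_w g (W w).
Proof.
move=> [mg g0].
have E (Z : {RV P >-> R}) : \int[P]_w g (Z w) = \int[distribution P Z]_x g x.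
  by rewrite ge0_integral_pushforward //= preimage_setT.
rewrite !E; apply: eq_measure_integral => B mB _.
by case: X_iid => H _; exact: H.
Qed.

Lemma independent_step {d1} {T1 : measurableType d1} u (Y : T -> T1)
    (H : T1 * R -> \bar R) :
  measurable_fun setT (Y : g_sigma_algebraType (other_classes F u) -> T1) ->
  measurable_fun setT H -> (forall z, 0 <= H z) ->
  \int[P]_w H (Y w, X u w) = \int[P]_w \int[P]_w' H (Y w, W w').
Proof.
move=> mY mH H0.
have Gm := other_classes_measurable F_measurable (u := u).
have GY := independent_sets_of_class (u := u) (Y := X u) F_measurable F_sigma F_indep.
rewrite (independent_integral Gm mY _ _ mH H0) //; last first.
  by apply: GY => B mB; exists B => //; rewrite setTI.
apply: eq_integral => w _; apply: (law_integral u (g := fun x => H (Y w, x))).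
by split => //; exact: measurableT_comp.
Qed.

(** The last [k] factors are integrated out one by one, the highest index first, while [g] keeps the
    first [r] alive for a second box. *)
Lemma sticks_pair r k (g f : R -> \bar R) y : borel_ge0 g -> borel_ge0 f ->
  \int[P]_w (g (sticks r w) * f (y * sticks (r + k) w)%R) =
  \int[P]_w (g (sticks r w) * iter k (mstep P W) f (y * sticks r w)%R).
Proof.
move=> hg; elim: k f => [|k IH] f hf; first by rewrite addn0.
have hMf : borel_ge0 (mstep P W f) by exact: borel_ge0_mstep.
rewrite iterSr -(IH _ hMf) addnS.
pose H (z : (R * R) * R) := g z.1.1 * f (y * (z.1.2 * z.2))%R.
have mH : measurable_fun setT H.
  apply: emeasurable_funM.
    by apply: measurableT_comp; [exact: hg.1|exact: measurableT_comp].
  apply: measurableT_comp; first exact: hf.1.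
  apply: measurable_funM => //; apply: measurable_funM => //.
  exact: measurableT_comp.
have H0 z : 0 <= H z by rewrite mule_ge0 ?hg.2 ?hf.2.
have mY : measurable_fun setT ((fun w => (sticks r w, sticks (r + k) w)) :
     g_sigma_algebraType (other_classes F (r + k)%N) -> (R * R)%type).
  by apply: measurable_fun_pair; apply: sticks_sub => //; exact: leq_addr.
have := independent_step mY mH H0.
rewrite sticksS /H /= => ->; apply: eq_integral => w _.
rewrite ge0_integralZl //.
- by congr (_ * _); apply: eq_integral => w' _; rewrite mulrA.
- apply: measurableT_comp; first exact: hf.1.
  apply: measurable_funM => //; exact: measurable_funM.
- by move=> w' _; exact: hf.2.
- exact: hg.2.
Qed.

Lemma sticks_iter r (f : R -> \bar R) y : borel_ge0 f ->
  \int[P]_w f (y * sticks r w)%R = iter r (mstep P W) f y.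
Proof.
move=> hf; have h1 : borel_ge0 (cst 1 : R -> \bar R).
  by split; [exact: measurable_cst|move=> ?; rewrite lee_fin].
have := sticks_pair 0 r y h1 hf; rewrite add0n.
under eq_integral do rewrite mul1e.
move=> ->; under eq_integral do rewrite mul1e /sticks big_ord0 mulr1.
by rewrite integral_cst //= probability_setT mule1.
Qed.

Lemma stick_breaking_iter r (f : R -> \bar R) y : borel_ge0 f ->
  \int[P]_w f (y * stick_breaking (fun r => X r) r w)%R =
  mstep P (fun w => 1 - W w)%R (iter r (mstep P W) f) y.
Proof.
move=> hf.
pose H (z : R * R) := f (y * (z.1 * (1 - z.2)))%R.
have mH : measurable_fun setT H.
  apply: measurableT_comp; first exact: hf.1.
  apply: measurable_funM => //; apply: measurable_funM => //.
  exact: measurable_funB.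
have H0 z : 0 <= H z by exact: hf.2.
have := independent_step (sticks_sub (leqnn r)) mH H0.
rewrite /H /= => E; rewrite -[LHS]/(\int[P]_w f (y * (sticks r w * (1 - X r w)))%R) E.
pose K (z : T * T) := f (y * (sticks r z.1 * (1 - W z.2)))%R.
have mK : measurable_fun setT K.
  apply: measurableT_comp; first exact: hf.1.
  apply: measurable_funM => //; apply: measurable_funM.
    by apply: measurableT_comp => //; exact: measurable_sticks.
  by apply: measurable_funB => //; exact: measurableT_comp.
rewrite (@fubini_tonelli _ _ _ _ _ P P K mK); last by move=> z; exact: hf.2.
apply: eq_integral => w _; rewrite -sticks_iter //.
by apply: eq_integral => w' _; congr f; rewrite -mulrA; congr (_ * _)%R; rewrite mulrC.
Qed.


Lemma iter_series (Z : T -> R) r (g : nat -> R -> \bar R) t : measurable_fun setT Z ->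
  (forall k, borel_ge0 (g k)) ->
  iter r (stepE P Z) (fun s => \sum_(k <oo) g k s) t =
  \sum_(k <oo) iter r (stepE P Z) (g k) t.
Proof.
move=> mZ hg; elim: r t => //= r IH t.
rewrite -(stepE_series P mZ); last by move=> k; exact: borel_ge0_iter.
by congr (stepE P Z _ t); apply/funext => s; exact: IH.
Qed.

Let W0 w : (0 < W w)%R. Proof. by case/andP: (W01 w). Qed.
Let W1 w : (0 < 1 - W w)%R. Proof. by case/andP: (W01 w); rewrite subr_gt0. Qed.
Let m1W : measurable_fun setT (fun w => 1 - W w)%R. Proof. exact: measurable_funB. Qed.
Let mxi : measurable_fun setT (xi W).
Proof.
have -> : xi W = (fun w => - ln (W w))%R by apply/funext => w; rewrite xiE.
by apply: measurableT_comp => //; exact: measurableT_comp.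
Qed.
Let meta : measurable_fun setT (eta W).
Proof.
have -> : eta W = (fun w => - ln (1 - W w))%R by apply/funext => w; rewrite etaE.
apply: measurableT_comp => //; exact: (measurableT_comp (f := @ln R)).
Qed.

Local Notation stick := (stick_breaking (fun r => X r)).

Lemma stick_breaking_series (f : R -> \bar R) y : borel_ge0 f ->
  \sum_(r <oo) \int[P]_w lnlift f (y * stick r w)%R = lnlift (splitE P W f) y.
Proof.
move=> hf.
under eq_eseriesr => r _.
  rewrite (stick_breaking_iter _ _ (borel_ge0_lift hf)).
  rewrite (iter_mstep_lift _ _ _ W0 (xiE W01)) (mstep_lift _ _ W1 (etaE W01)).
  over.
rewrite /lnlift; case: ifP => _; last by rewrite eseries0.
rewrite /splitE /potential (stepE_series P meta) // => r.
exact: borel_ge0_iter.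
Qed.

Lemma X_ae n : {ae P, forall w, forall l, (l < n)%N -> (0 < X l w < 1)%R}.
Proof.
elim: n => [|n IH]; first by apply: aeW.
have : {ae P, forall w, (0 < X n w < 1)%R}.
  have mI : measurable (~` [set` `]0%R, 1%R[ ] : set R) by apply: measurableC.
  exists (X n @^-1` (~` [set` `]0%R, 1%R[ ])); split.
  - by rewrite -[X in measurable X]setTI; apply: measurable_funP.
  - case: X_iid => H _; have := H n _ mI; rewrite /distribution /pushforward => ->.
    rewrite (_ : W @^-1` _ = set0) ?measure0 //; apply/seteqP; split => // w /=.
    by rewrite in_itv /= W01.
  - by move=> w /= h; rewrite in_itv /=.
apply: filterS2 IH => w h1 h2 l; rewrite ltnS leq_eqVlt => /orP[/eqP ->//|]; exact: h1.
Qed.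

Lemma measurable_stick r : measurable_fun setT (stick r).
Proof.
apply: measurable_funM; first exact: measurable_sticks.
exact: measurable_funB.
Qed.

Lemma stick_le_sticks r n y : (r < n)%N -> forall f, borel_ge0 f ->
  {homo f : s t / (s <= t)%R >-> s <= t} ->
  {ae P, forall w, lnlift f (y * stick r w)%R <= lnlift f (y * sticks r w)%R}.
Proof.
move=> rn f hf fm; apply: filterS (X_ae n) => w h.
have s0 : (0 < sticks r w)%R.
  by apply: prodr_gt0 => l _; case/andP: (h l (ltn_trans (ltn_ord l) rn)).
have /andP[x0 x1] := h r rn.
have [y0|y0] := ltP 0%R y.
  apply: lift_homo => //; first exact: hf.2.
  rewrite ler_pM2l // /stick_breaking ler_piMr // ?ltW //; lra.
rewrite {1}/lnlift ifF; last first.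
  apply/negbTE; rewrite -leNgt mulr_le0_ge0 // mulr_ge0 //; first exact: ltW.
  lra.
exact: (borel_ge0_lift hf).2.
Qed.

(** The factors [1 - X] are at most 1 and [f] is nondecreasing, so both are discarded. What remains
    are products of [r] and [r + k] factors sharing the first [r]; hence no step [eta] appears in
    [A2]. *)
Lemma stick_pair_le r k f y : borel_ge0 f ->
  {homo f : s t / (s <= t)%R >-> s <= t} ->
  \int[P]_w (lnlift f (y * stick r w)%R * lnlift f (y * stick (r + k) w)%R) <=
  lnlift (iter r (stepE P (xi W)) (f \* iter k (stepE P (xi W)) f)) y.
Proof.
move=> hf fm; have hlf := borel_ge0_lift hf.
have mc (Z : T -> R) : measurable_fun setT Z ->
    measurable_fun setT (fun w => lnlift f (y * Z w)%R).
  move=> mZ; apply: measurableT_comp; first exact: hlf.1.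
  exact: measurable_funM.
apply: (@le_trans _ _ (\int[P]_w (lnlift f (y * sticks r w)%R * lnlift f (y * sticks (r + k) w)%R))).
  apply: ae_ge0_le_integral => //.
  - by move=> w _; rewrite mule_ge0 ?hlf.2.
  - by apply: emeasurable_funM; apply: mc; exact: measurable_stick.
  - by move=> w _; rewrite mule_ge0 ?hlf.2.
  - by apply: emeasurable_funM; apply: mc; exact: measurable_sticks.
  have h1 := stick_le_sticks y (leq_addr k r.+1) hf fm.
  have h2 := stick_le_sticks y (leqnn (r + k).+1) hf fm.
  by apply: filterS2 h1 h2 => w h1 h2 _; apply: lee_pmul => //; exact: hlf.2.
have hg : borel_ge0 (fun x : R => lnlift f (y * x)%R).
  split; last by move=> x; exact: hlf.2.
  by apply: measurableT_comp; [exact: hlf.1|exact: measurable_funM].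
rewrite (sticks_pair r k y hg hlf) (iter_mstep_lift _ _ _ W0 (xiE W01)).
under eq_integral do rewrite liftM.
rewrite sticks_iter; last first.
  by apply: borel_ge0_lift; apply: borel_ge0M => //; exact: borel_ge0_iter.
by rewrite (iter_mstep_lift _ _ _ W0 (xiE W01)).
Qed.

Lemma stick_pair_series f y : borel_ge0 f -> (forall t, f t \is a fin_num) ->
  {homo f : s t / (s <= t)%R >-> s <= t} ->
  \sum_(r <oo) \sum_(r' <oo)
     \int[P]_w (lnlift f (y * stick r w)%R * lnlift f (y * stick r' w)%R) <=
  lnlift (A2 P W f) y.
Proof.
move=> hf ffin fm; have hlf := borel_ge0_lift hf.
pose g k := f \* iter k (stepE P (xi W)) f.
have hg k : borel_ge0 (g k) by apply: borel_ge0M => //; exact: borel_ge0_iter.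
pose b r k := lnlift (iter r (stepE P (xi W)) (g k)) y.
have b0 r k : 0 <= b r k.
  by rewrite /b; apply: (borel_ge0_lift _).2; apply: borel_ge0_iter.
pose a r r' := \int[P]_w (lnlift f (y * stick r w)%R * lnlift f (y * stick r' w)%R).
have a0 r r' : 0 <= a r r' by apply: integral_ge0 => w _; rewrite mule_ge0 ?hlf.2.
have aC r r' : a r r' = a r' r by apply: eq_integral => w _; rewrite muleC.
(* The symmetric double series is covered by an upper triangle and its transpose. The diagonal is
   counted twice, which an upper bound allows. *)
pose c r r' := if (r <= r')%N then b r (r' - r)%N else 0.
have c0 r r' : 0 <= c r r' by rewrite /c; case: ifP.
have ac r r' : a r r' <= c r r' + c r' r.
  have [rr|rr] := leqP r r'.
    apply: (@le_trans _ _ (c r r')); last by rewrite leeDl.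
    by rewrite /c rr -[in a _ _](subnKC rr); exact: stick_pair_le.
  apply: (@le_trans _ _ (c r' r)); last by rewrite leeDr.
  by rewrite aC /c (ltnW rr) -[in a _ _](subnKC (ltnW rr)); exact: stick_pair_le.
apply: (@le_trans _ _ (\sum_(r <oo) \sum_(r' <oo) (c r r' + c r' r))).
  apply: lee_nneseries => [r _ _|r _]; first by apply: nneseries_ge0 => *; exact: a0.
  by apply: lee_nneseries => *; [exact: a0|exact: ac].
have -> : \sum_(r <oo) \sum_(r' <oo) (c r r' + c r' r) =
    2%:E * \sum_(r <oo) \sum_(r' <oo) c r r'.
  under eq_eseriesr => r _.
    rewrite nneseriesD; [|by move=> *; exact: c0..].
    over.
  rewrite nneseriesD; [|by move=> *; apply: nneseries_ge0 => *; exact: c0..].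
  rewrite [X in _ + X]nneseries_interchange //.
  have -> : 2%:E = 1%:E + 1%:E :> \bar R by rewrite -EFinD.
  by rewrite ge0_muleDl // !mul1e.
have cE r : \sum_(r' <oo) c r r' = \sum_(k <oo) b r k.
  rewrite (nneseries_split 0 r) // add0n big1_seq ?add0e; last first.
    move=> r' /andP[_]; rewrite mem_index_iota => /andP[_ rr].
    by rewrite /c leqNgt rr.
  rewrite -(nneseries_addn r) //; apply: eq_eseriesr => k _.
  by rewrite /c leq_addl addnK.
under eq_eseriesr do rewrite cE.
rewrite /A2 /b /lnlift; case: ifP => _; last first.
  by under eq_eseriesr do rewrite eseries0 //; rewrite eseries0 // mule0.
rewrite le_eqVlt; apply/orP; left; apply/eqP; congr (_ * _).
apply: eq_eseriesr => r _; rewrite -iter_series //.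
congr (iter r _ _ _); apply/funext => s; rewrite /g /potential.
rewrite -(fineK (ffin s)) nneseriesZl // => k _; exact: (borel_ge0_iter P mxi k hf).2.
Qed.

End StickBreaking.

(** * Sums over words *)

Section WordSums.
Context {R : realType}.
Local Open Scope ereal_scope.
Implicit Types F G : word -> \bar R.

(** Covers the factor [+oo]: the functions of weights that are pulled out of series need not be
    known to be finite. *)
Lemma ge0_nneseriesZl (k : \bar R) (f : nat -> \bar R) : 0 <= k -> (forall r, 0 <= f r) ->
  \sum_(r <oo) k * f r = k * \sum_(r <oo) f r.
Proof.
move=> + f0; case: k => [k _||]; first exact: nneseriesZl.
  move=> _; have [h|/existsNP[r fr]] := pselect (forall r, f r = 0).
    rewrite !eseries0 ?mule0 // => r _ _; by rewrite h ?mule0.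
  have fr0 : 0 < f r by rewrite lt_neqAle f0 andbT eq_sym; apply/eqP.
  have term (g : nat -> \bar R) : (forall r, 0 <= g r) -> g r <= \sum_(r <oo) g r.
    move=> g0; rewrite (nneseriesD1 (n := r)) // leeDl // nneseries_ge0 //.
  rewrite [RHS]gt0_mulye; last exact: lt_le_trans fr0 (term _ f0).
  apply/eqP; rewrite eq_le leey /=.
  apply: le_trans (term (fun r => +oo * f r) _); first by rewrite gt0_mulye.
  by move=> r'; rewrite mule_ge0.
by [].
Qed.

(** The last letter is summed innermost: a sum over generation [j.+1] is a sum over generation [j]
    of sums over children, which matches inductions that integrate out the youngest generation
    first. *)
Fixpoint wsum (j : nat) F : \bar R :=
  if j is j'.+1 then wsum j' (fun u => \sum_(r <oo) F (rcons u r)) else F [::].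

Lemma wsum_ge0 j F : (forall v, 0 <= F v) -> 0 <= wsum j F.
Proof.
elim: j F => //= j IH F F0; apply: IH => u; exact: nneseries_ge0.
Qed.

Lemma eq_wsum j F G : (forall v, size v = j -> F v = G v) -> wsum j F = wsum j G.
Proof.
elim: j F G => [|j IH] F G FG /=; first exact: FG.
by apply: IH => u su; apply: eq_eseriesr => r _; rewrite FG // size_rcons su.
Qed.

Lemma le_wsum j F G : (forall v, 0 <= F v) -> (forall v, size v = j -> F v <= G v) ->
  wsum j F <= wsum j G.
Proof.
elim: j F G => [|j IH] F G F0 FG /=; first exact: FG.
apply: IH => [u|u su]; first exact: nneseries_ge0.
by apply: lee_nneseries => // r _; rewrite FG // size_rcons su.
Qed.

Lemma wsumD j F G : (forall v, 0 <= F v) -> (forall v, 0 <= G v) ->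
  wsum j (fun v => F v + G v) = wsum j F + wsum j G.
Proof.
elim: j F G => [|j IH] F G F0 G0 //=.
rewrite -IH; [|by move=> *; exact: nneseries_ge0..].
by apply: eq_wsum => u _; rewrite nneseriesD.
Qed.

Lemma wsumZl j F k : 0 <= k -> (forall v, 0 <= F v) ->
  wsum j (fun v => k * F v) = k * wsum j F.
Proof.
move=> k0; elim: j F => [|j IH] F F0 //=.
rewrite -IH; last by move=> *; exact: nneseries_ge0.
by apply: eq_wsum => u _; rewrite ge0_nneseriesZl.
Qed.

Lemma wsum_series j (F : nat -> word -> \bar R) : (forall r v, 0 <= F r v) ->
  wsum j (fun v => \sum_(r <oo) F r v) = \sum_(r <oo) wsum j (F r).
Proof.
elim: j F => [|j IH] F F0 //=.
rewrite -IH; last by move=> *; exact: nneseries_ge0.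
by apply: eq_wsum => u _; rewrite nneseries_interchange.
Qed.

Lemma wsum0 j : wsum j (fun=> 0) = 0.
Proof.
elim: j => //= j IH; rewrite -[RHS]IH; apply: eq_wsum => u _.
by rewrite eseries0.
Qed.

Lemma nneseries_pred1 (f : nat -> \bar R) r :  0 <= f r ->
  \sum_(k <oo) (if k == r then f k else 0) = f r.
Proof.
move=> fr; rewrite (nneseriesD1 (n := r)) //; last by move=> k _; case: eqP => // ->.
rewrite eqxx eseries0 ?adde0 // => k _ kr; by rewrite (negbTE kr).
Qed.

Lemma wsum_pred1 j v F : 0 <= F v ->
  wsum j (fun u => if u == v then F u else 0) = if size v == j then F v else 0.
Proof.
elim: j v F => [|j IH] v F Fv /=; first by case: v Fv.
case/lastP: v Fv => [|v r] Fv.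
  rewrite /= -[RHS](wsum0 j); apply: eq_wsum => u _.
  by apply: eseries0 => k _ _; case: u.
rewrite size_rcons eqSS -(IH v (fun u => F (rcons u r)) Fv).
apply: eq_wsum => u _; under eq_eseriesr do rewrite eqseq_rcons.
case: eqP => [->|_] /=; first exact: (nneseries_pred1 (f := fun k => F (rcons v k))).
by rewrite eseries0.
Qed.

Lemma wsum_sum j (I : Type) (s : seq I) (F : I -> word -> \bar R) :
  (forall i v, 0 <= F i v) ->
  wsum j (fun v => \sum_(i <- s) F i v) = \sum_(i <- s) wsum j (F i).
Proof.
move=> F0; elim: s => [|i s IH].
  by rewrite big_nil -[RHS](wsum0 j); apply: eq_wsum => v _; rewrite big_nil.
rewrite big_cons -IH -wsumD //; last by move=> v; apply: sume_ge0.
by apply: eq_wsum => v _; rewrite big_cons.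
Qed.

End WordSums.

Section WordSumsIntegral.
Context {d : measure_display} {T : measurableType d} {R : realType}.
Variable P : probability T R.
Local Open Scope ereal_scope.

Lemma measurable_wsum j (F : word -> T -> \bar R) :
  (forall v, measurable_fun setT (F v)) -> (forall v w, 0 <= F v w) ->
  measurable_fun setT (fun w => wsum j (F ^~ w)).
Proof.
elim: j F => [|j IH] F mF F0 /=; first exact: mF.
apply: (IH (fun u w => \sum_(r <oo) F (rcons u r) w)) => [u|u w].
  by apply: ge0_emeasurable_sum => // *; exact: F0.
exact: nneseries_ge0.
Qed.

Lemma wsum_integral j (F : word -> T -> \bar R) :
  (forall v, measurable_fun setT (F v)) -> (forall v w, 0 <= F v w) ->
  \int[P]_w wsum j (F ^~ w) = wsum j (fun v => \int[P]_w F v w).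
Proof.
elim: j F => [|j IH] F mF F0 //=.
rewrite (IH (fun u w => \sum_(r <oo) F (rcons u r) w)).
- by apply: eq_wsum => u _; rewrite integral_nneseries.
- by move=> u; apply: ge0_emeasurable_sum => // *; exact: F0.
- move=> *; exact: nneseries_ge0.
Qed.

End WordSumsIntegral.

(** * Moments of the number of heavy boxes *)

Section Tree.
Context {d : measure_display} {T : measurableType d} {R : realType}.
Variable P : probability T R.
Variable W : {RV P >-> R}.
Variable X : nat -> {RV P >-> R}.
Variable Pw : word -> nat -> {RV P >-> R}.
Hypothesis W01 : forall w, 0 < W w < 1.
Hypothesis X_iid : iid_copies W X.
Local Notation stick := (stick_breaking (fun r => X r)).
Hypothesis Pw_law : forall v, same_law P (fun r => Pw v r) stick.

Let F (v : word) : set (set T) := sigma_family (fun r => Pw v r : T -> R).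
Hypothesis Pw_indep : independent_classes P F.

Let F_sigma v : sigma_algebra setT (F v).
Proof. exact: smallest_sigma_algebra. Qed.

Let F_measurable v : F v `<=` measurable.
Proof.
apply: smallest_sub; first exact: sigma_algebra_measurable.
by move=> A [r _ [B mB <-]]; exact: measurable_funP.
Qed.

Local Notation sub u := (g_sigma_algebraType (other_classes F u)).

Lemma Pw_sub u v r : v != u -> measurable_fun setT (Pw v r : sub u -> R).
Proof.
move=> vu _ B mB; apply: sub_sigma_algebra; exists v => //.
by apply: sub_sigma_algebra; exists r => //; exists B.
Qed.

Definition Pv (v : word) w : R := \prod_(k < size v) Pw (take k v) (nth 0%N v k) w.

Lemma Pv_nil : Pv [::] = cst 1.
Proof. by apply/funext => w; rewrite /Pv big_ord0. Qed.

Lemma Pv_rcons u r : Pv (rcons u r) = (fun w => Pv u w * Pw u r w).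
Proof.
apply/funext => w; rewrite /Pv size_rcons big_ord_recr /=; congr (_ * _).
  apply: eq_bigr => k _; by rewrite nth_rcons ltn_ord -cats1 takel_cat // ltnW.
by rewrite nth_rcons ltnn eqxx -cats1 take_cat ltnn subnn take0 cats0.
Qed.

(** [Pv v] involves only the splittings at proper prefixes of [v]; if [u] is not among them, [Pv v]
    is independent of the splitting at [u]. *)
Lemma Pv_sub u v : (forall k, (k < size v)%N -> take k v != u) ->
  measurable_fun setT (Pv v : sub u -> R).
Proof.
elim/last_ind: v => [_|v r IH H]; first by rewrite Pv_nil; exact: measurable_cst.
rewrite Pv_rcons; apply: measurable_funM.
  apply: IH => k kv; have := H k; rewrite size_rcons ltnS (ltnW kv) => /(_ isT).
  by rewrite -cats1 takel_cat // ltnW.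
apply: Pw_sub; have := H (size v); rewrite size_rcons ltnSn => /(_ isT).
by rewrite -cats1 take_size_cat.
Qed.

Lemma Pv_sub_size u v : (size v <= size u)%N ->
  measurable_fun setT (Pv v : sub u -> R).
Proof.
move=> vu; apply: Pv_sub => k kv; apply/eqP => e.
by have := leq_trans kv vu; rewrite -e size_takel ?ltnn // ltnW.
Qed.

Lemma measurable_Pv v : measurable_fun setT (Pv v).
Proof.
exact: measurable_fun_sub (other_classes_measurable F_measurable (u := v)) (Pv_sub_size (leqnn _)).
Qed.

Local Open Scope ereal_scope.
Implicit Types f : R -> \bar R.

Lemma Pw_integral u r r' (H : R * R -> \bar R) :
  measurable_fun setT H -> (forall z, 0 <= H z) ->
  \int[P]_w H (Pw u r w, Pw u r' w) = \int[P]_w H (stick r w, stick r' w).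
Proof.
move=> mH H0.
have ms r0 : measurable_fun setT (stick r0) := measurable_stick X r0.
have mp1 : measurable_fun setT (fun w => (Pw u r w, Pw u r' w)) by exact: measurable_fun_pair.
have mp2 : measurable_fun setT (fun w => (stick r w, stick r' w)) by exact: measurable_fun_pair.
pose Z1 : {RV P >-> (R * R)%type} := HB.pack (fun w => (Pw u r w, Pw u r' w))
  (isMeasurableFun.Build _ _ _ _ _ mp1).
pose Z2 : {RV P >-> (R * R)%type} := HB.pack (fun w => (stick r w, stick r' w))
  (isMeasurableFun.Build _ _ _ _ _ mp2).
transitivity (\int[distribution P Z1]_z H z).
  by rewrite ge0_integral_pushforward //= preimage_setT.
transitivity (\int[distribution P Z2]_z H z); last first.
  by rewrite ge0_integral_pushforward //= preimage_setT.
apply: eq_measure_integral => B mB _.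
pose C : set (nat -> R) := [set x | B (x r, x r')].
pose G : set (set (nat -> R)) := \bigcup_r0 preimage_set_system setT (fun x : nat -> R => x r0) measurable.
have mx r0 : measurable_fun setT ((fun x => x r0) : g_sigma_algebraType G -> R).
  move=> _ D mD; apply: sub_sigma_algebra; exists r0 => //; exists D => //.
have mC : sigma_family (fun r (x : nat -> R) => x r) C.
  have := @measurable_fun_pair _ _ _ (g_sigma_algebraType G) _ _ _ _ (mx r) (mx r').
  by move=> /(_ measurableT B mB); rewrite setTI.
exact: (Pw_law u mC).
Qed.

Lemma branching_integral {d1} {T1 : measurableType d1} u (Y : T -> T1) r r'
    (H : T1 * (R * R) -> \bar R) :
  measurable_fun setT (Y : sub u -> T1) ->
  measurable_fun setT H -> (forall z, 0 <= H z) ->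
  \int[P]_w H (Y w, (Pw u r w, Pw u r' w)) =
  \int[P]_w \int[P]_w' H (Y w, (stick r w', stick r' w')).
Proof.
move=> mY mH H0.
have Gm := other_classes_measurable F_measurable (u := u).
have mF r0 : measurable_fun setT (Pw u r0 : g_sigma_algebraType (F u) -> R).
  move=> _ B mB; apply: sub_sigma_algebra; apply: sub_sigma_algebra.
  by exists r0 => //; exists B.
have GY := independent_sets_of_class (u := u) (Y := fun w => (Pw u r w, Pw u r' w))
  F_measurable F_sigma Pw_indep.
rewrite (independent_integral Gm mY _ _ mH H0); first last.
- apply: GY => B mB; rewrite -(sigma_algebra_id (F_sigma u)).
  have := @measurable_fun_pair _ _ _ (g_sigma_algebraType (F u)) _ _ _ _ (mF r) (mF r').
  by move=> /(_ measurableT B mB); rewrite setTI.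
- exact: measurable_fun_pair.
apply: eq_integral => w _.
apply: (Pw_integral u r r' (H := fun z => H (Y w, z))) => //.
exact: measurableT_comp.
Qed.

(** The many-to-one formula for the children of [u] in the presence of other boxes: [Y] collects
    whatever is determined by the splittings at the other words. *)
Lemma branching_series {d1} {T1 : measurableType d1} u (Y : T -> T1)
    (G : T1 -> \bar R) (h : T1 -> R) f :
  measurable_fun setT (Y : sub u -> T1) ->
  measurable_fun setT G -> (forall z, 0 <= G z) -> measurable_fun setT h ->
  borel_ge0 f ->
  \sum_(r <oo) \int[P]_w (G (Y w) * lnlift f (h (Y w) * Pw u r w)%R) =
  \int[P]_w (G (Y w) * lnlift (splitE P W f) (h (Y w))).
Proof.
move=> mY mG G0 mh hf; have hlf := borel_ge0_lift hf.
have mY' := measurable_fun_sub (other_classes_measurable F_measurable (u := u)) mY.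
have mst r y : measurable_fun setT (fun w => lnlift f (y * stick r w)%R).
  apply: measurableT_comp; first exact: hlf.1.
  apply: measurable_funM => //; exact: measurable_stick.
have E r : \int[P]_w (G (Y w) * lnlift f (h (Y w) * Pw u r w)%R) =
   \int[P]_w (G (Y w) * \int[P]_w' lnlift f (h (Y w) * stick r w')%R).
  pose H (z : T1 * (R * R)) := G z.1 * lnlift f (h z.1 * z.2.1)%R.
  have mH : measurable_fun setT H.
    apply: emeasurable_funM; first exact: measurableT_comp.
    apply: measurableT_comp; first exact: hlf.1.
    apply: measurable_funM; first exact: measurableT_comp.
    exact: measurableT_comp.
  have H0 z : 0 <= H z by rewrite mule_ge0 // hlf.2.
  have := branching_integral r r mY mH H0; rewrite /H /= => ->.
  apply: eq_integral => w _; rewrite ge0_integralZl // => w' _; exact: hlf.2.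
under eq_eseriesr do rewrite E.
rewrite -integral_nneseries //.
- apply: eq_integral => w _; rewrite ge0_nneseriesZl //.
    by rewrite (stick_breaking_series W01 X_iid).
  by move=> r; apply: integral_ge0 => *; exact: hlf.2.
- move=> r; apply: emeasurable_funM; first exact: measurableT_comp.
  pose K (z : T * T) := lnlift f (h (Y z.1) * stick r z.2)%R.
  have mK : measurable_fun setT K.
    apply: measurableT_comp; first exact: hlf.1.
    apply: measurable_funM; first by apply: measurableT_comp => //; exact: measurableT_comp.
    by apply: measurableT_comp => //; exact: measurable_stick.
  have := @measurable_fun_fubini_tonelli_F _ _ _ _ _ P K mK.
  by apply => z; exact: hlf.2.
- by move=> r w _; rewrite mule_ge0 // integral_ge0 // => *; exact: hlf.2.
Qed.

Lemma lnlift_Pv_measurable f y v : borel_ge0 f ->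
  measurable_fun setT (fun w => lnlift f (y * Pv v w)%R).
Proof.
move=> hf; apply: measurableT_comp; first exact: (borel_ge0_lift hf).1.
by apply: measurable_funM => //; exact: measurable_Pv.
Qed.

Let mxi : measurable_fun setT (xi W).
Proof.
have -> : xi W = (fun w => - ln (W w))%R by apply/funext => w; rewrite xiE.
by apply: measurableT_comp => //; exact: measurableT_comp.
Qed.
Let meta : measurable_fun setT (eta W).
Proof.
have -> : eta W = (fun w => - ln (1 - W w))%R by apply/funext => w; rewrite etaE.
apply: measurableT_comp => //; apply: (measurableT_comp (f := @ln R)) => //.
exact: measurable_funB.
Qed.

Lemma borel_ge0_splitE f : borel_ge0 f -> borel_ge0 (splitE P W f).
Proof.
by move=> hf; apply: borel_ge0_stepE => //; exact: borel_ge0_potential.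
Qed.

Lemma first_moment j f y : borel_ge0 f ->
  wsum j (fun v => \int[P]_w lnlift f (y * Pv v w)%R) = lnlift (iter j (splitE P W) f) y.
Proof.
elim: j f => [|j IH] f hf.
  rewrite /= Pv_nil; under eq_integral do rewrite mulr1.
  by rewrite integral_cst //= probability_setT mule1.
rewrite iterSr -IH; last exact: borel_ge0_splitE.
rewrite [LHS]/=; apply: eq_wsum => u _.
have mh : measurable_fun setT (fun x : R => y * x)%R by exact: measurable_funM.
have := branching_series (Y := Pv u) (G := cst 1%E)
   (Pv_sub_size (leqnn (size u))) (measurable_cst _) (fun=> lee01) mh hf.
move=> /= H; transitivity (\int[P]_w (1%E * lnlift (splitE P W f) (y * Pv u w)%R)).
  rewrite -H; apply: eq_eseriesr => r _; apply: eq_integral => w _.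
  by rewrite mul1e Pv_rcons mulrA.
by apply: eq_integral => w _; rewrite mul1e.
Qed.

Definition pair_sum j f y := wsum j (fun v => wsum j (fun v' =>
  if v != v' then \int[P]_w (lnlift f (y * Pv v w)%R * lnlift f (y * Pv v' w)%R) else 0)).

Lemma siblings_series u f y : borel_ge0 f -> (forall t, f t \is a fin_num) ->
  {homo f : s t / (s <= t)%R >-> s <= t} ->
  \sum_(r <oo) \sum_(r' <oo) \int[P]_w (lnlift f (y * Pv (rcons u r) w)%R *
     lnlift f (y * Pv (rcons u r') w)%R) <= \int[P]_w lnlift (A2 P W f) (y * Pv u w)%R.
Proof.
move=> hf ff fm; have hlf := borel_ge0_lift hf.
have hA2 : borel_ge0 (A2 P W f).
  apply: borel_ge0M; first by split; [exact: measurable_cst|move=> ?; rewrite lee_fin].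
  by apply: borel_ge0_potential => //; apply: borel_ge0M => //; exact: borel_ge0_potential.
pose a r r' x := \int[P]_w (lnlift f (x * stick r w)%R * lnlift f (x * stick r' w)%R).
have E r r' : \int[P]_w (lnlift f (y * Pv (rcons u r) w)%R *
     lnlift f (y * Pv (rcons u r') w)%R) = \int[P]_w a r r' (y * Pv u w)%R.
  pose H (z : R * (R * R)) := lnlift f (y * z.1 * z.2.1)%R * lnlift f (y * z.1 * z.2.2)%R.
  have mH : measurable_fun setT H.
    apply: emeasurable_funM; apply: measurableT_comp; try exact: hlf.1.
      apply: measurable_funM; first exact: measurable_funM.
      exact: measurableT_comp.
    apply: measurable_funM; first exact: measurable_funM.
    exact: measurableT_comp.
  have H0 z : 0 <= H z by rewrite mule_ge0 // hlf.2.
  have := branching_integral r r' (Pv_sub_size (leqnn (size u))) mH H0.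
  by rewrite /H /= !Pv_rcons => <-; apply: eq_integral => w _; rewrite !mulrA.
have a0 r r' x : 0 <= a r r' x by apply: integral_ge0 => *; rewrite mule_ge0 ?hlf.2.
have ma r r' : measurable_fun setT (a r r').
  pose K (z : R * T) := lnlift f (z.1 * stick r z.2)%R * lnlift f (z.1 * stick r' z.2)%R.
  have mK : measurable_fun setT K.
    apply: emeasurable_funM; apply: measurableT_comp; try exact: hlf.1.
      by apply: measurable_funM => //; apply: measurableT_comp => //; exact: measurable_stick.
    by apply: measurable_funM => //; apply: measurableT_comp => //; exact: measurable_stick.
  have := @measurable_fun_fubini_tonelli_F _ _ _ _ _ P K mK.
  by apply => z; rewrite mule_ge0 // hlf.2.
have may r r' : measurable_fun setT (fun w => a r r' (y * Pv u w)%R).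
  apply: measurableT_comp => //; apply: measurable_funM => //; exact: measurable_Pv.
under eq_eseriesr => r _.
  under eq_eseriesr do rewrite E.
  rewrite -integral_nneseries //.
  over.
rewrite -integral_nneseries //; last 2 first.
- by move=> r; apply: ge0_emeasurable_sum => // *; exact: a0.
- by move=> *; apply: nneseries_ge0 => *; exact: a0.
apply: ge0_le_integral => //.
- by move=> *; apply: nneseries_ge0 => *; apply: nneseries_ge0 => *; exact: a0.
- apply: ge0_emeasurable_sum => *; first by apply: nneseries_ge0 => *; exact: a0.
  by apply: ge0_emeasurable_sum => // *; exact: a0.
- exact: lnlift_Pv_measurable.
- by move=> w _; exact: stick_pair_series.
Qed.

(** The children of [u] are summed first, with [Pv (rcons u' r')] treated as known; this is
    legitimate because [u], of the same length as [u'] and distinct from it, is no proper prefix of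
    [rcons u' r']. The children of [u'] follow. *)
Lemma cousins_series u u' f y : size u = size u' -> u != u' -> borel_ge0 f ->
  \sum_(r <oo) \sum_(r' <oo) \int[P]_w (lnlift f (y * Pv (rcons u r) w)%R *
     lnlift f (y * Pv (rcons u' r') w)%R) =
  \int[P]_w (lnlift (splitE P W f) (y * Pv u w)%R * lnlift (splitE P W f) (y * Pv u' w)%R).
Proof.
move=> su uu hf; have hlf := borel_ge0_lift hf; have hA := borel_ge0_splitE hf.
have hlA := borel_ge0_lift hA.
rewrite nneseries_interchange; last first.
  by move=> r r'; apply: integral_ge0 => *; rewrite mule_ge0 ?hlf.2.
have E r' : \sum_(r <oo) \int[P]_w (lnlift f (y * Pv (rcons u r) w)%R *
     lnlift f (y * Pv (rcons u' r') w)%R) =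
   \int[P]_w (lnlift (splitE P W f) (y * Pv u w)%R * lnlift f (y * Pv u' w * Pw u' r' w)%R).
  have mY : measurable_fun setT ((fun w => (Pv u w, Pv (rcons u' r') w)) :
      sub u -> (R * R)%type).
    apply: measurable_fun_pair; first exact: Pv_sub_size.
    apply: Pv_sub => k; rewrite size_rcons ltnS leq_eqVlt => /orP[/eqP->|ku].
      by rewrite -cats1 take_size_cat // eq_sym.
    apply/eqP => e; have := ku; rewrite -su -e size_takel ?ltnn //.
    by rewrite size_rcons ltnW // ltnS ltnW.
  have := branching_series (G := fun z => lnlift f (y * z.2)%R) (h := fun z => y * z.1)%R f mY
    _ _ _ hf.
  move=> H; transitivity (\int[P]_w (lnlift f (y * Pv (rcons u' r') w)%R *
       lnlift (splitE P W f) (y * Pv u w)%R)); last first.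
    by apply: eq_integral => w _; rewrite muleC Pv_rcons mulrA.
  rewrite -H.
  - apply: eq_eseriesr => r _; apply: eq_integral => w _.
    by rewrite muleC (Pv_rcons u) mulrA.
  - by apply: measurableT_comp; [exact: hlf.1|exact: measurable_funM].
  - by move=> z; exact: hlf.2.
  - exact: measurable_funM.
under eq_eseriesr do rewrite E.
have mY : measurable_fun setT ((fun w => (Pv u w, Pv u' w)) : sub u' -> (R * R)%type).
  by apply: measurable_fun_pair; apply: Pv_sub_size; rewrite // su.
have := branching_series (G := fun z => lnlift (splitE P W f) (y * z.1)%R)
    (h := fun z => y * z.2)%R f mY _ _ _ hf.
apply.
- by apply: measurableT_comp; [exact: hlA.1|exact: measurable_funM].
- by move=> z; exact: hlA.2.
- exact: measurable_funM.
Qed.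

Lemma le_pair_sum j f g y : borel_ge0 f -> borel_ge0 g -> (forall t, f t <= g t) ->
  pair_sum j f y <= pair_sum j g y.
Proof.
move=> hf hg fg; have lfg x : lnlift f x <= lnlift g x by rewrite /lnlift; case: ifP.
have I0 h v v' : borel_ge0 h -> 0 <= if v != v' then
    \int[P]_w (lnlift h (y * Pv v w)%R * lnlift h (y * Pv v' w)%R) else 0.
  move=> hh; case: ifP => // _; apply: integral_ge0 => *.
  by rewrite mule_ge0 ?(borel_ge0_lift hh).2.
apply: le_wsum => [v|v _]; first by apply: wsum_ge0 => v'; exact: I0.
apply: le_wsum => [v'|v' _]; first exact: I0.
case: ifP => // _; apply: ge0_le_integral => //.
- by move=> *; rewrite mule_ge0 ?(borel_ge0_lift hf).2.
- by apply: emeasurable_funM; exact: lnlift_Pv_measurable.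
- by apply: emeasurable_funM; exact: lnlift_Pv_measurable.
- by move=> *; apply: lee_pmul => //; exact: (borel_ge0_lift hf).2.
Qed.

Lemma borel_ge0_A2 f : borel_ge0 f -> borel_ge0 (A2 P W f).
Proof.
move=> hf; apply: borel_ge0M; first by split; [exact: measurable_cst|move=> ?; rewrite lee_fin].
by apply: borel_ge0_potential => //; apply: borel_ge0M => //; exact: borel_ge0_potential.
Qed.

(** Pairs are split by their parents. Distinct parents give the cousins' term, with [f] replaced by
    its image under [splitE]; a common parent in generation [j] gives the siblings' term, enlarged
    by the diagonal. *)
Lemma pair_sum_step j f y : borel_ge0 f -> (forall t, f t \is a fin_num) ->
  {homo f : s t / (s <= t)%R >-> s <= t} ->
  pair_sum j.+1 f y <=
    pair_sum j (splitE P W f) y + lnlift (iter j (splitE P W) (A2 P W f)) y.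
Proof.
move=> hf ff fm; have hlf := borel_ge0_lift hf; have hA := borel_ge0_splitE hf.
have hA2 := borel_ge0_A2 hf.
pose I v v' := \int[P]_w (lnlift f (y * Pv v w)%R * lnlift f (y * Pv v' w)%R).
pose J v v' := \int[P]_w (lnlift (splitE P W f) (y * Pv v w)%R *
   lnlift (splitE P W f) (y * Pv v' w)%R).
pose S v := \int[P]_w lnlift (A2 P W f) (y * Pv v w)%R.
have I0 v v' : 0 <= I v v' by apply: integral_ge0 => *; rewrite mule_ge0 ?hlf.2.
have J0 v v' : 0 <= J v v'.
  by apply: integral_ge0 => *; rewrite mule_ge0 ?(borel_ge0_lift hA).2.
have S0 v : 0 <= S v by apply: integral_ge0 => *; exact: (borel_ge0_lift hA2).2.
pose K v v' := if v != v' then I v v' else 0.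
have K0 v v' : 0 <= K v v' by rewrite /K; case: ifP.
have KI v v' : K v v' <= I v v' by rewrite /K; case: ifP.
rewrite -(first_moment _ _ hA2) /pair_sum [X in X <= _]/=.
rewrite (eq_wsum (G := fun u => wsum j (fun u' =>
    \sum_(r <oo) \sum_(r' <oo) K (rcons u r) (rcons u' r')))); last first.
  by move=> u _; rewrite wsum_series // => r u'; apply: nneseries_ge0 => *; exact: K0.
apply: (@le_trans _ _ (wsum j (fun u => wsum j (fun u' =>
    (if u != u' then J u u' else 0) + (if u' == u then S u else 0))))).
  apply: le_wsum => [u|u su].
    by apply: wsum_ge0 => u'; do 2 apply: nneseries_ge0 => *; exact: K0.
  apply: le_wsum => [u'|u' su'].
    by do 2 apply: nneseries_ge0 => *; exact: K0.
  rewrite [u' == u]eq_sym; have [uu|uu] := eqVneq u u'; rewrite /= ?add0e ?adde0.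
    subst u'; apply: le_trans (siblings_series u y hf ff fm).
    apply: lee_nneseries => [r _ _|r _]; first by apply: nneseries_ge0 => *; exact: K0.
    by apply: lee_nneseries => *; [exact: K0|exact: KI].
  rewrite /J -cousins_series ?su //.
  apply: lee_nneseries => [r _ _|r _]; first by apply: nneseries_ge0 => *; exact: K0.
  by apply: lee_nneseries => *; [exact: K0|exact: KI].
rewrite -wsumD; [|by move=> u; apply: wsum_ge0 => u'; case: ifP => // _; exact: J0|by move=> v; exact: S0].
rewrite le_eqVlt; apply/orP; left; apply/eqP; apply: eq_wsum => u su.
rewrite wsumD; [|by move=> u'; case: ifP|by move=> u'; case: ifP].
by rewrite (wsum_pred1 _ (F := fun=> S u)) // su eqxx.
Qed.

(** The [N_j] of the overview for [y = n]: [lnlift] of [tpow 0 0] is the indicator of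
    [1 <= y * Pv v w]. The value is an extended real, as finiteness is not known in advance. *)
Definition nbig j y w := wsum j (fun v => lnlift (EFin \o tpow 0 0) (y * Pv v w)%R).

Let h0 : borel_ge0 (EFin \o tpow 0 0 : R -> \bar R).
Proof. exact: borel_ge0_tpow. Qed.

Lemma measurable_nbig j y : measurable_fun setT (nbig j y).
Proof.
apply: (measurable_wsum j (F := fun v w => lnlift (EFin \o tpow 0 0) (y * Pv v w)%R)) => [v|v w].
  exact: lnlift_Pv_measurable.
exact: (borel_ge0_lift h0).2.
Qed.

Lemma nbig_ge0 j y w : 0 <= nbig j y w.
Proof.
by apply: wsum_ge0 => v; exact: (borel_ge0_lift h0).2.
Qed.

Lemma nbig_mean j y :
  \int[P]_w nbig j y w = lnlift (iter j (splitE P W) (EFin \o tpow 0 0)) y.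
Proof.
rewrite -first_moment //.
apply: (wsum_integral P j (F := fun v w => lnlift (EFin \o tpow 0 0) (y * Pv v w)%R)) => [v|v w].
  exact: lnlift_Pv_measurable.
exact: (borel_ge0_lift h0).2.
Qed.

Lemma nbig_sqr_mean j y :
  \int[P]_w (nbig j y w * nbig j y w) <=
  lnlift (iter j (splitE P W) (EFin \o tpow 0 0)) y + pair_sum j (EFin \o tpow 0 0) y.
Proof.
pose e v w := lnlift (EFin \o tpow 0 0) (y * Pv v w)%R.
have e0 v w : 0 <= e v w by exact: (borel_ge0_lift h0).2.
have me v : measurable_fun setT (e v) by exact: lnlift_Pv_measurable.
have mee v v' : measurable_fun setT (fun w => e v w * e v' w) by exact: emeasurable_funM.
have ee0 v v' w : 0 <= e v w * e v' w by rewrite mule_ge0.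
have E w : nbig j y w * nbig j y w = wsum j (fun v => wsum j (fun v' => e v w * e v' w)).
  rewrite {2}/nbig -(wsumZl j (nbig_ge0 j y w)); last by move=> v; exact: e0.
  apply: eq_wsum => v _; rewrite muleC -wsumZl //; [exact: e0|].
  by move=> v'; exact: e0.
have -> : \int[P]_w (nbig j y w * nbig j y w) =
   \int[P]_w wsum j (fun v => wsum j (fun v' => e v w * e v' w)).
  by apply: eq_integral => w _; exact: E.
rewrite (wsum_integral P j (F := fun v w => wsum j (fun v' => e v w * e v' w))).
- rewrite -(first_moment _ _ h0) -wsumD.
  + apply: le_wsum => [v|v sv]; first by apply: integral_ge0 => *; apply: wsum_ge0.
    rewrite (wsum_integral P j (F := fun v' w => e v w * e v' w)) //.
    apply: (@le_trans _ _ (wsum j (fun v' => (if v' == v then \int[P]_w (e v w * e v' w) else 0) +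
      (if v != v' then \int[P]_w (e v w * e v' w) else 0)))).
      apply: le_wsum => [v'|v' _]; first exact: integral_ge0.
      by rewrite eq_sym; case: eqP => _ /=; rewrite ?adde0 ?add0e.
    rewrite wsumD; [|by move=> v'; case: ifP => // _; exact: integral_ge0..].
    rewrite (wsum_pred1 _ (F := fun v' => \int[P]_w (e v w * e v' w))); last exact: integral_ge0.
    rewrite sv eqxx leeD2r // le_eqVlt; apply/orP; left; apply/eqP.
    apply: eq_integral => w _; rewrite /e liftM; congr lnlift; apply/funext => t /=.
    by rewrite -EFinM /tpow; case: ifP; rewrite ?expr0 ?mulr1 ?mulr0.
  + by move=> v; apply: integral_ge0 => *; exact: e0.
  + move=> v; apply: wsum_ge0 => v'; case: ifP => // _; apply: integral_ge0 => *; exact: ee0.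
- by move=> v; apply: (measurable_wsum j (F := fun v' w => e v w * e v' w)).
- by move=> v w; apply: wsum_ge0.
Qed.

End Tree.

(** * Conditional densities *)

Section ConditionalDensity.
Context {d : measure_display} {T : measurableType d} {R : realType}.
Variable P : probability T R.
Variable G : set (set T).
Hypothesis Gm : <<s G >> `<=` measurable.
Local Open Scope ereal_scope.

(* D is the conditional probability of E given <<s G >>; the layer cake formula
   for h avoids an approximation by simple functions. *)
Lemma density_integral (E : set T) (D h : T -> R) :
  measurable E -> (forall w, 0 <= D w)%R -> (forall w, 0 <= h w)%R ->
  measurable_fun setT D -> measurable_fun setT (h : g_sigma_algebraType G -> R) ->
  (forall A, <<s G >> A -> P (A `&` E) = \int[P]_(w in A) (D w)%:E) ->
  \int[P]_(w in E) (h w)%:E = \int[P]_w (D w * h w)%:E.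
Proof.
move=> mE D0 h0 mD mh H.
have mh' : measurable_fun setT h.
  by move=> _ B mB; apply: Gm; exact: mh.
pose L (s : R) := [set w | 0 <= s <= h w]%R.
have GL s : <<s G >> (L s).
  have -> : L s = if (0 <= s)%R then h @^-1` `[s, +oo[%classic else set0.
    apply/funext => w; apply/propext; rewrite /L /=.
    case: (leP 0%R s) => s0 /=; last by split.
    by rewrite in_itv /= andbT.
  case: ifP => _; last exact: (@measurable0 _ (g_sigma_algebraType G)).
  by have := mh measurableT `[s, +oo[%classic (measurable_itv _); rewrite setTI.
have layer w : \int[lebesgue_measure]_s (\1_(L s) w)%:E = (h w)%:E.
  transitivity (\int[lebesgue_measure]_s (\1_(`[0%R, h w]%classic) s : R)%:E).
    apply: eq_integral => s _; rewrite !indicE.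
    suff -> : (w \in L s) = (s \in `[0%R, h w]%classic) by [].
    by apply/idP/idP; rewrite !inE /L /= ?in_itv.
  rewrite integral_indic /= ?setIT; [|by []|exact: measurable_itv].
  rewrite lebesgue_measure_itv /= lte_fin; case: ltP => [_|hw].
    by rewrite -EFinB subr0.
  by congr EFin; apply/le_anti; rewrite h0 hw.
have mK : measurable_fun setT (fun z : T * R => \1_(L z.2) z.1 : R)%R.
  have -> : (fun z : T * R => \1_(L z.2) z.1 : R)%R =
     (fun z => if (0 <= z.2)%R && (z.2 <= h z.1)%R then 1%R else 0%R).
    apply/funext => z; rewrite indicE /L; case: ifPn => hz.
      by rewrite mem_set.
    by rewrite memNset //; exact/negP.
  apply: measurable_fun_ifT => //; apply: measurable_and; apply: measurable_fun_ler => //.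
  exact: measurableT_comp.
pose K1 (z : T * R) : \bar R := (\1_E z.1 * \1_(L z.2) z.1)%:E.
pose K2 (z : T * R) : \bar R := (D z.1 * \1_(L z.2) z.1)%:E.
have mK1 : measurable_fun setT K1.
  apply/measurable_EFinP; apply: measurable_funM => //.
  by apply: measurableT_comp => //; exact: measurable_indic.
have mK2 : measurable_fun setT K2.
  by apply/measurable_EFinP; apply: measurable_funM => //; exact: measurableT_comp.
have K10 z : 0 <= K1 z by rewrite lee_fin mulr_ge0 // indicE.
have K20 z : 0 <= K2 z by rewrite lee_fin mulr_ge0 // indicE.
have mLw w : measurable_fun setT (fun s => (\1_(L s) w : R)%:E).
  have m2 : measurable_fun setT (fun s : R => (w, s)) by exact: measurable_fun_pair.
  by apply/measurable_EFinP; exact: (measurableT_comp mK m2).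
have L0 w s : 0 <= (\1_(L s) w : R)%:E by rewrite lee_fin indicE.
have scaled (k : R) w : (0 <= k)%R ->
    \int[lebesgue_measure]_s (k * \1_(L s) w)%:E = (k * h w)%:E.
  by move=> k0; rewrite EFinM -layer -ge0_integralZl_EFin //; exact: mLw.
transitivity (\int[P]_w \int[lebesgue_measure]_s K1 (w, s)).
  rewrite integral_mkcond; apply: eq_integral => w _ /=.
  rewrite /K1 /= scaled ?indicE // patchE; case: ifP => _; rewrite ?mul1r ?mul0r //.
transitivity (\int[P]_w \int[lebesgue_measure]_s K2 (w, s)); last first.
  by apply: eq_integral => w _; rewrite /K2 /= scaled.
rewrite (@fubini_tonelli _ _ _ _ _ P lebesgue_measure K1 mK1 K10).
rewrite (@fubini_tonelli _ _ _ _ _ P lebesgue_measure K2 mK2 K20).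
apply: eq_integral => s _.
transitivity (P (L s `&` E)).
  rewrite -(setIT (L s `&` E)) -integral_indic //; last first.
    by apply: measurableI => //; exact: Gm.
  by apply: eq_integral => w _; rewrite /K1 /= setIC indicI.
rewrite (H _ (GL s)) integral_mkcond; apply: eq_integral => w _.
rewrite /K2 /= patchE indicE; case: ifP => _; rewrite ?mulr1 ?mulr0 //.
Qed.

End ConditionalDensity.

(** * Empty and occupied boxes *)

Lemma measurable_prod_seq {d} {T : measurableType d} {R : realType} (I : Type)
  (s : seq I) (f : I -> T -> R) : (forall i, measurable_fun setT (f i)) ->
  measurable_fun setT (fun w => \prod_(i <- s) f i w).
Proof.
move=> mf; elim: s => [|i s IH].
  have -> : (fun w => \prod_(i <- [::]) f i w) = cst 1 by apply/funext => w; rewrite big_nil.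
  exact: measurable_cst.
have -> : (fun w => \prod_(k <- i :: s) f k w) = (fun w => f i w * \prod_(k <- s) f k w).
  by apply/funext => w; rewrite big_cons.
exact: measurable_funM.
Qed.

Lemma sume_ord_const {R : realType} n (x : \bar R) : (0 <= x)%E ->
  (\sum_(i < n) x = n%:R%:E * x)%E.
Proof.
move=> x0; elim: n => [|n IH]; first by rewrite big_ord0 mul0e.
by rewrite big_ord_recr /= IH -natr1 EFinD ge0_muleDl ?mul1e // lee_fin.
Qed.

Section Balls.
Context {d : measure_display} {T : measurableType d} {R : realType}.
Variable P : probability T R.
Variable W : {RV P >-> R}.
Variable X : nat -> {RV P >-> R}.
Variable Pw : word -> nat -> {RV P >-> R}.
Variable C : nat -> nat -> {RV P >-> nat}.
Hypothesis W01 : forall w, 0 < W w < 1.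
Hypothesis X_iid : iid_copies W X.
Local Notation stick := (stick_breaking (fun r => X r)).
Hypothesis nested : nested_occupancy stick Pw C.

Let G : set (set T) :=
  \bigcup_(u in [set: word * nat]) preimage_set_system setT (Pw u.1 u.2 : T -> R) measurable.

Let Gm : <<s G >> `<=` measurable.
Proof.
apply: smallest_sub; first exact: sigma_algebra_measurable.
by move=> A [u _ [B mB <-]]; exact: measurable_funP.
Qed.

Lemma Pw_weights u r : measurable_fun setT (Pw u r : g_sigma_algebraType G -> R).
Proof.
by move=> _ B mB; apply: sub_sigma_algebra; exists (u, r) => //; exists B.
Qed.

Local Notation Pv := (Pv Pw).

Lemma Pv_weights v : measurable_fun setT (Pv v : g_sigma_algebraType G -> R).
Proof.
elim/last_ind: v => [|v r IH]; first by rewrite Pv_nil; exact: measurable_cst.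
by rewrite Pv_rcons; apply: measurable_funM => //; exact: Pw_weights.
Qed.

Lemma measurable_Pv' v : measurable_fun setT (Pv v).
Proof. exact: measurable_fun_sub Gm (Pv_weights v). Qed.

Lemma stick_sum N w : \sum_(r < N) stick r w = 1 - sticks X N w.
Proof.
elim: N => [|N IH]; first by rewrite big_ord0 sticks0 /= subrr.
by rewrite big_ord_recr /= IH sticksS /stick_breaking /sticks; ring.
Qed.

(** Countably many conditions on finitely many coordinates each, hence an event of the product
    sigma-algebra, which [same_law] transfers from the stick-breaking weights to every [Pw u]. *)
Definition proper_weights (x : nat -> R) :=
  (forall r, 0 <= x r) /\ (forall N, \sum_(r < N) x r <= 1).

Lemma proper_weights_measurable :
  sigma_family (fun r (x : nat -> R) => x r) proper_weights.
Proof.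
pose G0 : set (set (nat -> R)) := \bigcup_r preimage_set_system setT (fun x : nat -> R => x r) measurable.
have mx r : measurable_fun setT ((fun x => x r) : g_sigma_algebraType G0 -> R).
  by move=> _ B mB; apply: sub_sigma_algebra; exists r => //; exists B.
have -> : proper_weights = (\bigcap_r ((fun x : nat -> R => x r) @^-1` `[0, +oo[%classic)) `&`
    (\bigcap_N ((fun x : nat -> R => \sum_(r < N) x r) @^-1` `]-oo, 1]%classic)).
  apply/seteqP; split => x [h1 h2]; split.
  - by move=> r _ /=; rewrite in_itv /= andbT.
  - by move=> N _; have := h2 N; rewrite /= in_itv.
  - by move=> r; have := h1 r I; rewrite /= in_itv /= andbT.
  - by move=> N; have := h2 N I; rewrite /= in_itv.
suff : @measurable _ (g_sigma_algebraType G0) ((\bigcap_r ((fun x : nat -> R => x r) @^-1` `[0, +oo[%classic)) `&`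
    (\bigcap_N ((fun x : nat -> R => \sum_(r < N) x r) @^-1` `]-oo, 1]%classic))) by [].
apply: measurableI; apply: bigcapT_measurable => k.
  by have := mx k measurableT _ (measurable_itv `[0, +oo[); rewrite setTI.
have mS : measurable_fun setT ((fun x => \sum_(r < k) x r) : g_sigma_algebraType G0 -> R).
  exact: measurable_sum.
by have := mS measurableT _ (measurable_itv `]-oo, 1]); rewrite setTI.
Qed.

Lemma measurable_proper (Z : nat -> T -> R) : (forall r, measurable_fun setT (Z r)) ->
  measurable [set w | proper_weights (Z ^~ w)].
Proof.
move=> mZ; have -> : [set w | proper_weights (Z ^~ w)] =
  (\bigcap_r (Z r @^-1` `[0, +oo[%classic)) `&`
  (\bigcap_N ((fun w => \sum_(r < N) Z r w) @^-1` `]-oo, 1]%classic)).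
  apply/seteqP; split => x [h1 h2]; split.
  - by move=> r _ /=; rewrite in_itv /= andbT.
  - by move=> N _; have := h2 N; rewrite /= in_itv.
  - by move=> r; have := h1 r I; rewrite /= in_itv /= andbT.
  - by move=> N; have := h2 N I; rewrite /= in_itv.
apply: measurableI; apply: bigcapT_measurable => k.
  by have := mZ k measurableT _ (measurable_itv `[0, +oo[); rewrite setTI.
have mS : measurable_fun setT (fun w => \sum_(r < k) Z r w) by exact: measurable_sum.
by have := mS measurableT _ (measurable_itv `]-oo, 1]); rewrite setTI.
Qed.

Lemma stick_proper : {ae P, forall w, proper_weights (stick ^~ w)}.
Proof.
have H : {ae P, forall w, forall n l, (l < n)%N -> 0 < X l w < 1}.
  pose N n := [set w | ~ (forall l, (l < n)%N -> 0 < X l w < 1)].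
  have : P.-negligible (\bigcup_n N n).
    by apply: negligible_bigcup => n; have := X_ae W01 X_iid n.
  by apply: negligibleS => w /existsNP[n hn]; exists n.
apply: filterS H => w h.
have s0 n : 0 <= sticks X n w.
  by apply: prodr_ge0 => l _; rewrite ltW //; case/andP: (h n l (ltn_ord l)).
split => [r|n]; last by rewrite stick_sum gerBl.
rewrite /stick_breaking mulr_ge0 //; first exact: s0.
by case/andP: (h r.+1 r (ltnSn r)); lra.
Qed.

(** There are countably many words, so the exceptional null sets can be united; [pickle] enumerates
    them. *)
Lemma weights_ae : {ae P, forall w, forall u, proper_weights (Pw u ^~ w)}.
Proof.
have one u : P.-negligible [set w | ~ proper_weights (Pw u ^~ w)].
  have mPw : measurable [set w | proper_weights (Pw u ^~ w)].
    by apply: measurable_proper => r.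
  have mst : measurable [set w | proper_weights (stick ^~ w)].
    by apply: measurable_proper => r; exact: measurable_stick.
  exists (~` [set w | proper_weights (Pw u ^~ w)]); split => //.
    exact: measurableC.
  have := weights_copies nested u (sigma_algebraCD proper_weights_measurable).
  rewrite !setTD => H; transitivity (P (~` [set w | proper_weights (stick ^~ w)])).
    exact: H.
  apply: measure_negligible; first exact: measurableC.
  exact: stick_proper.
pose N n := if (choice.unpickle n : option word) is Some u then
  [set w | ~ proper_weights (Pw u ^~ w)] else set0.
have : P.-negligible (\bigcup_n N n).
  apply: negligible_bigcup => n; rewrite /N; case: choice.unpickle => // *.
  exact: negligible_set0.
apply: negligibleS => w /existsNP[u hu]; exists (choice.pickle u) => //.
by rewrite /N choice.pickleK.
Qed.

Lemma Pv_ge0 v w : (forall u, proper_weights (Pw u ^~ w)) -> 0 <= Pv v w.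
Proof. by move=> h; apply: prodr_ge0 => k _; case: (h (take k v)). Qed.

Lemma series_le1 (x : nat -> R) : proper_weights x -> (\sum_(r <oo) (x r)%:E <= 1)%E.
Proof.
move=> [x0 x1]; apply: lime_le.
  by apply: is_cvg_nneseries => r _ _; rewrite lee_fin.
apply: nearW => N; rewrite sumEFin lee_fin big_mkord; exact: x1.
Qed.

Lemma Pv_wsum_le1 j w : (forall u, proper_weights (Pw u ^~ w)) ->
  (wsum j (fun v => (`|Pv v w|)%:E) <= 1)%E.
Proof.
move=> h; elim: j => [|j IH] /=; first by rewrite Pv_nil /= normr1.
apply: le_trans IH; apply: le_wsum => [v|v _].
  by apply: nneseries_ge0 => r _ _; rewrite lee_fin.
under eq_eseriesr do rewrite Pv_rcons normrM EFinM.
rewrite ge0_nneseriesZl ?lee_fin //.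
rewrite -[leRHS]mule1; apply: lee_wpmul2l; first by rewrite lee_fin.
rewrite (eq_eseriesr (g := fun r => (Pw v r w)%:E)); first exact: series_le1.
by move=> r _; rewrite ger0_norm //; case: (h v).
Qed.

(** * Joint law of the boxes given the weights *)

Lemma box0 i w : box (fun i k => C i k) i 0 w = [::].
Proof. by []. Qed.

Lemma boxS i k w : box (fun i k => C i k) i k.+1 w = rcons (box (fun i k => C i k) i k w) (C i k w).
Proof. by rewrite /box mkseqS. Qed.

Lemma size_box i k w : size (box (fun i k => C i k) i k w) = k.
Proof. by rewrite /box size_mkseq. Qed.

Local Notation bx := (box (fun i k => C i k)).

Lemma measurable_letter i k r : measurable [set w | C i k w = r].
Proof.
by rewrite -[X in measurable X]setTI; exact: (measurable_funP (C i k) measurableT [set r]).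
Qed.

Lemma measurable_box i k v : measurable [set w | bx i k w = v].
Proof.
elim: k v => [|k IH] v.
  have [->|v0] := eqVneq v [::].
    by have -> : [set w | bx i 0 w = [::]] = setT by apply/seteqP; split.
  have -> : [set w | bx i 0 w = v] = set0 => //.
  by apply/seteqP; split => // w /=; rewrite box0 => e; rewrite -e in v0.
case/lastP: v => [|v r].
  have -> : [set w | bx i k.+1 w = [::]] = set0 => //.
  by apply/seteqP; split => // w /=; rewrite boxS; case: (bx i k w).
have -> : [set w | bx i k.+1 w = rcons v r] =
    [set w | bx i k w = v] `&` [set w | C i k w = r].
  apply/seteqP; split => w /=; rewrite boxS.
    by move/rcons_inj => -[-> ->].
  by move=> [-> ->].
by apply: measurableI => //; exact: measurable_letter.
Qed.

Lemma measurable_at_boxes n k (v : 'I_n -> word) : measurable (at_boxes (fun i k => C i k) k v).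
Proof.
have -> : at_boxes (fun i k => C i k) k v = \bigcap_(i in [set: 'I_n]) [set w | bx i k w = v i].
  by apply/seteqP; split => w h i; [move=> _|]; exact: h.
by apply: fin_bigcap_measurable => // i _; exact: measurable_box.
Qed.

Local Open Scope ereal_scope.

Lemma at_boxes_weights n j (v : 'I_n -> word) (A : set T) :
  (forall i, size (v i) = j) -> <<s G >> A ->
  P (A `&` at_boxes (fun i k => C i k) j v) =
  \int[P]_(w in A) (\prod_(i < n) `|Pv (v i) w|)%:E.
Proof.
elim: j v A => [|j IH] v A sv GA; have mA := Gm GA.
  have vn i : v i = [::] by apply: size0nil.
  have -> : at_boxes (fun i k => C i k) 0 v = setT.
    by apply/seteqP; split => // w _ i; rewrite vn.
  rewrite setIT (eq_integral (cst 1)).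
    by rewrite integral_cst // mul1e.
  by move=> w _; rewrite big1 // => i _; rewrite vn Pv_nil /= normr1.
pose u i := take j (v i); pose r i := nth 0%N (v i) j.
have vE i : v i = rcons (u i) (r i).
  by rewrite /u /r -take_nth ?sv // -(sv i) take_size.
have su i : size (u i) = j by rewrite size_takel // sv.
have -> : A `&` at_boxes (fun i k => C i k) j.+1 v =
   A `&` at_boxes (fun i k => C i k) j u `&` [set w | forall i : 'I_n, C i j w = r i].
  apply/seteqP; split => w /=.
    move=> [Aw h]; split; [split => // i|move=> i]; have := h i; rewrite boxS vE.
      by move/rcons_inj => -[].
    by move/rcons_inj => -[].
  by move=> [[Aw h1] h2]; split => // i; rewrite boxS vE h1 h2.
rewrite (balls_transition nested) //.
pose D w := (\prod_(i < n) `|Pv (u i) w|)%R.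
pose h w := (\1_A w * \prod_(i < n) `|Pw (u i) (r i) w|)%R.
set E := at_boxes (fun i k => C i k) j u.
have mE : measurable E by exact: measurable_at_boxes.
have mD : measurable_fun setT D.
  by apply: measurable_prod_seq => i; apply: measurableT_comp => //; exact: measurable_Pv'.
have mh : measurable_fun setT (h : g_sigma_algebraType G -> R).
  apply: measurable_funM.
    exact: (@measurable_indic _ (g_sigma_algebraType G)).
  apply: measurable_prod_seq => i; apply: measurableT_comp => //; exact: Pw_weights.
have D0 w : (0 <= D w)%R by apply: prodr_ge0.
have h0 w : (0 <= h w)%R by rewrite /h mulr_ge0 // ?indicE //; apply: prodr_ge0.
have mPw : measurable_fun setT (fun w => \prod_(i < n) Pw (u i) (r i) w)%R.
  exact: measurable_prod_seq.
transitivity (\int[P]_(w in E) (h w)%:E).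
  transitivity (\int[P]_(w in A `&` E) (\prod_(i < n) `|Pw (u i) (r i) w|)%:E).
    apply: ae_eq_integral.
    - exact: measurableI.
    - by apply/measurable_EFinP; apply: measurable_funTS.
    - apply/measurable_EFinP; apply: measurable_funTS.
      by apply: measurable_prod_seq => i; exact: measurableT_comp.
    - apply: filterS weights_ae => w hw _; congr EFin; apply: eq_bigr => i _.
      by rewrite ger0_norm //; case: (hw (u i)).
  rewrite setIC integral_mkcondr; apply: eq_integral => w _.
  by rewrite patchE /h indicE; case: ifP => _; rewrite ?mul1r ?mul0r.
rewrite (density_integral Gm mE D0 h0 mD mh); last by move=> B GB; exact: IH.
rewrite [RHS]integral_mkcond; apply: eq_integral => w _.
rewrite patchE /h /D indicE; case: ifP => _; rewrite ?mul1r ?mul0r ?mulr0 //.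
rewrite -big_split /=; congr EFin; apply: eq_bigr => i _.
by rewrite vE Pv_rcons normrM.
Qed.

Lemma balls_event_le n j (S : nat -> pred word) (c : nat -> T -> R) (A : set T) :
  <<s G >> A -> (forall i, measurable_fun setT (c i)) -> (forall i w, 0 <= c i w)%R ->
  (forall i, {ae P, forall w,
     wsum j (fun x => if S i x then (`|Pv x w|)%:E else 0) <= (c i w)%:E}) ->
  P (A `&` [set w | forall i, (i < n)%N -> S i (bx i j w)]) <=
  \int[P]_(w in A) (\prod_(0 <= i < n) c i w)%:E.
Proof.
move=> GA mc c0 sc; have mA := Gm GA.
pose Ev m (v : nat -> word) := [set w | forall i, (i < n)%N ->
  if (i < m)%N then bx i j w = v i else S i (bx i j w)].
have mEv m v : measurable (Ev m v).
  have -> : Ev m v = \bigcap_(i in `I_n)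
     (if (i < m)%N then [set w | bx i j w = v i]
      else \bigcup_x (if S i x then [set w | bx i j w = x] else set0)).
    apply/seteqP; split => w h i ni; have := h i ni; case: ifP => // _.
      by move=> Si; exists (bx i j w) => //; rewrite Si.
    by move=> [x _]; case: ifP => // Six /= ->.
  apply: fin_bigcap_measurable => // i _; case: ifP => _; first exact: measurable_box.
  pose D (o : option word) := if o is Some x then
    (if S i x then [set w | bx i j w = x] else set0) else set0.
  have -> : \bigcup_x (if S i x then [set w | bx i j w = x] else set0) =
    \bigcup_k D (choice.unpickle k).
    apply/seteqP; split => w [x _ h].
      by exists (choice.pickle x) => //; rewrite choice.pickleK.
    by move: h; rewrite /D; case: (choice.unpickle x : option word) => // y h; exists y.
  apply: bigcupT_measurable => k; rewrite /D.
  case: (choice.unpickle k : option word) => // x.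
  by case: ifP => // _; exact: measurable_box.
have mB k l (v : nat -> word) : measurable_fun setT
    (fun w => \prod_(0 <= i < k) `|Pv (v i) w| * \prod_(l <= i < n) c i w)%R.
  apply: measurable_funM; apply: measurable_prod_seq => // i.
  by apply: measurableT_comp => //; exact: measurable_Pv'.
have B0 k l (v : nat -> word) w :
    (0 <= \prod_(0 <= i < k) `|Pv (v i) w| * \prod_(l <= i < n) c i w)%R.
  by apply: mulr_ge0; apply: prodr_ge0.
have main k : (k <= n)%N -> forall v : nat -> word, (forall i, size (v i) = j) ->
    P (A `&` Ev (n - k)%N v) <= \int[P]_(w in A)
      (\prod_(0 <= i < n - k) `|Pv (v i) w| * \prod_(n - k <= i < n) c i w)%:E.
  elim: k => [|k IH] kn v sv.
    rewrite subn0; have -> : Ev n v = at_boxes (fun i k => C i k) j (fun i : 'I_n => v i).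
      apply/seteqP; split => w h i; first by have := h i (ltn_ord i); rewrite ltn_ord.
      by move=> ni; rewrite ni; exact: (h (Ordinal ni)).
    rewrite at_boxes_weights // le_eqVlt; apply/orP; left; apply/eqP.
    apply: eq_integral => w _.
    by rewrite big_mkord [in RHS]big_geq ?mulr1.
  set m := (n - k.+1)%N; have mE : (n - k = m.+1)%N by rewrite /m subnSK.
  have mn : (m < n)%N by rewrite -mE leq_subr.
  pose vx x i := if i == m then x else v i.
  (* Ball [m] is released: its box [x] is summed over the words allowed by [S m], and at most one
     summand is nonzero. *)
  have split1 w : (\1_(A `&` Ev m v) w : R)%:E =
      wsum j (fun x => if S m x then (\1_(A `&` Ev m.+1 (vx x)) w : R)%:E else 0).
    have Evx x : Ev m.+1 (vx x) w <-> bx m j w = x /\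
        (forall i, (i < n)%N -> i != m -> if (i < m)%N then bx i j w = v i else S i (bx i j w)).
      split.
        move=> h; split; first by have := h m mn; rewrite ltnSn /vx eqxx.
        move=> i ni im; have := h i ni.
        by rewrite /vx (negbTE im) ltnS [in (i <= m)%N]leq_eqVlt (negbTE im).
      move=> [h1 h2] i ni; rewrite /vx; have [->|im] := eqVneq i m; first by rewrite ltnSn.
      by have := h2 i ni im; rewrite ltnS [in (i <= m)%N]leq_eqVlt (negbTE im).
    have Em : Ev m v w <-> S m (bx m j w) /\ Ev m.+1 (vx (bx m j w)) w.
      split.
        move=> h; split; first by have := h m mn; rewrite ltnn.
        by apply/Evx; split => // i ni _; exact: h.
      move=> [h /Evx [_ h2]] i ni; have [->|im] := eqVneq i m; first by rewrite ltnn.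
      exact: h2.
    rewrite (eq_wsum (G := fun x => if x == bx m j w then
       (if S m x then (\1_(A `&` Ev m.+1 (vx x)) w : R)%:E else 0) else 0)); last first.
      move=> x _; case: eqP => // xb; case: ifP => // _.
      by rewrite indicE memNset // => -[_ /Evx [/esym]].
    rewrite wsum_pred1; last by case: ifP => // _; rewrite lee_fin indicE.
    rewrite size_box eqxx; case: ifPn => Sb.
      rewrite !indicE; congr (_%:R%:E); congr nat_of_bool; apply/idP/idP; rewrite !inE.
        by move=> [Aw /Em [_ h]].
      by move=> [Aw h]; split => //; apply/Em.
    by rewrite indicE memNset // => -[_ /Em [h]]; rewrite h in Sb.
  have mEvx x : measurable (A `&` Ev m.+1 (vx x)) by exact: measurableI.
  have -> : P (A `&` Ev m v) = wsum j (fun x =>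
      if S m x then P (A `&` Ev m.+1 (vx x)) else 0).
    rewrite -(setIT (A `&` Ev m v)) -integral_indic //; last exact: measurableI.
    under eq_integral do rewrite split1.
    rewrite (wsum_integral P j (F := fun x w => if S m x then
       (\1_(A `&` Ev m.+1 (vx x)) w : R)%:E else 0)).
    - apply: eq_wsum => x _; case: ifP => _; last by rewrite integral0.
      by rewrite integral_indic // setIT.
    - move=> x; case: (S m x); last exact: measurable_cst.
      by apply/measurable_EFinP; exact: measurable_indic.
    - by move=> x w; case: ifP => // _; rewrite lee_fin indicE.
  pose B w := (\prod_(0 <= i < m) `|Pv (v i) w| * \prod_(m.+1 <= i < n) c i w)%R.
  pose H x w := if S m x then (\1_A w * (B w * `|Pv x w|))%:E else 0.
  have H0 x w : 0 <= H x w.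
    by rewrite /H; case: ifP => // _; rewrite lee_fin; apply: mulr_ge0; [rewrite indicE|apply: mulr_ge0 (B0 _ _ _ _) _].
  have mH x : measurable_fun setT (H x).
    rewrite /H; case: (S m x); last exact: measurable_cst.
    apply/measurable_EFinP; apply: measurable_funM; first exact: measurable_indic.
    apply: measurable_funM; first exact: mB.
    by apply: measurableT_comp => //; exact: measurable_Pv'.
  apply: (@le_trans _ _ (wsum j (fun x => \int[P]_w H x w))).
    apply: le_wsum => [x|x sx]; first by case: ifP.
    rewrite /H; case: ifP => Sx; last by rewrite integral0.
    have := IH (ltnW kn) (vx x) _; rewrite mE => /(_ _) E.
    apply: (le_trans (E _)); first by move=> i; rewrite /vx; case: eqP.
    rewrite [leLHS]integral_mkcond le_eqVlt; apply/orP; left; apply/eqP.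
    apply: eq_integral => w _; rewrite patchE indicE; case: ifP => _; last by rewrite mul0r.
    rewrite mul1r big_nat_recr //= /vx eqxx /B mulrAC; congr (_ * _ * _)%:E.
    by apply: eq_big_nat => i /andP[_ im]; rewrite (ltn_eqF im).
  rewrite -(wsum_integral P j mH H0) [leRHS]integral_mkcond.
  apply: ae_ge0_le_integral => //.
  - by move=> w _; exact: wsum_ge0.
  - exact: (measurable_wsum j mH H0).
  - by move=> w _; rewrite patchE; case: ifP => // _; rewrite lee_fin.
  - by apply/(measurable_restrictT _ mA)/measurable_EFinP; exact: measurable_funTS.
  apply: filterS (sc m) => w hw _; rewrite patchE.
  rewrite (eq_wsum (G := fun x => (\1_A w * B w)%:E *
      (if S m x then (`|Pv x w|)%:E else 0))); last first.
    by move=> x _; rewrite /H; case: ifP => _; rewrite ?mule0 // -EFinM mulrA.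
  rewrite wsumZl; first last.
  - by move=> x; case: ifP => // _; rewrite lee_fin.
  - by rewrite lee_fin; apply: mulr_ge0 (B0 _ _ _ _); rewrite indicE.
  rewrite indicE; case: ifP => _; last by rewrite mul0r mul0e.
  rewrite mul1r.
  have -> : (\prod_(0 <= i < m) `|Pv (v i) w| * \prod_(m <= i < n) c i w = B w * c m w)%R.
    by rewrite (big_ltn mn) /B mulrCA mulrC.
  rewrite [in leRHS]EFinM; apply: lee_wpmul2l => //; rewrite lee_fin; exact: B0.
(* With [m = 0] no box is prescribed; the constant word only serves as a placeholder of length
   [j]. *)
have := main n (leqnn n) (fun=> nseq j 0%N); rewrite subnn.
have -> : Ev 0%N (fun=> nseq j 0%N) = [set w | forall i, (i < n)%N -> S i (bx i j w)].
  by apply/seteqP; split.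
move=> /(_ (fun=> size_nseq _ _)); under eq_integral do rewrite big_geq // mul1r.
by [].
Qed.

Lemma wsum_pred1_Pv j v w :
  wsum j (fun x => if x == v then (`|Pv x w|)%:E else 0) <= (`|Pv v w|)%:E.
Proof.
by rewrite (wsum_pred1 _ (F := fun x => (`|Pv x w|)%:E)) //; case: ifP => // _; rewrite lee_fin.
Qed.

Lemma wsum_predC1_Pv j v w : (forall u, proper_weights (Pw u ^~ w)) -> size v = j ->
  wsum j (fun x => if x != v then (`|Pv x w|)%:E else 0) <= (1 - `|Pv v w|)%:E.
Proof.
move=> h sv; rewrite EFinB leeBrDr //; apply: le_trans (Pv_wsum_le1 j h).
rewrite (_ : (`|Pv v w|)%:E = wsum j (fun x => if x == v then (`|Pv x w|)%:E else 0)); last first.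
  by rewrite (wsum_pred1 _ (F := fun x => (`|Pv x w|)%:E)) // sv eqxx.
rewrite -wsumD; last 2 first.
- by move=> x; case: ifP => // _; rewrite lee_fin.
- by move=> x; case: ifP => // _; rewrite lee_fin.
apply: le_wsum => [x|x _]; last by case: eqP => _; rewrite ?adde0 ?add0e.
by apply: adde_ge0; case: ifP => // _; rewrite lee_fin.
Qed.

Lemma Pv_le1 v w : (forall u, proper_weights (Pw u ^~ w)) -> (Pv v w <= 1)%R.
Proof.
move=> h; have := wsum_predC1_Pv h (erefl (size v)).
move=> H; have := le_trans (wsum_ge0 (size v) _) H.
rewrite lee_fin subr_ge0 => H'; apply: le_trans (ler_norm _) (H' _) => x.
by case: ifP => // _; rewrite lee_fin.
Qed.

(** * Light boxes that are hit and heavy boxes that are missed *)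

Definition occ n j v w := has (fun i => bx i j w == v) (iota 0 n).

Lemma occP n j v w : reflect (exists2 i, (i < n)%N & bx i j w = v) (occ n j v w).
Proof.
apply: (iffP hasP) => [[i]|[i ni <-]]; first by rewrite mem_iota => ni /eqP; exists i.
by exists i => //; rewrite mem_iota.
Qed.

Lemma measurable_occ n j v : measurable [set w | occ n j v w].
Proof.
have -> : [set w | occ n j v w] = \bigcup_(i in `I_n) [set w | bx i j w = v].
  by apply/seteqP; split => w /=; [move/occP => [i ni e]; exists i|
    move=> [i ni e]; apply/occP; exists i].
by apply: fin_bigcup_measurable => // i _; exact: measurable_box.
Qed.

Lemma box_probability_le i j v (A : set T) : <<s G >> A ->
  P (A `&` [set w | bx i j w = v]) <= \int[P]_(w in A) (`|Pv v w|)%:E.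
Proof.
move=> GA; have mA := Gm GA.
(* Only the balls up to [i] are considered; those before [i] are unconstrained and contribute a
   factor at most 1. *)
pose S k : pred word := if k == i then pred1 v else predT.
pose c k w : R := (if k == i then `|Pv v w| else 1)%R.
have mc k : measurable_fun setT (c k).
  rewrite /c; case: (k == i); last exact: measurable_cst.
  by apply: measurableT_comp => //; exact: measurable_Pv'.
have c0 k w : (0 <= c k w)%R by rewrite /c; case: (k == i).
have sc k : {ae P, forall w,
     wsum j (fun x => if S k x then (`|Pv x w|)%:E else 0) <= (c k w)%:E}.
  rewrite /S /c; case: (k == i).
    by apply: aeW => w; exact: wsum_pred1_Pv.
  by apply: filterS weights_ae => w h; exact: Pv_wsum_le1.
have := balls_event_le i.+1 GA mc c0 sc.
under eq_integral => w _.
  rewrite big_nat_recr //= big_nat big1; last by move=> k /= ki; rewrite /c ltn_eqF.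
  rewrite mul1r {1}/c eqxx.
  over.
apply: le_trans; apply: le_measure; rewrite ?inE.
- by apply: measurableI => //; exact: measurable_box.
- apply: measurableI => //.
  have -> : [set w | forall i0, (i0 < i.+1)%N -> S i0 (bx i0 j w)] = [set w | bx i j w = v].
    apply/seteqP; split => w /=; first by move/(_ i (ltnSn i)); rewrite /S eqxx => /eqP.
    by move=> bv k _; rewrite /S; case: eqP => [->|//]; apply/eqP.
  exact: measurable_box.
- apply: setIS => w /= bv k _; rewrite /S; case: eqP => [->|//]; exact/eqP.
Qed.

Lemma avoid_probability_le n j v (A : set T) : size v = j -> <<s G >> A ->
  P (A `&` [set w | ~~ occ n j v w]) <= \int[P]_(w in A) (`|1 - Pv v w| ^+ n)%:E.
Proof.
move=> sv GA.
pose c (k : nat) w : R := `|1 - Pv v w|%R.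
have mc k : measurable_fun setT (c k).
  by apply: measurableT_comp => //; apply: measurable_funB => //; exact: measurable_Pv'.
have c0 k w : (0 <= c k w)%R by exact: normr_ge0.
have sc (k : nat) : {ae P, forall w,
     wsum j (fun x => if predC1 v x then (`|Pv x w|)%:E else 0) <= (c k w)%:E}.
  apply: filterS weights_ae => w h; apply: le_trans (wsum_predC1_Pv h sv) _.
  by rewrite lee_fin (ger0_norm (Pv_ge0 v h)) ler_norm.
have := balls_event_le n GA mc c0 (S := fun=> predC1 v) sc.
under eq_integral do rewrite prodr_const_nat subn0.
congr (P (_ `&` _) <= _); apply/seteqP; split => w /=.
  move=> h; apply/negP => /occP[i ni bv].
  by have := h i ni; rewrite bv eqxx.
move=> h i ni; apply/eqP => bv; move/negP: h; apply; apply/occP.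
by exists i.
Qed.

Definition mismatch n j v w : \bar R :=
  ((n%:R * Pv v w < 1)%R && occ n j v w)%:R%:E +
  ((1 <= n%:R * Pv v w)%R && ~~ occ n j v w)%:R%:E.

Let sublevel n v : <<s G >> [set w | (n%:R * Pv v w < 1)%R].
Proof.
have mf : measurable_fun setT ((fun w => n%:R * Pv v w)%R : g_sigma_algebraType G -> R).
  by apply: measurable_funM => //; exact: Pv_weights.
have := mf measurableT _ (measurable_itv `]-oo, 1%R[); rewrite setTI.
by congr (<<s G >> _); apply/seteqP; split => w /=; rewrite in_itv.
Qed.

Let superlevel n v : <<s G >> [set w | (1 <= n%:R * Pv v w)%R].
Proof.
have := sigma_algebraC (sublevel n v).
by congr (<<s G >> _); apply/seteqP; split => w /=; rewrite leNgt => /negP.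
Qed.

Lemma mismatchE n j v w : mismatch n j v w =
  (\1_([set w | (n%:R * Pv v w < 1)%R] `&` [set w | occ n j v w]) w : R)%:E +
  (\1_([set w | (1 <= n%:R * Pv v w)%R] `&` [set w | ~~ occ n j v w]) w : R)%:E.
Proof.
rewrite /mismatch !indicE; congr (_%:R%:E + _%:R%:E); congr nat_of_bool.
  by apply/idP/idP; rewrite !inE /=; [move/andP|move=> h; apply/andP].
by apply/idP/idP; rewrite !inE /=; [move/andP|move=> h; apply/andP].
Qed.

Lemma measurable_mismatch n j v : measurable_fun setT (mismatch n j v).
Proof.
have -> : mismatch n j v = fun w =>
  (\1_([set w | (n%:R * Pv v w < 1)%R] `&` [set w | occ n j v w]) w : R)%:E +
  (\1_([set w | (1 <= n%:R * Pv v w)%R] `&` [set w | ~~ occ n j v w]) w : R)%:E.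
  by apply/funext => w; exact: mismatchE.
have mo : measurable [set w | ~~ occ n j v w].
  have := measurableC (measurable_occ n j v).
  by congr (measurable _); apply/seteqP; split => w /= /negP.
apply: emeasurable_funD; apply/measurable_EFinP; apply: measurable_indic;
  apply: measurableI => //.
- exact: Gm (sublevel n v).
- exact: measurable_occ.
- exact: Gm (superlevel n v).
Qed.

Lemma mismatch_ge0 n j v w : 0 <= mismatch n j v w.
Proof. by rewrite adde_ge0 // lee_fin. Qed.

(** Put [t = ln (n p)] with [p = Pv v]. A light box is hit with conditional probability at most
    [n p = exp t], by the union bound over the balls; a heavy one is missed with probability at most
    [(1 - p)^n <= 1 / (n p) = exp (- t)], by [pow1B_le]. *)
Lemma mismatch_mean n j v : size v = j ->
  \int[P]_w mismatch n j v w <=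
  \int[P]_w lnlift (EFin \o small) (n%:R * Pv v w)%R +
  \int[P]_w lnlift (EFin \o large) (n%:R * Pv v w)%R.
Proof.
move=> sv.
have mo : measurable [set w | ~~ occ n j v w].
  have := measurableC (measurable_occ n j v).
  by congr (measurable _); apply/seteqP; split => w /= /negP.
have mI1 := measurableI _ _ (Gm (sublevel n v)) (measurable_occ n j v).
have mI2 := measurableI _ _ (Gm (superlevel n v)) mo.
under eq_integral do rewrite mismatchE.
rewrite ge0_integralD //; try by [apply/measurable_EFinP; exact: measurable_indic|
  move=> w _; rewrite lee_fin indicE].
rewrite !integral_indic // !setIT.
have mN : measurable_fun setT (fun w => n%:R * Pv v w)%R.
  by apply: measurable_funM => //; exact: measurable_Pv'.
have [ms s0] := borel_ge0_lift (@borel_ge0_small R).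
have [ml l0] := borel_ge0_lift (@borel_ge0_large R).
apply: leeD.
  set A := [set w | (n%:R * Pv v w < 1)%R]; have mA : measurable A := Gm (sublevel n v).
  have -> : A `&` [set w | occ n j v w] =
     \bigcup_(i in `I_n) (A `&` [set w | bx i j w = v]).
    rewrite -setI_bigcupr; congr (_ `&` _).
    by apply/seteqP; split => w /=; [move/occP => [i ni e]; exists i|
      move=> [i ni e]; apply/occP; exists i].
  have mAb i : measurable (A `&` [set w | bx i j w = v]).
    by apply: measurableI => //; exact: measurable_box.
  apply: (@le_trans _ _ (\sum_(i < n) P (A `&` [set w | bx i j w = v]))).
    apply: (@content_subadditive _ _ _ P _ (fun i => A `&` [set w | bx i j w = v]) n) => //.
      by rewrite bigcup_mkord; apply: bigsetU_measurable.
    by rewrite bigcup_mkord.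
  apply: (@le_trans _ _ (\sum_(i < n) \int[P]_(w in A) (`|Pv v w|)%:E)).
    by apply: lee_sum => i _; apply: box_probability_le; exact: sublevel.
  have mp : measurable_fun A (fun w => (`|Pv v w|)%:E).
    apply/measurable_EFinP; apply: measurable_funTS; apply: measurableT_comp => //.
    exact: measurable_Pv'.
  rewrite sume_ord_const; last by apply: integral_ge0 => w _; rewrite lee_fin.
  rewrite -ge0_integralZl_EFin //.
  rewrite integral_mkcond; apply: ae_ge0_le_integral; first by [].
  - by move=> w _; rewrite patchE; case: ifP => // _; rewrite mule_ge0 // lee_fin.
  - by apply/(measurable_restrictT _ mA); exact: measurable_funeM.
  - by move=> w _; exact: s0.
  - exact: measurableT_comp.
  apply: filterS weights_ae => w h _; rewrite patchE; case: ifPn => // wA.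
  have p0 := Pv_ge0 v h; rewrite ger0_norm // -EFinM /lnlift.
  have := wA; rewrite inE /A /= => lt1.
  case: ifPn => y0; last by rewrite lee_fin leNgt.
  by rewrite /= /small ln_lt0 ?y0 // lnK.
set A := [set w | (1 <= n%:R * Pv v w)%R]; have mA : measurable A := Gm (superlevel n v).
apply: le_trans (avoid_probability_le n sv (superlevel n v)) _.
rewrite integral_mkcond; apply: ae_ge0_le_integral; first by [].
- by move=> w _; rewrite patchE; case: ifP => // _; rewrite lee_fin exprn_ge0.
- apply/(measurable_restrictT _ mA)/measurable_EFinP; apply: measurable_funTS.
  apply: measurable_funX; apply: measurableT_comp => //.
  by apply: measurable_funB => //; exact: measurable_Pv'.
- by move=> w _; exact: l0.
- exact: measurableT_comp.
apply: filterS weights_ae => w h _; rewrite patchE; case: ifPn => // wA.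
have p0 := Pv_ge0 v h; have p1 := Pv_le1 v h.
have := wA; rewrite inE /A /= => ge1.
have y0 : (0 < n%:R * Pv v w)%R by exact: lt_le_trans ltr01 ge1.
rewrite /lnlift y0 /= /large ln_ge0 // lee_fin expRN lnK ?posrE //.
rewrite ger0_norm ?subr_ge0 // -[leRHS]mul1r ler_pdivlMr //.
apply: le_trans (pow1B_le n (u := Pv v w) _); last by rewrite p0.
by rewrite ler_wpM2l ?exprn_ge0 ?subr_ge0 // lerDr.
Qed.

Lemma occupied_wsum n j w :
  ((occupied (fun i k => C i k) n j w)%:R : R)%:E = wsum j (fun v => (occ n j v w)%:R%:E).
Proof.
set B := [set v : word | size v = j /\ exists2 i, (i < n)%N & bx i j w = v].
have fB : finite_set B.
  have : finite_set [set bx i j w | i in `I_n] by exact: finite_image.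
  by apply: sub_finite_set => v [_ [i ni e]]; exists i.
rewrite (eq_wsum (G := fun v => \sum_(x <- fset_set B) (if v == x then 1 else 0))); last first.
  move=> v sv; have [ov|ov] := boolP (occ n j v w).
    have vB : v \in fset_set B by rewrite in_fset_set // inE; split => //; exact/occP.
    rewrite (big_fsetD1 v) //= eqxx big1_seq ?adde0 // => x /andP[_].
    by rewrite !inE eq_sym => /andP[/negbTE ->].
  rewrite big1_seq // => x /andP[_]; rewrite in_fset_set // inE => -[_ h].
  case: eqP => // vx; move: ov; rewrite vx => /negP; case; exact/occP.
rewrite wsum_sum; last by move=> x v; case: ifP.
rewrite (eq_big_seq (fun=> 1%E)); last first.
  move=> x; rewrite in_fset_set // inE => -[sx _].
  by rewrite (wsum_pred1 _ (F := fun=> 1%E)) // sx eqxx.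
rewrite (_ : \sum_(x <- fset_set B) 1 = (size (fset_set B))%:R%:E) //.
by rewrite sumEFin big_const_seq count_predT iter_addr_0.
Qed.

End Balls.

(** * Deviation bound *)

(* The pointwise form of Chebyshev's inequality, rearranged so that nothing is
   subtracted: N and D may be infinite. *)
Lemma deviation_pointwise {R : realType} (K G e : R) (N D : \bar R) (b : bool) :
  0 < G -> 0 < e -> (0 <= N)%E -> (0 <= D)%E ->
  (K%:E <= N + D)%E -> (N <= K%:E + D)%E -> (b -> e < `|K / G - 1|) ->
  ((2 * G)%:E * N + (e ^+ 2 / 4 * G ^+ 2)%:E * (b%:R)%:E
   <= N * N + (G ^+ 2)%:E + (e / 2 * G)%:E * D)%E.
Proof.
move=> G0 e0 N0 + KN NK hb; case: D KN NK => [D||] //; last first.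
  move=> _ _ _; rewrite gt0_muley ?lte_fin ?mulr_gt0 ?divr_gt0 //.
  by rewrite addey ?leey // gt_eqF // (lt_le_trans (ltNyr 0)) // adde_ge0 ?mule_ge0 // lee_fin sqr_ge0.
move=> KN NK; rewrite lee_fin => D0.
have Nf : N \is a fin_num.
  by rewrite ge0_fin_numE //; apply: le_lt_trans NK _; rewrite -EFinD ltry.
move: N0 KN NK; rewrite -(fineK Nf); move: (fine N) => {Nf}N.
rewrite -!EFinM -!EFinD !lee_fin => N0 KN NK.
have eG : 0 < e * G by rewrite mulr_gt0.
have sq : 0 <= (N - G) ^+ 2 := sqr_ge0 _.
have eGD : 0 <= e / 2 * G * D by rewrite !mulr_ge0 ?divr_ge0 // ltW.
case: b hb => [/(_ isT) hb|_]; last by rewrite mulr0 addr0; nra.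
(* Either [D] accounts for half of the deviation and its term alone pays [e^2 / 4 * G^2], or [N] is
   at distance at least [e / 2 * G] from [G] and [(N - G)^2] pays. *)
rewrite mulr1; have [DG|DG] := leP (e / 2 * G) D.
  have : (e / 2 * G) * (e / 2 * G) <= e / 2 * G * D.
    by rewrite ler_wpM2l // mulr_ge0 ?divr_ge0 // ltW.
  nra.
have hK : e * G < `|K - G|.
  have -> : K - G = (K / G - 1) * G by rewrite mulrBl divfK ?gt_eqF // mul1r.
  by rewrite normrM (gtr0_norm G0) ltr_pM2r.
suff : (e / 2 * G) ^+ 2 <= (N - G) ^+ 2 by nra.
have h0 : 0 <= e / 2 * G by rewrite mulr_ge0 ?divr_ge0 // ltW.
rewrite -[leRHS]real_normK ?num_real // lerXn2r ?nnegrE //.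
move: hK; rewrite ltr_normr => /orP[hK|hK].
  by apply: le_trans (ler_norm _); lra.
by rewrite -normrN; apply: le_trans (ler_norm _); lra.
Qed.

Section Deviation.
Context {d : measure_display} {T : measurableType d} {R : realType}.
Variable P : probability T R.
Variable W : {RV P >-> R}.
Variable X : nat -> {RV P >-> R}.
Variable Pw : word -> nat -> {RV P >-> R}.
Variable C : nat -> nat -> {RV P >-> nat}.
Hypothesis W01 : forall w, 0 < W w < 1.
Hypothesis X_iid : iid_copies W X.
Hypothesis nested : nested_occupancy (stick_breaking (fun r => X r)) Pw C.
Variables m M2 rho e1 : R.
Hypothesis xi_m : has_mean P (xi W) m.
Hypothesis xi_M2 : has_mean P (fun w => xi W w ^+ 2) M2.
Hypothesis W_rho : has_mean P W rho.
Hypothesis eta_e1 : has_mean P (eta W) e1.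

Let Pw_law := weights_copies nested.
Let Pw_indep := weights_independent nested.
Local Notation A := (splitE P W).
Local Notation phi := (phi m M2 rho).
Local Notation psi := (psi m M2 rho).
Local Notation a := (cstA m M2 rho).
Local Notation e0 := (EFin \o tpow 0 0).

Let a0 : 0 <= a. Proof. exact: cstA_ge0 xi_m xi_M2 W_rho. Qed.
Let m0 : 0 < m. Proof. exact: m_gt0 xi_m. Qed.

(** Unrolls [pair_sum_step]; the term [i] collects the pairs whose last common ancestor is in
    generation [i]. The exponent [k] is general because [splitE] sends [phi k] below [phi k.+1]. *)
Lemma pair_sum_phi j k y : 0 < y ->
  (pair_sum Pw j (EFin \o phi k) y <=
   (\sum_(i < j) psi (k + j - i)%N (ln y) * phi i (ln y))%:E)%E.
Proof.
move=> y0; elim: j k => [|j IH] k; first by rewrite big_ord0.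
have hphi l : borel_ge0 (EFin \o phi l) by exact: (borel_ge0_phi W01 xi_m xi_M2 W_rho).
have hA : borel_ge0 (A (EFin \o phi k)) by exact: (borel_ge0_splitE W01 (hphi k)).
have hA2 : borel_ge0 (A2 P W (EFin \o phi k)) by exact: (borel_ge0_A2 W01 (hphi k)).
apply: le_trans (pair_sum_step W01 X_iid Pw_law Pw_indep j y (hphi k) _ _) _ => //.
  by move=> s t st; rewrite lee_fin; exact: (phi_mono W01 xi_m xi_M2 W_rho).
rewrite big_ord_recr /= EFinD; apply: leeD.
  apply: (@le_trans _ _ (pair_sum Pw j (EFin \o phi k.+1) y)).
    apply: le_pair_sum => // t; exact: (A_phi W01 xi_m xi_M2 W_rho eta_e1).
  apply: le_trans (IH k.+1) _; rewrite lee_fin ler_sum // => i _.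
  by rewrite addSnnS.
have -> : (k + j.+1 - j = k.+1)%N by rewrite -addSnnS addnK.
rewrite /lnlift y0.
apply: le_trans (iterA_psi W01 xi_m xi_M2 W_rho eta_e1 k.+1 j (ln y)).
apply: (le_iterA xi_m eta_e1) => //.
  exact: (borel_ge0_psi W01 xi_m xi_M2 W_rho).
by move=> t; exact: (A2_phi W01 xi_m xi_M2 W_rho).
Qed.

Section FixedN.
Variables (n j : nat) (eps e : R).
Hypotheses (e_gt0 : 0 < e) (eps_ge0 : 0 <= eps) (j_gt0 : (0 < j)%N) (n_gt0 : (0 < n)%N).
Local Notation L := (ln (n%:R : R)).
Hypothesis jL : j%:R ^+ 2 <= eps * L.
Hypothesis eps_a : (4 * a + m) * eps <= 1 / 2.
Hypothesis eps_e1 : e1 * eps <= 1.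
Local Notation G := (gterm m j L).
Local Notation kap := (kap rho).

Let L_gt0 : 0 < L.
Proof.
have j1 : 1 <= j%:R ^+ 2 :> R by rewrite -natrX ler1n expn_gt0 j_gt0.
rewrite ltNge; apply/negP => L0; have := le_trans j1 jL; apply/negP.
by rewrite -ltNge; apply: le_lt_trans ltr01; rewrite mulr_ge0_le0.
Qed.

Let n0 : 0 < n%:R :> R. Proof. by rewrite ltr0n. Qed.
Let G_gt0 : 0 < G. Proof. exact: gterm_gt0. Qed.
Let kap0 : 0 < kap. Proof. exact: (kap_gt0 W01 W_rho). Qed.
Let e1_0 : 0 <= e1. Proof. exact: (e1_ge0 eta_e1). Qed.
Local Notation x := (L + j.+1%:R * a).

Let shift_ge0 k : 0 <= L + k%:R * a.
Proof. by apply: addr_ge0; [exact: ltW|apply: mulr_ge0]. Qed.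

Let phi_gterm i : (i <= j)%N -> phi i L <= gterm m i x.
Proof.
move=> ij; rewrite /phi /tpow (ltW L_gt0); apply: le_gterm => //.
by rewrite lerD2l ler_wpM2r // ler_nat leqW.
Qed.

Let psi_gterm k : (k <= j)%N -> psi k L <= gterm m k x ^+ 2.
Proof.
move=> kj; rewrite /psi /tpow (ltW L_gt0).
have L0 : 0 <= L + k.+1%:R * a by exact: shift_ge0.
have H : gterm m k (L + k.+1%:R * a) <= gterm m k x.
  by apply: le_gterm => //; rewrite lerD2l ler_wpM2r // ler_nat ltnS.
by apply: lerXn2r => //; rewrite nnegrE; apply: gterm_ge0 => //; exact: shift_ge0.
Qed.

Local Notation N := (nbig Pw j n%:R).

Lemma mean_N_ge : ((G * (1 - e1 * eps))%:E <= \int[P]_w N w)%E.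
Proof.
rewrite (nbig_mean W01 X_iid Pw_law Pw_indep) /lnlift n0.
apply: le_trans (iterA_low W01 xi_m W_rho eta_e1 j L).
have [jc H] := gterm_low m0 L_gt0 e1_0 j_gt0 jL eps_e1.
by rewrite lee_fin /low tpowE0 ?subr_ge0.
Qed.

Lemma mean_sqr_N_le :
  (\int[P]_w (N w * N w) <= ((1 + 2 * (4 * a + m) * eps) * G ^+ 2)%:E)%E.
Proof.
apply: le_trans (nbig_sqr_mean W01 X_iid Pw_law Pw_indep j n%:R) _.
have hp := @pair_sum_phi j 0%N n%:R n0; rewrite phi0 in hp.
rewrite /lnlift n0.
apply: le_trans (leeD (iterA_phi W01 xi_m xi_M2 W_rho eta_e1 j L) hp) _.
rewrite -EFinD lee_fin.
apply: le_trans _ (gterm_convolution_le m0 L_gt0 a0 j_gt0 eps_ge0 jL eps_a).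
(* The diagonal pairs supply the term [i = j] of the convolution, where [gterm m 0 x = 1]. *)
rewrite big_ord_recr /= subnn [leRHS]addrC; apply: lerD.
  have -> : gterm m 0 x = 1 by rewrite /gterm !expr0 mulr1 divr1.
  by rewrite expr1n mulr1 phi_gterm.
apply: ler_sum => i _; rewrite add0n mulrC.
apply: ler_pM; rewrite ?psi_ge0 ?(phi_ge0 W01 xi_m xi_M2 W_rho) //.
  by apply: phi_gterm; exact: ltnW.
by apply: psi_gterm; exact: leq_subr.
Qed.

Local Notation D := (fun w => wsum j (fun v => mismatch Pw C n j v w)).

(** Light boxes contribute [kap S] and heavy ones at most [2 kap S], where [S <= 2 m eps G]; hence
    the 6. The own term [small L] vanishes because [0 < L]. *)
Lemma mean_D_le : (\int[P]_w D w <= (6 * kap * m * eps * G)%:E)%E.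
Proof.
have mD v : measurable_fun setT (mismatch Pw C n j v).
  exact: measurable_mismatch.
rewrite (wsum_integral P j (F := fun v w => mismatch Pw C n j v w)) //; last first.
  by move=> v w; exact: mismatch_ge0.
apply: (@le_trans _ _ (wsum j (fun v =>
   (\int[P]_w lnlift (EFin \o small) (n%:R * Pv Pw v w)%R +
   \int[P]_w lnlift (EFin \o large) (n%:R * Pv Pw v w)%R)%E))).
  apply: le_wsum => [v|v sv]; first by apply: integral_ge0 => w _; exact: mismatch_ge0.
  exact: (mismatch_mean W01 X_iid nested).
have bs := @borel_ge0_small R; have bl := @borel_ge0_large R.
rewrite wsumD; last 2 first.
- by move=> v; apply: integral_ge0 => w _; exact: (borel_ge0_lift bs).2.
- by move=> v; apply: integral_ge0 => w _; exact: (borel_ge0_lift bl).2.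
rewrite !(first_moment W01 X_iid Pw_law Pw_indep) // /lnlift n0.
have Hs := iterA_small W01 xi_m xi_M2 W_rho eta_e1 j L.
have Hl := iterA_large W01 xi_m xi_M2 W_rho eta_e1 j.-1 L; rewrite prednK // in Hl.
apply: le_trans (leeD Hs Hl) _; rewrite -EFinD lee_fin.
have -> : small L = 0 by rewrite /small ltNge ltW.
rewrite add0r.
set S := \sum_(i < j) phi i L.
have S1 : phi j.-1 L <= S.
  have jj : (j.-1 < j)%N by rewrite prednK.
  rewrite /S (bigD1 (Ordinal jj)) //= lerDl sumr_ge0 // => i _.
  exact: (phi_ge0 W01 xi_m xi_M2 W_rho).
have S2 : S <= 2 * m * eps * G.
  apply: le_trans (gterm_sum_small m0 L_gt0 a0 j_gt0 eps_ge0 jL eps_a).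
  by apply: ler_sum => i _; apply: phi_gterm; exact: ltnW.
have k2 : kap * phi j.-1 L <= kap * S by rewrite ler_wpM2l // ltW.
have k3 : kap * S <= kap * (2 * m * eps * G) by rewrite ler_wpM2l // ltW.
lra.
Qed.

Local Notation K w := ((occupied (fun i k => C i k) n j w)%:R : R).

Lemma occupied_le w : ((K w)%:E <= N w + D w)%E.
Proof.
rewrite occupied_wsum /nbig -wsumD; last 2 first.
- by move=> v; rewrite /lnlift; case: ifP => // _; rewrite lee_fin tpow_ge0.
- by move=> v; exact: mismatch_ge0.
apply: le_wsum => [v|v _]; first by rewrite lee_fin.
have [y1|y1] := leP 1 (n%:R * Pv Pw v w).
  rewrite /lnlift (lt_le_trans ltr01 y1) /= tpowE0 ?ln_ge0 // expr0.
  by apply: (@le_trans _ _ 1%E); [rewrite lee_fin lern1; case: occ|rewrite leeDl // mismatch_ge0].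
have y1' := y1; rewrite ltNge in y1'; rewrite /mismatch y1 (negbTE y1') /= adde0 leeDr //.
by rewrite /lnlift; case: ifP => // _; rewrite lee_fin tpow_ge0.
Qed.

Lemma le_occupied w : (N w <= (K w)%:E + D w)%E.
Proof.
rewrite occupied_wsum /nbig -wsumD; last 2 first.
- by move=> v; rewrite lee_fin.
- by move=> v; exact: mismatch_ge0.
apply: le_wsum => [v|v _].
  by rewrite /lnlift; case: ifP => // _; rewrite lee_fin tpow_ge0.
rewrite /lnlift; have [y1|y1] := leP 1 (n%:R * Pv Pw v w).
  rewrite (lt_le_trans ltr01 y1) /= tpowE0 ?ln_ge0 // expr0 /mismatch y1 ltNge y1 /= add0e.
  by case: occ => /=; rewrite ?adde0 ?add0e.
case: ifP => y0; last by rewrite adde_ge0 ?lee_fin // mismatch_ge0.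
by rewrite /= tpow_lt0 ?ln_lt0 ?y0 // adde_ge0 ?lee_fin // mismatch_ge0.
Qed.

Lemma measurable_occupied : measurable_fun setT (fun w => K w).
Proof.
apply/measurable_EFinP.
have -> : EFin \o (fun w => K w) = fun w => wsum j (fun v => (occ C n j v w)%:R%:E).
  by apply/funext => w /=; rewrite occupied_wsum.
apply: (measurable_wsum j (F := fun v w => (occ C n j v w)%:R%:E)) => [v|v w].
  have -> : (fun w => (occ C n j v w)%:R%:E) =
    EFin \o (\1_([set w | occ C n j v w]) : T -> R).
    apply/funext => w /=; rewrite indicE; congr (_%:R%:E); congr nat_of_bool.
    by apply/idP/idP; rewrite inE.
  by apply/measurable_EFinP; apply: measurable_indic; exact: measurable_occ.
by rewrite lee_fin.
Qed.

(** Integrate [deviation_pointwise]. The bounds on the two moments make the terms [2 G^2] cancel, so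
    only terms of order [eps] remain: [2 (4 a + m)] from the second moment, [2 e1] from the first,
    and [3 e kap m = (e / 2) 6 kap m] from the mismatches. *)
Lemma deviation_probability :
  (P [set w | (e < `|j`!%:R * m ^+ j * K w / L ^+ j - 1|)%R] <=
   (4 / e ^+ 2 * (2 * (4 * a + m) + 2 * e1 + 3 * e * kap * m) * eps)%:E)%E.
Proof.
have Z w : j`!%:R * m ^+ j * K w / L ^+ j = K w / G.
  rewrite /gterm invf_div; field.
  by rewrite expf_neq0 // gt_eqF.
set B := [set w | _].
have mB : measurable B.
  have -> : B = setT `&` (fun w => `|j`!%:R * m ^+ j * K w / L ^+ j - 1|) @^-1` `]e, +oo[%classic.
    by rewrite setTI; apply/seteqP; split => w /=; rewrite in_itv /= andbT.
  have : measurable_fun setT (fun w => `|j`!%:R * m ^+ j * K w / L ^+ j - 1|).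
    apply: measurableT_comp => //; apply: measurable_funB => //.
    apply: measurable_funM => //; apply: measurable_funM => //.
    exact: measurable_occupied.
  by apply => //; exact: measurable_itv.
have mN : measurable_fun setT N by exact: measurable_nbig.
have N0 w : (0 <= N w)%E by exact: nbig_ge0.
have mD v : measurable_fun setT (mismatch Pw C n j v).
  exact: measurable_mismatch.
have mDs : measurable_fun setT D.
  by apply: (measurable_wsum j (F := mismatch Pw C n j)) => // *; exact: mismatch_ge0.
have D0 w : (0 <= D w)%E by apply: wsum_ge0 => v; exact: mismatch_ge0.
have c0 : 0 <= e ^+ 2 / 4 * G ^+ 2 
  by apply: mulr_ge0; [apply: divr_ge0; rewrite ?sqr_ge0|exact: sqr_ge0].
have G2 : 0 <= 2 * G by apply: mulr_ge0 => //; exact: ltW.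
have eG : 0 <= e / 2 * G.
  by apply: mulr_ge0; [apply: divr_ge0 => //|]; exact: ltW.
have key : ((2 * G)%:E * \int[P]_w N w + (e ^+ 2 / 4 * G ^+ 2)%:E * P B <=
   \int[P]_w (N w * N w) + (G ^+ 2)%:E + (e / 2 * G)%:E * \int[P]_w D w)%E.
  have mI1 : measurable_fun setT (fun w => (\1_B w : R)%:E).
    by apply/measurable_EFinP; exact: measurable_indic.
  have I1 w : (0 <= (\1_B w : R)%:E)%E by rewrite lee_fin indicE.
  have -> : P B = (\int[P]_w (\1_B w : R)%:E)%E by rewrite integral_indic // setIT.
  rewrite -(ge0_integralZl_EFin _ _ _ _ G2) // -(ge0_integralZl_EFin _ _ _ _ c0) //.
  rewrite -(ge0_integralZl_EFin _ _ _ _ eG) //.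
  have -> : (G ^+ 2)%:E = (\int[P]_w (cst (G ^+ 2)%:E w))%E.
    by rewrite integral_cst //= probability_setT mule1.
  have mI : measurable_fun setT (fun w => (e ^+ 2 / 4 * G ^+ 2)%:E * (\1_B w : R)%:E)%E.
    by apply: measurable_funeM; apply/measurable_EFinP; exact: measurable_indic.
  have I0 w : (0 <= (e ^+ 2 / 4 * G ^+ 2)%:E * (\1_B w : R)%:E)%E.
    by rewrite mule_ge0 // lee_fin // indicE.
  have mNG : measurable_fun setT (fun w => (2 * G)%:E * N w)%E by exact: measurable_funeM.
  have NG0 w : (0 <= (2 * G)%:E * N w)%E by rewrite mule_ge0.
  have mNN : measurable_fun setT (fun w => N w * N w)%E by exact: emeasurable_funM.
  have NN0 w : (0 <= N w * N w)%E by rewrite mule_ge0.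
  have mDD : measurable_fun setT (fun w => (e / 2 * G)%:E * D w)%E by exact: measurable_funeM.
  have DD0 w : (0 <= (e / 2 * G)%:E * D w)%E by rewrite mule_ge0.
  have G20 : (0 <= (G ^+ 2)%:E :> \bar R)%E by rewrite lee_fin sqr_ge0.
  have mS : measurable_fun setT (fun w => N w * N w + cst (G ^+ 2)%:E w)%E.
    exact: emeasurable_funD.
  have S0 w : (0 <= N w * N w + cst (G ^+ 2)%:E w)%E by rewrite adde_ge0.
  rewrite -(ge0_integralD P measurableT _ mNG _ mI) //.
  rewrite -(ge0_integralD P measurableT (f2 := cst (G ^+ 2)%:E) _ mNN) //.
  rewrite -(ge0_integralD P measurableT _ mS _ mDD) //.
  apply: ge0_le_integral => //.
  - by move=> w _; rewrite adde_ge0.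
  - exact: emeasurable_funD.
  - by apply: emeasurable_funD => //; exact: emeasurable_funD.
  move=> w _; rewrite indicE.
  apply: deviation_pointwise => //; first exact: occupied_le.
    exact: le_occupied.
  by rewrite inE /B /= Z.
have PBf : P B \is a fin_num by rewrite fin_num_measure.
rewrite -(fineK PBf) lee_fin; move: key; rewrite -(fineK PBf); move: (fine (P B)) => p key.
have E1 : ((2 * G * (G * (1 - e1 * eps)) + e ^+ 2 / 4 * G ^+ 2 * p)%:E <=
   ((1 + 2 * (4 * a + m) * eps) * G ^+ 2 + G ^+ 2 + e / 2 * G * (6 * kap * m * eps * G))%:E)%E.
  apply: le_trans (le_trans _ key) _.
    rewrite EFinD !EFinM leeD2r // lee_wpmul2l ?lee_fin // -EFinM.
    exact: mean_N_ge.
  rewrite [leRHS]EFinD EFinD; apply: leeD; first by rewrite leeD2r // mean_sqr_N_le.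
  by rewrite [leRHS]EFinM lee_wpmul2l ?lee_fin // mean_D_le.
rewrite lee_fin in E1.
have GG : 0 < G ^+ 2 by rewrite exprn_gt0.
have E2 : e ^+ 2 / 4 * p <= (2 * (4 * a + m) + 2 * e1 + 3 * e * kap * m) * eps.
  rewrite -(ler_pM2r GG).
  move: E1; rewrite !expr2; move: G => g E1; lra.
have e2 : 0 < e ^+ 2 / 4 by rewrite divr_gt0 // exprn_gt0.
rewrite -(ler_pM2l e2); apply: le_trans E2 _; rewrite le_eqVlt; apply/orP; left; apply/eqP.
by field; rewrite gt_eqF.
Qed.

End FixedN.

End Deviation.

Lemma littleo_sqrt_ln {R : realType} (j : nat -> nat) (eps : R) : 0 < eps ->
  (fun n => (j n)%:R : R) =o_\oo (fun n => Num.sqrt (ln n%:R) : R) ->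
  \forall n \near \oo, (j n)%:R ^+ 2 <= eps * ln (n%:R : R).
Proof.
move=> eps0 /eqoP /(_ (Num.sqrt eps)); rewrite sqrtr_gt0 => /(_ eps0) H.
near=> n.
have n1 : 1 <= n%:R :> R by rewrite ler1n; near: n; exists 1%N.
have : `|(j n)%:R : R| <= Num.sqrt eps * `|Num.sqrt (ln n%:R) : R| by near: n.
rewrite ger0_norm // ger0_norm ?sqrtr_ge0 // => jn.
rewrite -[eps in leRHS]sqr_sqrtr ?(ltW eps0) // -[ln _ in leRHS]sqr_sqrtr ?ln_ge0 // -exprMn.
by apply: lerXn2r => //; rewrite nnegrE // mulr_ge0 ?sqrtr_ge0.
Unshelve. all: by end_near. Qed.

Lemma log_moments {d : measure_display} {T : measurableType d} {R : realType}
    (P : probability T R) (W : {RV P >-> R}) :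
  (forall w, 0 < W w < 1) ->
  ('E_P[fun w => (ln (W w) ^+ 2)%R] < +oo)%E ->
  ('E_P[fun w => `|ln (1 - W w)|%R] < +oo)%E ->
  exists M2 rho e1, [/\ has_mean P (xi W) (fine 'E_P[xi W]),
    has_mean P (fun w => xi W w ^+ 2) M2, has_mean P W rho & has_mean P (eta W) e1].
Proof.
move=> W01 hM2 he1.
have mW : measurable_fun setT W by exact: measurable_funPT.
have mxi : measurable_fun setT (xi W).
  by apply: measurableT_comp => //; exact: measurableT_comp (@measurable_ln R) mW.
have xi2 : (fun w => xi W w ^+ 2) = (fun w => ln (W w) ^+ 2).
  by apply/funext => w; rewrite /xi real_normK ?num_real.
have [M2 hM] : exists M2, has_mean P (fun w => xi W w ^+ 2) M2.
  eexists; apply: has_mean_fine; last by rewrite xi2.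
    by apply: measurable_funX.
  by move=> w; exact: sqr_ge0.
(* Integrability of [xi] follows from that of its square through [xi <= 1 + xi^2]. *)
have [m hm] : exists m, has_mean P (xi W) m.
  apply: (has_mean_ex mxi _ (has_meanD (has_mean_cst P 1) hM)) => w /=.
  rewrite normr_ge0 /=; have := sqr_ge0 (xi W w - 1); have := sqr_ge0 (xi W w).
  rewrite /xi /=; nra.
have [rho hr] : exists rho, has_mean P W rho.
  apply: (has_mean_ex mW _ (has_mean_cst P 1)) => w /=.
  by have /andP[w0 w1] := W01 w; rewrite !ltW.
have he : has_mean P (eta W) (fine 'E_P[eta W]).
  apply: has_mean_fine => //; last by move=> w; exact: normr_ge0.
  apply: measurableT_comp => //; apply: measurableT_comp (@measurable_ln R) _.
  by apply: measurable_funB.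
exists M2, rho, (fine 'E_P[eta W]); split => //.
by rewrite (has_mean_E hm).
Qed.

Lemma small_factor {R : realFieldType} (x y z delta : R) :
  0 <= x -> 0 <= y -> 0 <= z -> 0 < delta ->
  exists2 eps, 0 < eps & [/\ x * eps <= 1 / 2, y * eps <= 1 & z * eps <= delta].
Proof.
move=> x0 y0 z0 delta0; pose del := Num.min 1 delta; pose D := 2 * x + y + z + 1.
have D0 : 0 < D by rewrite /D; lra.
have del0 : 0 < del by rewrite lt_min ltr01.
have del1 : del <= 1 by rewrite ge_min lexx.
have deld : del <= delta by rewrite ge_min lexx orbT.
have eps0 : 0 < del / D by rewrite divr_gt0.
exists (del / D) => //.
have : D * (del / D) = del by rewrite mulrC divfK ?gt_eqF.
have := mulr_ge0 x0 (ltW eps0); have := mulr_ge0 y0 (ltW eps0).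
have := mulr_ge0 z0 (ltW eps0).
by move: (del / D) eps0 => eps eps0 ? ? ?; rewrite /D => ?; split; lra.
Qed.

Theorem mainTheorem2 (R : realType) (d : measure_display)
    (T : measurableType d) (P : probability T R)
    (W : {RV P >-> R}) (W_ : nat -> {RV P >-> R})
    (Pw : word -> nat -> {RV P >-> R}) (C : nat -> nat -> {RV P >-> nat})
    (j : nat -> nat) :
  (forall w, 0 < W w < 1) ->
  iid_copies W W_ ->
  ('E_P[fun w => (ln (W w) ^+ 2)%R] < +oo)%E ->
  ('E_P[fun w => `|ln (1 - W w)|%R] < +oo)%E ->
  nested_occupancy (stick_breaking (fun r => W_ r)) Pw C ->
  (forall n, (0 < n)%N -> (0 < j n)%N) ->
  (fun n => (j n)%:R : R) =o_\oo (fun n => Num.sqrt (ln n%:R) : R) ->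
  cvg_in_probability P
    (fun n w => (j n)`!%:R * fine 'E_P[fun w' => `|ln (W w')|] ^+ j n
                * (occupied C n (j n) w)%:R / ln n%:R ^+ j n)
    1.
Proof.
move=> W01 W_iid hM2 he1 nested j_gt0 j_small e e0.
have [M2 [rho [e1 [xi_m xi_M2 W_rho eta_e1]]]] := log_moments W01 hM2 he1.
(* The expectation in the goal is that of [xi W] up to conversion, so it is replaced by [m] there
   too. *)
move: (fine 'E_P[xi W]) xi_m => m xi_m.
pose B n := [set w | e < `|(j n)`!%:R * m ^+ j n
                * (occupied C n (j n) w)%:R / ln n%:R ^+ j n - 1|].
pose a := cstA m M2 rho; pose kp := kap rho.
pose c := 4 / e ^+ 2 * (2 * (4 * a + m) + 2 * e1 + 3 * e * kp * m).
have a0 : 0 <= a := cstA_ge0 W01 xi_m xi_M2 W_rho.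
have m0 : 0 < m := m_gt0 W01 xi_m.
have kp0 : 0 < kp := kap_gt0 W01 W_rho.
have e10 : 0 <= e1 := e1_ge0 eta_e1.
have am0 : 0 <= 4 * a + m by lra.
have c0 : 0 <= c.
  apply: mulr_ge0; first by rewrite divr_ge0 // sqr_ge0.
  have := mulr_gt0 (mulr_gt0 e0 kp0) m0; lra.
have small delta : 0 < delta -> \forall n \near \oo, (P (B n) <= delta%:E)%E.
  move=> delta0.
  have [eps eps0 [p1 p2 p3]] := small_factor am0 e10 c0 delta0.
  near=> n.
  have n0 : (0 < n)%N by near: n; exists 1%N.
  have jL : (j n)%:R ^+ 2 <= eps * ln (n%:R : R) by near: n; exact: littleo_sqrt_ln.
  apply: le_trans (deviation_probability W01 W_iid nested xi_m xi_M2 W_rho eta_e1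
    e0 (ltW eps0) (j_gt0 n n0) n0 jL p1 p2) _.
  by rewrite lee_fin.
rewrite -[X in X @ _]/(fun n => P (B n)); apply: cvg_EFin.
  apply: filterS (small 1 ltr01) => n Pn.
  by rewrite ge0_fin_numE //; apply: le_lt_trans Pn (ltry 1).
apply/cvgr0Pnorm_le => delta /small; apply: filterS => n /= Pn.
rewrite ger0_norm ?fine_ge0 // -lee_fin fineK // ge0_fin_numE //.
exact: le_lt_trans Pn (ltry delta).
Unshelve. all: by end_near. Qed.
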